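(* The decision problem $\mathrm{DWR}^{\exists,>0}$ belongs to P, and for an MDP $\mathcal{M}$, state $s$, and a DWR-property with $T\setminus T^*=\{\mathit{goal}\}$, the value $K^{\exists,>0}_{\mathcal{M},s}$ is computable in polynomial time.
   Context: An MDP $\mathcal{M}=(S,\mathit{Act},P,\mathit{wgt})$ has finite state and action sets, rational transition probabilities and integer weights on state-action pairs; paths, path weights, schedulers and $\Pr^{\mathfrak{S}}_{\mathcal{M},s}$ are standard. A disjunctive weight-bounded reachability (DWR) property is given by a set $T\subseteq S$ and thresholds $K_t\in\mathbb{Z}\cup\{-\infty\}$ for $t\in T$, and is $\varphi=\bigvee_{t\in T}\Diamond(t\wedge(\mathrm{wgt}\geqslant K_t))$: a path satisfies it iff it has a finite prefix ending in some $t\in T$ with accumulated weight at least $K_t$. $T^*=\{t\in T:K_t=-\infty\}$. $\mathrm{DWR}^{\exists,>0}$: given $\mathcal{M}$, $s$ and $\varphi$, does there exist a scheduler $\mathfrak{S}$ with $\Pr^{\mathfrak{S}}_{\mathcal{M},s}(\varphi)>0$? When $T\setminus T^*=\{\mathit{goal}\}$, write $\varphi_K$ for $\varphi$ with $K_{\mathit{goal}}=K$, and $K^{\exists,>0}_{\mathcal{M},s}=\sup\{K\in\mathbb{Z}:\exists\mathfrak{S}.\ \Pr^{\mathfrak{S}}_{\mathcal{M},s}(\varphi_K)>0\}\in\mathbb{Z}\cup\{\pm\infty\}$. *)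

(* Defs.v *)
From HB Require Import structures.
From mathcomp Require Import all_boot all_order all_algebra.
From mathcomp Require Import all_classical all_reals all_analysis.
From Stdlib Require BinNums.

Set Implicit Arguments.
Unset Strict Implicit.
Unset Printing Implicit Defensive.

Import Order.TTheory GRing.Theory Num.Theory.

Local Open Scope classical_set_scope.
Local Open Scope ring_scope.

(** * Markov decision processes *)

(* Since instances have to be written down on a tape, the finite sets of states
   and actions are {0, ..., nS - 1} and {0, ..., nA - 1}. An action is enabled
   in a state when its row of transition probabilities sums to 1, and disabled
   when the row is zero; states without enabled actions (traps) are allowed. *)
Record mdp := Mdp {
  nS : nat;
  nA : nat;
  trans : 'I_nS -> 'I_nA -> 'I_nS -> rat;
  wgt : 'I_nS -> 'I_nA -> int;
  trans_ge0 : forall s a t, 0 <= trans s a t;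
  trans_sum : forall s a,
    (\sum_t trans s a t = 0) \/ (\sum_t trans s a t = 1)
}.

Section Paths.
Variable M : mdp.

Definition state := 'I_(nS M).
Definition action := 'I_(nA M).

Definition enabled (s : state) (a : action) : bool := \sum_t trans s a t == 1.

Definition trap (s : state) : bool := [forall a, ~~ enabled s a].

(* The finite path s a_0 s_1 a_1 ... a_(n-1) s_n is represented by its first
   state s and the sequence (a_0, s_1), ..., (a_(n-1), s_n). *)
Fixpoint is_path (s : state) (p : seq (action * state)) : bool :=
  if p is (a, t) :: p' then (0 < trans s a t) && is_path t p' else true.

Definition path_last (s : state) (p : seq (action * state)) : state :=
  last s (map snd p).

Fixpoint path_wgt (s : state) (p : seq (action * state)) : int :=
  if p is (a, t) :: p' then wgt s a + path_wgt t p' else 0.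

(* A maximal path from s is infinite or ends in a trap. Its k-th step is
   [Some (a_k, s_(k+1))], or [None] once the path has ended. *)
Fixpoint state_at (s : state) (w : nat -> option (action * state)) (k : nat)
    : state :=
  if k is k'.+1 then
    if w k' is Some (_, t) then t else state_at s w k'
  else s.

Definition is_maxpath (s : state) (w : nat -> option (action * state)) : Prop :=
  forall k, if w k is Some (a, t) then 0 < trans (state_at s w k) a t
            else trap (state_at s w k).

Record maxpath (s : state) := MaxPath {
  step_at :> nat -> option (action * state);
  maxpathP : is_maxpath s step_at
}.

HB.instance Definition _ (s : state) := gen_eqMixin (maxpath s).
HB.instance Definition _ (s : state) := gen_choiceMixin (maxpath s).

(* Measurable spaces have to be inhabited: we exhibit a maximal path. *)
Definition some_step (s : state) : option (action * state) :=
  [pick x : action * state | 0 < trans s x.1 x.2].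

Fixpoint some_state (s : state) (k : nat) : state :=
  if k is k'.+1 then
    if some_step (some_state s k') is Some (_, t) then t else some_state s k'
  else s.

Lemma some_maxpathP (s : state) :
  is_maxpath s (fun k => some_step (some_state s k)).
Proof.
move=> k.
have -> : state_at s (fun k => some_step (some_state s k)) k = some_state s k.
  by elim: k => //= k ->.
rewrite /some_step; case: pickP => [[a t] //|nostep].
apply/forallP => a; apply/negP => /eqP sum1.
suff sum0 : \sum_t trans (some_state s k) a t = 0.
  by move: sum1; rewrite sum0 => /eqP; rewrite eq_sym oner_eq0.
apply: big1 => t _; apply/eqP; move: (nostep (a, t)) => /=.
by rewrite lt_neqAle trans_ge0 andbT eq_sym => /negbFE.
Qed.

HB.instance Definition _ (s : state) :=
  isPointed.Build (maxpath s) (MaxPath (some_maxpathP s)).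

Definition prefix_of (s : state) (p : seq (action * state)) (w : maxpath s)
    : Prop :=
  mkseq w (size p) = map Some p.

(** * The probability measure of a scheduler *)

Definition cylinder (s : state) (p : seq (action * state)) : set (maxpath s) :=
  [set w | prefix_of p w].

Definition cylinders (s : state) : set (set (maxpath s)) :=
  [set cylinder p | p in [set p | is_path s p]].

Definition path_space (s : state) := g_sigma_algebraType (@cylinders s).

(* Randomised and history-dependent: [dist s p a] is the probability of choosing
   [a] after the finite path (s, p); its value is irrelevant unless (s, p) is a
   path that does not end in a trap. *)
Record scheduler (R : realType) := Scheduler {
  dist :> state -> seq (action * state) -> action -> R;
  dist_ge0 : forall s p a, is_path s p -> ~~ trap (path_last s p) ->
    0 <= dist s p a;
  dist_sum : forall s p, is_path s p -> ~~ trap (path_last s p) ->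
    \sum_a dist s p a = 1;
  dist_enabled : forall s p a, is_path s p -> ~~ trap (path_last s p) ->
    0 < dist s p a -> enabled (path_last s p) a
}.

(* Probability of performing the steps [p] after the history [h]. *)
Fixpoint path_prob (R : realType) (S : scheduler R) (s : state)
    (h p : seq (action * state)) : R :=
  if p is (a, t) :: p' then
    S s h a * ratr (trans (path_last s h) a t) * path_prob S s (rcons h (a, t)) p'
  else 1.

(* The cylinders of finite paths are stable under intersection up to the empty
   set, so this determines [mu] uniquely. *)
Definition is_scheduler_measure (R : realType) (S : scheduler R) (s : state)
    (mu : probability (path_space s) R) : Prop :=
  forall p, is_path s p ->
    mu (cylinder p : set (path_space s)) = (path_prob S s [::] p)%:E.

(** * Disjunctive weight-bounded reachability *)

(* The threshold [None] stands for -oo; thresholds of states that are not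
   targets are irrelevant. *)
Record dwr := Dwr {
  targets : {set state};
  threshold : state -> option int
}.

Definition Tstar (phi : dwr) : {set state} :=
  [set t in targets phi | threshold phi t == None].

Definition meets (w : int) (K : option int) : bool :=
  if K is Some k then k <= w else true.

Definition sat (phi : dwr) (s : state) : set (maxpath s) :=
  [set w | exists p : seq (action * state),
     [/\ prefix_of p w,
         path_last s p \in targets phi &
         meets (path_wgt s p) (threshold phi (path_last s p))]].

Definition set_threshold (phi : dwr) (goal : state) (k : int) : dwr :=
  Dwr (targets phi) (fun t => if t == goal then Some k else threshold phi t).

Definition exists_pos (R : realType) (s : state) (phi : dwr) : Prop :=
  exists (S : scheduler R) (mu : probability (path_space s) R),
    is_scheduler_measure S mu /\
    (0 < mu (sat phi (s := s) : set (path_space s)))%E.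

(* The supremum is taken in Z extended with -oo and +oo; it is -oo for the
   empty set. *)
Definition K_exists_pos (R : realType) (s : state) (phi : dwr) (goal : state)
    : \bar int :=
  supremum -oo%E
    [set k%:E | k in [set k : int | exists_pos R s (set_threshold phi goal k)]].

End Paths.

Record dwr_instance := DwrInstance {
  inst_mdp : mdp;
  inst_state : state inst_mdp;
  inst_dwr : dwr inst_mdp
}.

Record goal_instance := GoalInstance {
  goal_inst :> dwr_instance;
  goal : state (inst_mdp goal_inst);
  goalP : (targets (inst_dwr goal_inst) :\: Tstar (inst_dwr goal_inst)
           = [set goal])%SET
}.

Definition DWR_exists_pos (R : realType) (x : dwr_instance) : Prop :=
  exists_pos R (inst_state x) (inst_dwr x).

Definition K_value (R : realType) (x : goal_instance) : \bar int :=
  K_exists_pos R (inst_state x) (inst_dwr x) (goal x).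

(** * Polynomial time on deterministic multi-tape Turing machines *)

Section Machines.
Local Open Scope nat_scope.
Variable letter : finType.

Inductive move := MoveLeft | Stay | MoveRight.

(* [None] is the blank, [inl] embeds the input and output alphabet, [inr] the
   auxiliary symbols. *)
Definition symbol (aux : finType) := option (letter + aux)%type.

(* The machine has [extra.+1] two-way infinite tapes and halts when the
   transition function returns [None]. *)
Record machine := Machine {
  aux : finType;
  extra : nat;
  control : finType;
  start : control;
  delta : control -> {ffun 'I_extra.+1 -> symbol aux} ->
    option (control * {ffun 'I_extra.+1 -> symbol aux * move})
}.

(* The cells left of the head (nearest first), the scanned cell and the cells
   right of the head; all the other cells are blank. *)
Record tape (aux : finType) := Tape {
  left_of : seq (symbol aux);
  scanned : symbol aux;
  right_of : seq (symbol aux)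
}.

Definition write_move (aux : finType) (t : tape aux) (x : symbol aux * move)
    : tape aux :=
  let: Tape l _ r := t in
  match x.2 with
  | MoveLeft => Tape (behead l) (head None l) (x.1 :: r)
  | Stay => Tape l x.1 r
  | MoveRight => Tape (x.1 :: l) (head None r) (behead r)
  end.

Record config (m : machine) := Config {
  cstate : control m;
  ctape : 'I_(extra m).+1 -> tape (aux m)
}.

Definition cdelta (m : machine) (c : config m) :=
  delta (cstate c) [ffun i => scanned (ctape c i)].

Definition halted (m : machine) (c : config m) : bool := ~~ isSome (cdelta c).

Definition cstep (m : machine) (c : config m) : config m :=
  if cdelta c is Some (q, x) then
    Config q (fun i => write_move (ctape c i) (x i))
  else c.

(* The input is on tape 0, with the head on its first letter. *)
Definition initial (m : machine) (u : seq letter) : config m :=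
  let cells := [seq Some (inl a) | a <- u] : seq (symbol (aux m)) in
  Config (start m)
    (fun i => if i == ord0 then Tape [::] (head None cells) (behead cells)
              else Tape [::] None [::]).

(* The output is the longest word over [letter] that starts at the head of
   tape 0. *)
Fixpoint read_word (aux : finType) (cells : seq (symbol aux)) : seq letter :=
  if cells is Some (inl a) :: cells' then a :: read_word cells' else [::].

Definition output (m : machine) (c : config m) : seq letter :=
  read_word (scanned (ctape c ord0) :: right_of (ctape c ord0)).

Definition polytime (X Y : Type) (encX : X -> seq letter) (encY : Y -> seq letter)
    (f : X -> Y) : Prop :=
  exists (m : machine) (c d : nat), forall x : X,
    exists2 n, n <= c * size (encX x) ^ d + c &
      let final := iter n (@cstep m) (initial m (encX x)) in
      halted final /\ output final = encY (f x).

End Machines.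

(** * Encodings *)

(* Words over {0, 1, #}: [Some b] is a bit and [None] is the separator #. *)
Definition letter := option bool : finType.

(* Least significant bit first. *)
Fixpoint pos_bits (p : BinNums.positive) : seq bool :=
  match p with
  | BinNums.xH => [:: true]
  | BinNums.xO p' => false :: pos_bits p'
  | BinNums.xI p' => true :: pos_bits p'
  end.

Definition nat_bits (n : nat) : seq bool :=
  if bin_of_nat n is BinNums.Npos p then pos_bits p else [::].

(* Sign bit, then absolute value. *)
Definition int_bits (z : int) : seq bool := (z < 0) :: nat_bits (absz z).

Definition block (b : seq bool) : seq letter := rcons (map Some b) None.

Definition enc_nat (n : nat) : seq letter := block (nat_bits n).
Definition enc_int (z : int) : seq letter := block (int_bits z).

(* Nonnegative rationals, in lowest terms. *)
Definition enc_prob (q : rat) : seq letter :=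
  enc_nat (absz (numq q)) ++ enc_nat (absz (denq q)).

Definition enc_mdp (M : mdp) : seq letter :=
  enc_nat (nS M) ++ enc_nat (nA M) ++
  flatten [seq
    flatten [seq
      enc_int (wgt s a) ++
      flatten [seq enc_prob (trans s a t) | t <- enum 'I_(nS M)]
    | a <- enum 'I_(nA M)]
  | s <- enum 'I_(nS M)].

(* For every state: # if it is not a target, 0# if its threshold is -oo, and 1
   followed by the threshold otherwise. *)
Definition enc_dwr (M : mdp) (phi : dwr M) : seq letter :=
  flatten [seq
    block (if t \in targets phi then
             if threshold phi t is Some k then true :: int_bits k
             else [:: false]
           else [::])
  | t <- enum 'I_(nS M)].

Definition enc_instance (x : dwr_instance) : seq letter :=
  enc_mdp (inst_mdp x) ++ enc_nat (inst_state x) ++ enc_dwr (inst_dwr x).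

Definition enc_goal_instance (x : goal_instance) : seq letter := enc_instance x.

Definition enc_bool (b : bool) : seq letter := [:: Some b].

Definition enc_extint (k : \bar int) : seq letter :=
  match k with
  | EFin z => enc_int z
  | EPInf => [:: None; Some true]
  | ENInf => [:: None; Some false]
  end.

(* A decision problem on a type of instances is in P when its characteristic
   function is computable in time polynomial in the length of the encoded
   instance. *)
Definition in_P (X : Type) (encX : X -> seq letter) (Q : X -> Prop) : Prop :=
  polytime encX enc_bool (fun x => `[< Q x >]).

(* Main.v *)
Require Import Defs.
From HB Require Import structures.
From mathcomp Require Import all_boot all_order all_algebra.
From mathcomp Require Import all_classical all_reals all_analysis.
From mathcomp Require Import zify.

(* A scheduler makes the property hold with positive probability iff some finite
   path from the initial state ends in a target with enough weight: under the
   memoryless scheduler that picks an enabled action uniformly, every finite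
   path has positive probability. Its path measure is the image of the uniform
   distribution on [0, 1] under successive subdivision of the unit interval, so
   no extension theorem is needed.

   The longest weights of such paths are found by Bellman-Ford. After [nS] rounds
   the values are the maxima over all walks of at most [nS] steps; a walk which
   improves on them in a later round contains a positive cycle, so its end has
   unbounded weights, and so does every state reachable from it. Weights are
   pairs of binary naturals that stand for their difference, which makes
   subtraction unnecessary during the rounds.

   Polynomial time is obtained from a class [ptime] of functions between types
   encoded as binary trees, closed under composition, pairing, case analysis and
   folds with polynomially bounded accumulators. It is realised by programs over
   a fixed number of stacks, and these by Turing machines with one tape per
   stack, whose control states are the positions in the program. *)

Set Implicit Arguments.
Unset Strict Implicit.
Unset Printing Implicit Defensive.

Local Open Scope nat_scope.

(** * Stack programs on Turing machines *)

(** The second series has [nS + 1] rounds: its first round flags the improvements over the maxima of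
    walks of at most [nS] steps, and the other [nS] carry these flags along every walk of fewer than
    [nS] steps. If no flagged state leads to a given state, the values satisfy all edge inequalities
    on the way to it and so bound walks of every length.

    Polynomial time is a matter of sizes. For the rounds this is a bound on bit widths: a round
    reads its sources from the vector it started with, so the common width bound rises by one per
    round, whatever the number of edges. The numbers of states and actions are written in binary,
    but the instance contains at least as many blocks, so they can be expanded in unary up to the
    input length.

    On the probabilistic side one direction needs no analysis of the scheduler: a set of positive
    measure is nonempty, and a path in it already contains the required prefix. *)

Inductive cmd :=
| Skip
| Push of nat & letter
| Pop of nat
| Seq of cmd & cmd
| If of nat & pred (option letter) & cmd & cmd
| While of nat & pred (option letter) & cmd.

Definition store := seq (seq letter).

Definition top (s : store) (r : nat) : option letter := ohead (nth [::] s r).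

(** The counts are exact machine steps. A push takes two, since the head first moves left and only
    then writes; a pop blanks the top cell and moves right in one; each test of a conditional or a
    loop takes one. *)
Inductive runs : cmd -> store -> nat -> store -> Prop :=
| runs_skip s : runs Skip s 1 s
| runs_push r x s : runs (Push r x) s 2 (set_nth [::] s r (x :: nth [::] s r))
| runs_pop r s : runs (Pop r) s 1 (set_nth [::] s r (behead (nth [::] s r)))
| runs_seq c1 c2 s1 n1 s2 n2 s3 :
    runs c1 s1 n1 s2 -> runs c2 s2 n2 s3 -> runs (Seq c1 c2) s1 (n1 + n2) s3
| runs_then r (P : pred (option letter)) c1 c2 s1 n s2 :
    P (top s1 r) -> runs c1 s1 n s2 -> runs (If r P c1 c2) s1 n.+1 s2
| runs_else r (P : pred (option letter)) c1 c2 s1 n s2 :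
    ~~ P (top s1 r) -> runs c2 s1 n s2 -> runs (If r P c1 c2) s1 n.+1 s2
| runs_stop r (P : pred (option letter)) c s : ~~ P (top s r) -> runs (While r P c) s 1 s
| runs_loop r (P : pred (option letter)) c s1 n1 s2 n2 s3 :
    P (top s1 r) -> runs c s1 n1 s2 -> runs (While r P c) s2 n2 s3 ->
    runs (While r P c) s1 (n1 + n2).+1 s3.

(** [None] is the position of the test in a conditional or a loop; the two positions of a push lie
    before and after the move of the head. *)
Fixpoint ctl (c : cmd) : finType :=
  match c with
  | Skip | Pop _ => unit
  | Push _ _ => bool
  | Seq c1 c2 => (ctl c1 + ctl c2)%type
  | If _ _ c1 c2 => option (ctl c1 + ctl c2)%type
  | While _ _ c => option (ctl c)
  end.

Fixpoint entry (c : cmd) : ctl c :=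
  match c return ctl c with
  | Skip | Pop _ => tt
  | Push _ _ => true
  | Seq c1 c2 => inl (entry c1)
  | If _ _ c1 c2 => None
  | While _ _ c => None
  end.

Definition effect := option (nat * (option letter * move)).

(* The first component of the result is [None] when [c] is left. *)
Fixpoint ctl_step (c : cmd) (h : nat -> option letter) :
    ctl c -> option (ctl c) * effect :=
  match c return ctl c -> option (ctl c) * effect with
  | Skip => fun _ => (None, None)
  | Pop r => fun _ => (None, Some (r, (None, MoveRight)))
  | Push r x => fun q =>
      if q then (Some false, Some (r, (h r, MoveLeft)))
      else (None, Some (r, (Some x, Stay)))
  | Seq c1 c2 => fun q =>
      match q with
      | inl q1 => let: (q', e) := ctl_step h q1 in
                  (Some (if q' is Some q2 then inl q2 else inr (entry c2)), e)
      | inr q1 => let: (q', e) := ctl_step h q1 in (omap inr q', e)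
      end
  | If r P c1 c2 => fun q =>
      match q with
      | None => (Some (Some (if P (h r) then inl (entry c1) else inr (entry c2))),
                 None)
      | Some (inl q1) =>
          let: (q', e) := ctl_step h q1 in (omap (Some \o inl) q', e)
      | Some (inr q1) =>
          let: (q', e) := ctl_step h q1 in (omap (Some \o inr) q', e)
      end
  | While r P c => fun q =>
      match q with
      | None => ((if P (h r) then Some (Some (entry c)) else None), None)
      | Some q1 => let: (q', e) := ctl_step h q1 in (Some q', e)
      end
  end.

Section Simulation.
Variable e : nat.

Notation sym := (symbol letter void).

Definition to_sym (x : option letter) : sym := omap inl x.
Definition of_sym (x : sym) : option letter :=
  if x is Some (inl a) then Some a else None.

Definition tapes := 'I_e.+1 -> tape letter void.

Definition heads (f : 'I_e.+1 -> sym) (r : nat) : option letter :=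
  if insub r is Some i then of_sym (f i) else None.

Definition apply_effect (ts : tapes) (x : effect) : tapes :=
  if x is Some (r, (a, m)) then
    fun i => if i == r :> nat then write_move (ts i) (to_sym a, m) else ts i
  else ts.

Notation tops ts := (heads (fun i => scanned (ts i))).

(** A run inside [c] until its control is left, without reference to the surrounding program. Such
    runs embed into every compound command, which is what the induction on [runs] needs. *)
Inductive exec (c : cmd) : ctl c -> tapes -> nat -> tapes -> Prop :=
| exec_exit q ts x :
    ctl_step (tops ts) q = (None, x) -> exec q ts 1 (apply_effect ts x)
| exec_next q ts x q' n ts' :
    ctl_step (tops ts) q = (Some q', x) ->
    exec q' (apply_effect ts x) n ts' -> exec q ts n.+1 ts'.

Lemma exec_seqr c1 c2 (q : ctl c2) ts n ts' :
  exec q ts n ts' -> exec (c := Seq c1 c2) (inr q) ts n ts'.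
Proof.
elim=> {q ts n ts'} [q ts x E|q ts x q' n ts' E _ IH].
  by apply: exec_exit; rewrite /= E.
by apply: exec_next IH; rewrite /= E.
Qed.

Lemma exec_seql c1 c2 (q : ctl c1) ts1 n1 ts2 n2 ts3 :
  exec q ts1 n1 ts2 -> exec (entry c2) ts2 n2 ts3 ->
  exec (c := Seq c1 c2) (inl q) ts1 (n1 + n2) ts3.
Proof.
move=> H; elim: H n2 ts3 => {q ts1 n1 ts2} [q ts x E|q ts x q' n ts' E _ IH] n2 ts3 H2.
  by apply: (@exec_next (Seq c1 c2) (inl q) ts x (inr (entry c2))); rewrite /= ?E //; apply: exec_seqr.
by rewrite addSn; apply: exec_next (IH _ _ H2); rewrite /= E.
Qed.

Lemma exec_ifl r P c1 c2 (q : ctl c1) ts n ts' :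
  exec q ts n ts' -> exec (c := If r P c1 c2) (Some (inl q)) ts n ts'.
Proof.
elim=> {q ts n ts'} [q ts x E|q ts x q' n ts' E _ IH].
  by apply: exec_exit; rewrite /= E.
by apply: exec_next IH; rewrite /= E.
Qed.

Lemma exec_ifr r P c1 c2 (q : ctl c2) ts n ts' :
  exec q ts n ts' -> exec (c := If r P c1 c2) (Some (inr q)) ts n ts'.
Proof.
elim=> {q ts n ts'} [q ts x E|q ts x q' n ts' E _ IH].
  by apply: exec_exit; rewrite /= E.
by apply: exec_next IH; rewrite /= E.
Qed.

Lemma exec_while r P c (q : ctl c) ts1 n1 ts2 n2 ts3 :
  exec q ts1 n1 ts2 -> exec (c := While r P c) None ts2 n2 ts3 ->
  exec (c := While r P c) (Some q) ts1 (n1 + n2) ts3.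
Proof.
move=> H; elim: H n2 ts3 => {q ts1 n1 ts2} [q ts x E|q ts x q' n ts' E _ IH] n2 ts3 H2.
  by apply: (@exec_next (While r P c) (Some q) ts x None); rewrite /= ?E.
by rewrite addSn; apply: exec_next (IH _ _ H2); rewrite /= E.
Qed.

(** Comparison through [nth None] identifies contents up to trailing blanks. The cells left of the
    head are unconstrained, because a push overwrites the one it enters. *)
Definition tape_holds (t : tape letter void) (u : seq letter) :=
  nth None (scanned t :: right_of t) =1 nth None (map (to_sym \o Some) u).

Definition holds (ts : tapes) (s : store) :=
  forall i, tape_holds (ts i) (nth [::] s i).

Fixpoint regs_le (c : cmd) : bool :=
  match c with
  | Skip => true
  | Push r _ | Pop r => r <= e
  | Seq c1 c2 => regs_le c1 && regs_le c2
  | If r _ c1 c2 => [&& r <= e, regs_le c1 & regs_le c2]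
  | While r _ c => (r <= e) && regs_le c
  end.

Lemma heads_top ts s r : holds ts s -> r <= e -> tops ts r = top s r.
Proof.
move=> H re; rewrite /heads /top insubT => //=.
have := H (Ordinal (re : r < e.+1)) 0; rewrite /tape_holds /= => ->.
by case: (nth [::] s r).
Qed.

Lemma write_pop t u :
  tape_holds t u -> tape_holds (write_move t (None, MoveRight)) (behead u).
Proof.
case: t => l x r H k; have /= := H k.+1.
by case: r {H} => [|y r]; case: u => [|z u]; rewrite /= ?nth_nil //; case: k => [|[]].
Qed.

Lemma write_push t u x : tape_holds t u ->
  tape_holds (write_move (write_move t (to_sym (ohead u), MoveLeft)) (to_sym (Some x), Stay))
             (x :: u).
Proof.
case: t => l y r H [|[|k]] //=; first by case: u H.
by have := H k.+1; case: u {H} => //=; rewrite !nth_nil.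
Qed.

Lemma runs_exec c s n s' : runs c s n s' -> regs_le c ->
  forall ts, holds ts s -> exists2 ts', exec (entry c) ts n ts' & holds ts' s'.
Proof.
elim=> {c s n s'}
  [s|r x s|r s|c1 c2 s1 n1 s2 n2 s3 _ IH1 _ IH2|r P c1 c2 s1 n s2 HP _ IH
  |r P c1 c2 s1 n s2 HP _ IH|r P c s HP|r P c s1 n1 s2 n2 s3 HP _ IH1 _ IH2] /= re ts hs.
- by exists ts => //; apply: (@exec_exit Skip tt ts None).
(* The first effect writes back the letter already under the head, because a machine writes before
   it moves. *)
- set x1 : effect := Some (r, (top s r, MoveLeft)); set x2 : effect := Some (r, (Some x, Stay)).
  exists (apply_effect (apply_effect ts x1) x2).
    apply: (@exec_next (Push r x) true ts x1 false); last exact: exec_exit.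
    by rewrite /= (heads_top hs).
  move=> i; rewrite nth_set_nth /=.
  case: eqP => [<-|_]; last exact: hs.
  exact: write_push.
- set x : effect := Some (r, (None, MoveRight)).
  exists (apply_effect ts x); first exact: (@exec_exit (Pop r) tt).
  by move=> i; rewrite nth_set_nth /=; case: eqP => [<-|_]; [apply: write_pop|apply: hs].
- case/andP: re => re1 re2; have [ts1 E1 /(IH2 re2)[ts2 E2 h2]] := IH1 re1 _ hs.
  by exists ts2 => //; apply: exec_seql E1 E2.
- case/and3P: re => re0 re1 re2; have [ts1 E1 h1] := IH re1 _ hs.
  exists ts1 => //; apply: (@exec_next (If r P c1 c2) None ts None (Some (inl (entry c1)))).
    by rewrite /= (heads_top hs) // HP.
  exact: exec_ifl.
- case/and3P: re => re0 re1 re2; have [ts1 E1 h1] := IH re2 _ hs.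
  exists ts1 => //; apply: (@exec_next (If r P c1 c2) None ts None (Some (inr (entry c2)))).
    by rewrite /= (heads_top hs) // (negPf HP).
  exact: exec_ifr.
- case/andP: re => re0 re1; exists ts => //.
  apply: (@exec_exit (While r P c) None ts None).
  by rewrite /= (heads_top hs) // (negPf HP).
- case/andP: re => re0 re1; have [ts1 E1 h1] := IH1 re1 _ hs.
  have [|ts2 E2 h2] := IH2 _ _ h1; first by rewrite /= re0.
  exists ts2 => //; apply: (@exec_next (While r P c) None ts None (Some (entry c))).
    by rewrite /= (heads_top hs) // HP.
  exact: exec_while E1 E2.
Qed.

(** The additional control state [None] is entered when the program is left; it has no transition,
    so the machine halts there. *)
Definition cmd_delta (c : cmd) (q : option (ctl c)) (f : {ffun 'I_e.+1 -> sym}) :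
    option (option (ctl c) * {ffun 'I_e.+1 -> sym * move}) :=
  if q is Some q1 then
    let: (q', x) := ctl_step (heads f) q1 in
    Some (q', [ffun i : 'I_e.+1 => if x is Some (r, (a, m)) then
                           if i == r :> nat then (to_sym a, m) else (f i, Stay)
                         else (f i, Stay)])
  else None.

Definition cmd_machine (c : cmd) : machine letter :=
  @Machine letter void e (option (ctl c)) (Some (entry c)) (@cmd_delta c).

Lemma exec_machine c (q : ctl c) ts n ts' : exec q ts n ts' ->
  iter n (@cstep _ (cmd_machine c)) (@Config _ (cmd_machine c) (Some q) ts)
  = @Config _ (cmd_machine c) None ts'.
Proof.
have step (q1 : ctl c) ts1 q2 x : ctl_step (tops ts1) q1 = (q2, x) ->
  @cstep _ (cmd_machine c) (@Config _ (cmd_machine c) (Some q1) ts1)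
  = @Config _ (cmd_machine c) q2 (apply_effect ts1 x).
  move=> E; rewrite /cstep /cdelta /=.
  have -> : heads [ffun i => scanned (ts1 i)] = tops ts1.
    by apply/funext => r; rewrite /heads; case: insub => // i; rewrite ffunE.
  rewrite E; congr Config; apply/funext => i; rewrite !ffunE.
  case: x {E} => [[r [a m]]|] /=; first case: eqP => // _; by case: (ts1 i).
elim=> {q ts n ts'} [q ts x E|q ts x q' n ts' E _ IH]; first by rewrite /= (step _ _ _ _ E).
by rewrite iterSr (step _ _ _ _ E) IH.
Qed.

End Simulation.

Lemma read_word_holds (t : tape letter void) u :
  tape_holds t u -> read_word (scanned t :: right_of t) = u.
Proof.
rewrite /tape_holds; move: (scanned t :: right_of t) => l {t}.
elim: u l => [|x u IH] [|y l] H //=; first by have := H 0 => /= ->.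
  by have := H 0.
by have := H 0 => /= ->; rewrite IH // => k; have := H k.+1.
Qed.

Lemma cmd_machine_output e c u k n w s' : regs_le e c ->
  runs c (u :: nseq k [::]) n (w :: s') ->
  let final := iter n (@cstep _ (cmd_machine e c)) (initial (cmd_machine e c) u) in
  halted final /\ output final = w.
Proof.
move=> re R.
set ts : tapes e := ctape (initial (cmd_machine e c) u).
have hs : holds ts (u :: nseq k [::]).
  move=> i; rewrite /ts /=; case: eqP => [->|/eqP i0] j /=.
    by case: u {R ts} => [|x u] //=; case: j => [|[]] //=.
  have -> : nth [::] (u :: nseq k [::]) i = [::].
    by move: i0; rewrite -val_eqE /=; case: (val i) => [|i'] // _; rewrite /= nth_nseq if_same.
  by case: j => [|[]].
have [ts' E h'] := runs_exec R re hs.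
rewrite /=.
have -> : initial (cmd_machine e c) u = @Config _ (cmd_machine e c) (Some (entry c)) ts by [].
rewrite (exec_machine E); split=> //.
exact: (read_word_holds (h' ord0)).
Qed.

(** * Polynomial bounds *)

(** The base [s x + 2] is at least 2, so constants and factors of 2 are absorbed by a larger
    exponent and the single number [d] describes the whole bound. *)
Definition poly_bounded (X : Type) (s g : X -> nat) :=
  exists d, forall x, g x <= (s x + 2) ^ d.

Section PolyBounded.
Variables (X : Type) (s : X -> nat).

Lemma pb_le g g' : (forall x, g x <= g' x) -> poly_bounded s g' -> poly_bounded s g.
Proof. by move=> le [d H]; exists d => x; apply: leq_trans (le x) (H x). Qed.

Lemma pb_const n : poly_bounded s (fun=> n).
Proof.
exists n => x; apply: (leq_trans (ltnW (ltn_expl n (isT : 1 < 2)))).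
by case: n => // n; rewrite leq_exp2r // leq_addl.
Qed.

Lemma pb_id : poly_bounded s s.
Proof. by exists 1 => x; rewrite expn1 leq_addr. Qed.

Lemma pb_mul g h : poly_bounded s g -> poly_bounded s h ->
  poly_bounded s (fun x => g x * h x).
Proof. by move=> [d H] [d' H']; exists (d + d') => x; rewrite expnD leq_mul. Qed.

Lemma pb_add g h : poly_bounded s g -> poly_bounded s h ->
  poly_bounded s (fun x => g x + h x).
Proof.
move=> [d H] [d' H']; exists (d + d').+1 => x.
have p n : 0 < (s x + 2) ^ n by rewrite expn_gt0 addn2.
apply: (@leq_trans ((s x + 2) ^ (d + d') + (s x + 2) ^ (d + d'))).
  rewrite expnD leq_add //.
    by apply: leq_trans (H x) _; rewrite leq_pmulr.
  by apply: leq_trans (H' x) _; rewrite leq_pmull.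
by rewrite addnn -mul2n expnS leq_mul2r leq_addl orbT.
Qed.

Lemma pb_exp g d : poly_bounded s g -> poly_bounded s (fun x => g x ^ d).
Proof.
move=> H; elim: d => [|d IH]; first exact: pb_const 1.
by under eq_fun do rewrite expnS; apply: pb_mul.
Qed.

Lemma pb_comp Y (t : Y -> nat) (u : X -> Y) h :
  poly_bounded t h -> poly_bounded s (fun x => t (u x)) ->
  poly_bounded s (fun x => h (u x)).
Proof.
move=> [d H] H'; apply: (pb_le (g' := fun x => (t (u x) + 2) ^ d)) => //.
by apply: pb_exp; apply: pb_add => //; apply: pb_const.
Qed.

End PolyBounded.

Ltac pb := repeat first
  [ assumption | apply: pb_id | apply: pb_const | apply: pb_add | apply: pb_mul
  | apply: pb_exp ].

(** * Trees on a stack *)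

Inductive bintree := Leaf | Node of bintree & bintree.

Notation tt1 := (Some true : letter).
Notation ff1 := (Some false : letter).

(** Preorder gives a prefix code: a tree ends as soon as its leaves outnumber its nodes by one.
    Codes can therefore be stacked on one register without separators. *)
Fixpoint tcode (x : bintree) : seq letter :=
  if x is Node y z then tt1 :: tcode y ++ tcode z else [:: ff1].

Lemma code_gt0 x : 0 < size (tcode x).
Proof. by case: x. Qed.

Definition runs_within c s N s' := exists2 n, runs c s n s' & n <= N.

Lemma runs_within_le c s N N' s' : runs_within c s N s' -> N <= N' -> runs_within c s N' s'.
Proof. by case=> n R le1 le2; exists n => //; apply: leq_trans le1 le2. Qed.

Lemma runs_within_skip s : runs_within Skip s 1 s.
Proof. by exists 1 => //; constructor. Qed.

Lemma runs_within_push r x s : runs_within (Push r x) s 2 (set_nth [::] s r (x :: nth [::] s r)).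
Proof. by exists 2 => //; constructor. Qed.

Lemma runs_within_pop r s : runs_within (Pop r) s 1 (set_nth [::] s r (behead (nth [::] s r))).
Proof. by exists 1 => //; constructor. Qed.

Lemma runs_within_seq c1 c2 s1 N1 s2 N2 s3 :
  runs_within c1 s1 N1 s2 -> runs_within c2 s2 N2 s3 -> runs_within (Seq c1 c2) s1 (N1 + N2) s3.
Proof. by case=> n1 R1 le1 [n2 R2 le2]; exists (n1 + n2); [econstructor; eassumption|apply: leq_add]. Qed.

Lemma runs_within_then r (P : pred (option letter)) c1 c2 s1 N s2 :
  P (top s1 r) -> runs_within c1 s1 N s2 -> runs_within (If r P c1 c2) s1 N.+1 s2.
Proof. by move=> HP [n R le]; exists n.+1 => //; apply: runs_then. Qed.

Lemma runs_within_else r (P : pred (option letter)) c1 c2 s1 N s2 :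
  ~~ P (top s1 r) -> runs_within c2 s1 N s2 -> runs_within (If r P c1 c2) s1 N.+1 s2.
Proof. by move=> HP [n R le]; exists n.+1 => //; apply: runs_else. Qed.

Lemma runs_within_stop r (P : pred (option letter)) c s :
  ~~ P (top s r) -> runs_within (While r P c) s 1 s.
Proof. by exists 1 => //; constructor. Qed.

Lemma runs_within_loop r (P : pred (option letter)) c s1 N1 s2 N2 s3 :
  P (top s1 r) -> runs_within c s1 N1 s2 -> runs_within (While r P c) s2 N2 s3 ->
  runs_within (While r P c) s1 (N1 + N2).+1 s3.
Proof. by move=> HP [n1 R1 l1] [n2 R2 l2]; exists (n1 + n2).+1;
  [econstructor; eassumption|rewrite ltnS leq_add]. Qed.

Definition is_true_top : pred (option letter) :=
  fun x => if x is Some (Some true) then true else false.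
Definition is_false_top : pred (option letter) :=
  fun x => if x is Some (Some false) then true else false.
Definition nonempty_top : pred (option letter) := isSome.

Ltac wstep := first
  [ exact: runs_within_skip | exact: runs_within_push | exact: runs_within_pop
  | eapply runs_within_seq
  | apply: runs_within_then; [done|]
  | apply: runs_within_else; [done|] ].

(** The letter to be pushed is part of the program text, hence the branching over the three
    letters. *)
Definition copy_top j i :=
  If j is_true_top (Push i tt1) (If j is_false_top (Push i ff1) (Push i None)).

Lemma runs_within_copy_top j i s x u : nth [::] s j = x :: u ->
  runs_within (copy_top j i) s 4 (set_nth [::] s i (x :: nth [::] s i)).
Proof.
move=> E; have T : top s j = Some x by rewrite /top E.
rewrite /copy_top; case: x E T => [[|]|] E T.
- by apply: (runs_within_le (N := 3)) => //; apply: runs_within_then; [rewrite T|apply: runs_within_push].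
- by apply: runs_within_else; [by rewrite T|]; apply: runs_within_then; [by rewrite T|apply: runs_within_push].
- by apply: runs_within_else; [by rewrite T|]; apply: runs_within_else; [by rewrite T|apply: runs_within_push].
Qed.

Definition pour j i := While j nonempty_top (Seq (copy_top j i) (Pop j)).

Lemma runs_within_pour (j i : nat) u s : i != j -> i < size s -> j < size s -> nth [::] s j = u ->
  runs_within (pour j i) s (6 * size u + 1)
    (set_nth [::] (set_nth [::] s j [::]) i (rev u ++ nth [::] s i)).
Proof.
move=> ij; elim: u s => [|x u IH] s li lj E.
  have -> : set_nth [::] (set_nth [::] s j [::]) i (rev [::] ++ nth [::] s i) = s.
    apply: (@eq_from_nth _ [::]) => [|k lk]; first by rewrite !size_set_nth; lia.
    by rewrite !nth_set_nth /=; case: eqP => [->|] //; rewrite !nth_set_nth /=; case: eqP => [->|].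
  by apply: runs_within_stop; rewrite /top E.
set s1 := set_nth [::] s i (x :: nth [::] s i).
set s2 := set_nth [::] s1 j (behead (nth [::] s1 j)).
have E1 : nth [::] s1 j = x :: u by rewrite nth_set_nth /= eq_sym (negPf ij).
have := IH s2; rewrite !size_set_nth nth_set_nth /= eqxx E1 => IH'.
have {}IH' : runs_within (pour j i) s2 (6 * size u + 1)
  (set_nth [::] (set_nth [::] s j [::]) i (rev (x :: u) ++ nth [::] s i)).
  apply: (runs_within_le (N := 6 * size u + 1)) => //.
  have -> : set_nth [::] (set_nth [::] s j [::]) i (rev (x :: u) ++ nth [::] s i)
    = set_nth [::] (set_nth [::] s2 j [::]) i (rev u ++ nth [::] s2 i).
    apply: (@eq_from_nth _ [::]) => [|k _]; first by rewrite !size_set_nth; lia.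
    rewrite /s2 /s1 !nth_set_nth /= !nth_set_nth /= !nth_set_nth /= eqxx (negPf ij).
    case: (k =P i) => [_|ki]; first by rewrite rev_cons cat_rcons.
    by case: (k =P j) => // _; rewrite nth_set_nth /=; case: (k =P i) (ki).
  by apply: IH' => //; lia.
apply: (runs_within_le (N := (4 + 1 + (6 * size u + 1)).+1)); last by rewrite /=; lia.
apply: runs_within_loop IH'; first by rewrite /top E.
by apply: runs_within_seq; [apply: runs_within_copy_top E|rewrite -/s1; apply: runs_within_pop].
Qed.

(** Register 4 counts in unary the subtrees still to be read: a node replaces one by two, a leaf
    removes one. The letters arrive in register [j] in reverse order. *)
Definition skim j := While 4 nonempty_top
  (If 0 is_true_top (Seq (Pop 0) (Seq (Push j tt1) (Push 4 tt1)))
                    (Seq (Pop 0) (Seq (Push j ff1) (Pop 4)))).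

(** After a subtree the loop continues with the pending ones, so the rest of the run is taken as a
    hypothesis and extended to the left; the induction then treats both children in turn. A node
    costs 7 steps: the loop test, the branch test, one pop and two pushes. *)
Lemma runs_within_skim2 x r k a b t N s' :
  runs_within (skim 2) [:: r; k; rev (tcode x) ++ a; b; t] N s' ->
  runs_within (skim 2) [:: tcode x ++ r; k; a; b; tt1 :: t] (7 * size (tcode x) + N) s'.
Proof.
elim: x r a t N => [|x IHx y IHy] r a t N H.
  apply: (runs_within_le (N := ((1 + (2 + 1)).+1 + N).+1)); last by rewrite /=; lia.
  apply: runs_within_loop H => //.
  by apply: runs_within_else => //; apply: runs_within_seq; [wstep|apply: runs_within_seq; wstep].
move: H; rewrite /= rev_cons rev_cat -cats1 -!catA /= => /IHy/IHx H.
apply: (runs_within_le (N := ((1 + (2 + 2)).+1 + (7 * size (tcode x) + (7 * size (tcode y) + N))).+1)).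
  apply: runs_within_loop H => //.
  by apply: runs_within_then => //; apply: runs_within_seq; [wstep|apply: runs_within_seq; wstep].
by rewrite /= size_cat; lia.
Qed.

Lemma runs_within_skim3 x r k a b t N s' :
  runs_within (skim 3) [:: r; k; a; rev (tcode x) ++ b; t] N s' ->
  runs_within (skim 3) [:: tcode x ++ r; k; a; b; tt1 :: t] (7 * size (tcode x) + N) s'.
Proof.
elim: x r b t N => [|x IHx y IHy] r b t N H.
  apply: (runs_within_le (N := ((1 + (2 + 1)).+1 + N).+1)); last by rewrite /=; lia.
  apply: runs_within_loop H => //.
  by apply: runs_within_else => //; apply: runs_within_seq; [wstep|apply: runs_within_seq; wstep].
move: H; rewrite /= rev_cons rev_cat -cats1 -!catA /= => /IHy/IHx H.
apply: (runs_within_le (N := ((1 + (2 + 2)).+1 + (7 * size (tcode x) + (7 * size (tcode y) + N))).+1)).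
  apply: runs_within_loop H => //.
  by apply: runs_within_then => //; apply: runs_within_seq; [wstep|apply: runs_within_seq; wstep].
by rewrite /= size_cat; lia.
Qed.

Definition take_tree j := Seq (Push 4 tt1) (skim j).

Lemma runs_within_take2 x r k a b :
  runs_within (take_tree 2) [:: tcode x ++ r; k; a; b; [::]] (7 * size (tcode x) + 3)
    [:: r; k; rev (tcode x) ++ a; b; [::]].
Proof.
apply: (runs_within_le (N := 2 + (7 * size (tcode x) + 1))); last by lia.
by apply: runs_within_seq; [wstep|apply: runs_within_skim2; apply: runs_within_stop].
Qed.

Lemma runs_within_take3 x r k a b :
  runs_within (take_tree 3) [:: tcode x ++ r; k; a; b; [::]] (7 * size (tcode x) + 3)
    [:: r; k; a; rev (tcode x) ++ b; [::]].
Proof.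
apply: (runs_within_le (N := 2 + (7 * size (tcode x) + 1))); last by lia.
by apply: runs_within_seq; [wstep|apply: runs_within_skim3; apply: runs_within_stop].
Qed.

Definition clear j := While j nonempty_top (Pop j).

Lemma runs_within_clear2 u v k b t :
  runs_within (clear 2) [:: v; k; u; b; t] (2 * size u + 1) [:: v; k; [::]; b; t].
Proof.
elim: u => [|x u IH]; first exact: runs_within_stop.
apply: (runs_within_le (N := (1 + (2 * size u + 1)).+1)); last by rewrite /=; lia.
by apply: runs_within_loop IH => //; wstep.
Qed.

(* Register 0 is a stack of encoded trees and register 1 a stack of loop
   counters; registers 2, 3 and 4 are empty between the basic operations. *)
Definition std (v k : seq letter) : store := [:: v; k; [::]; [::]; [::]].

Definition drop_cmd := Seq (take_tree 2) (clear 2).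

Lemma runs_within_drop x r k :
  runs_within drop_cmd (std (tcode x ++ r) k) (9 * size (tcode x) + 4) (std r k).
Proof.
apply: (runs_within_le (N := 7 * size (tcode x) + 3 + (2 * size (rev (tcode x) ++ [::]) + 1))).
  by apply: runs_within_seq; [apply: runs_within_take2|apply: runs_within_clear2].
by rewrite cats0 size_rev; lia.
Qed.

(** The tree taken first is also poured back first, and so ends below the other. *)
Definition swap_cmd :=
  Seq (take_tree 2) (Seq (take_tree 3) (Seq (pour 2 0) (pour 3 0))).

Lemma runs_within_swap x y r k :
  runs_within swap_cmd (std (tcode x ++ tcode y ++ r) k)
    (13 * size (tcode x) + 13 * size (tcode y) + 8) (std (tcode y ++ tcode x ++ r) k).
Proof.
apply: (runs_within_le (N := 7 * size (tcode x) + 3 + (7 * size (tcode y) + 3 +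
   ((6 * size (rev (tcode x)) + 1) + (6 * size (rev (tcode y)) + 1))))); last first.
  by rewrite !size_rev; lia.
apply: runs_within_seq; first exact: runs_within_take2.
apply: runs_within_seq; first exact: runs_within_take3.
rewrite !cats0; apply: runs_within_seq; first exact: runs_within_pour.
by rewrite /= -{3}(revK (tcode y)) revK; apply: (@runs_within_pour 3 0).
Qed.

(** The loop empties register 2 and writes each letter twice. The copy on register 0 is in order at
    once; the one on register 3 reaches register 0 after two reversals. *)
Definition dup_cmd :=
  Seq (take_tree 2) (Seq (While 2 nonempty_top
        (Seq (copy_top 2 0) (Seq (copy_top 2 3) (Pop 2))))
     (Seq (pour 3 2) (pour 2 0))).

Lemma runs_within_dup x r k :
  runs_within dup_cmd (std (tcode x ++ r) k) (29 * size (tcode x) + 6)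
    (std (tcode x ++ tcode x ++ r) k).
Proof.
have L u v b : runs_within (While 2 nonempty_top (Seq (copy_top 2 0) (Seq (copy_top 2 3) (Pop 2))))
    [:: v; k; u; b; [::]] (10 * size u + 1) [:: rev u ++ v; k; [::]; rev u ++ b; [::]].
  elim: u v b => [|y u IH] v b; first exact: runs_within_stop.
  apply: (runs_within_le (N := (4 + (4 + 1) + (10 * size u + 1)).+1)); last by rewrite /=; lia.
  rewrite rev_cons !cat_rcons; apply: runs_within_loop (IH _ _) => //.
  apply: runs_within_seq; first by apply: runs_within_copy_top.
  by apply: runs_within_seq; [apply: runs_within_copy_top|wstep].
apply: (runs_within_le (N := 7 * size (tcode x) + 3 + (10 * size (rev (tcode x)) + 1 +
   ((6 * size (tcode x) + 1) + (6 * size (rev (tcode x)) + 1))))); last first.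
  by rewrite !size_rev; lia.
apply: runs_within_seq; first exact: runs_within_take2.
rewrite cats0; apply: runs_within_seq; first exact: L.
rewrite !cats0 revK; apply: runs_within_seq; first exact: (@runs_within_pour 3 2).
rewrite /= cats0; have := @runs_within_pour 2 0 (rev (tcode x))
  [:: tcode x ++ r; k; rev (tcode x); [::]; [::]] isT isT isT erefl.
by rewrite /= revK.
Qed.

Definition push_word (u : seq letter) := foldr (fun x c => Seq c (Push 0 x)) Skip u.

Lemma runs_within_push_word u v k a b c :
  runs_within (push_word u) [:: v; k; a; b; c] (2 * size u + 1) [:: u ++ v; k; a; b; c].
Proof.
elim: u v => [|x u IH] v; first exact: runs_within_skip.
apply: (runs_within_le (N := 2 * size u + 1 + 2)); last by rewrite /=; lia.
by apply: runs_within_seq; [apply: IH|wstep].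
Qed.

Lemma push_word_regs u : regs_le 4 (push_word u).
Proof. by elim: u => //= x u ->. Qed.

(** * Polynomial-time functions on encodable types *)

Class coded (T : Type) := tree : T -> bintree.

(** Pairs, nonempty lists and [Some] are all nodes, while [false], [None] and [[::]] are leaves.
    Once a pair is built, cons and [Some] cost nothing, and a case analysis is one test of the top
    letter. *)
#[export] Instance coded_unit : coded unit := fun=> Leaf.
#[export] Instance coded_bool : coded bool := fun b => if b then Node Leaf Leaf else Leaf.
#[export] Instance coded_prod T U (cT : coded T) (cU : coded U) : coded (T * U) :=
  fun x => Node (tree x.1) (tree x.2).
#[export] Instance coded_option T (cT : coded T) : coded (option T) :=
  fun x => if x is Some y then Node (tree y) Leaf else Leaf.
#[export] Instance coded_seq T (cT : coded T) : coded (seq T) :=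
  foldr (fun x y => Node (tree x) y) Leaf.

Definition sz {T} {cT : coded T} (x : T) := size (tcode (tree x)).

Lemma sz_gt0 {T} {cT : coded T} (x : T) : 0 < sz x.
Proof. exact: code_gt0. Qed.

Lemma sz_pair {T U} {cT : coded T} {cU : coded U} (x : T) (y : U) :
  sz (x, y) = (sz x + sz y).+1.
Proof. by rewrite /sz /= size_cat. Qed.

Lemma sz_cons {T} {cT : coded T} (x : T) s : sz (x :: s) = (sz x + sz s).+1.
Proof. by rewrite /sz /= size_cat. Qed.

Lemma sz_nil {T} {cT : coded T} : sz ([::] : seq T) = 1.
Proof. by []. Qed.

Lemma sz_some {T} {cT : coded T} (x : T) : sz (Some x) = (sz x).+2.
Proof. by rewrite /sz /= size_cat /= addn1. Qed.

Lemma sz_none {T} {cT : coded T} : sz (None : option T) = 1.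
Proof. by []. Qed.

Lemma sz_bool (b : bool) : sz b <= 3.
Proof. by case: b. Qed.

Lemma sz_unit (u : unit) : sz u = 1.
Proof. by case: u. Qed.

Lemma sz_cat {T} {cT : coded T} (s1 s2 : seq T) : (sz (s1 ++ s2)).+1 = sz s1 + sz s2.
Proof. by elim: s1 => [|x s IH] //; rewrite cat_cons !sz_cons; lia. Qed.

Lemma size_sz {T} {cT : coded T} (s : seq T) : size s < sz s.
Proof. by elim: s => [|x s IH] //; rewrite sz_cons /=; have := sz_gt0 x; lia. Qed.

(** The rest [r] of the stack and the counters [k] are arbitrary, so a program can run above saved
    data. The bound on the size of the result is kept because in a composition the second program
    runs on that result. *)
Definition ptime {A B} {cA : coded A} {cB : coded B} (f : A -> B) :=
  exists c T, [/\ regs_le 4 c,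
    forall a r k, runs_within c (std (tcode (tree a) ++ r) k) (T a)
                           (std (tcode (tree (f a)) ++ r) k),
    poly_bounded sz T & poly_bounded sz (fun a => sz (f a))].

Section Closure.
Context {A B C E S : Type} {cA : coded A} {cB : coded B} {cC : coded C}
  {cE : coded E} {cS : coded S}.

Lemma ptime_eq (f g : A -> B) : f =1 g -> ptime f -> ptime g.
Proof. by move=> /funext ->. Qed.

Lemma ptime_id : ptime (fun a : A => a).
Proof.
exists Skip, (fun=> 1); split=> //; pb.
by move=> a r k; apply: runs_within_skip.
Qed.

Lemma ptime_comp (g : B -> C) (f : A -> B) : ptime g -> ptime f -> ptime (fun a => g (f a)).
Proof.
move=> [cg [Tg [Rg Hg pTg pg]]] [cf [Tf [Rf Hf pTf pf]]].
exists (Seq cf cg), (fun a => Tf a + Tg (f a)); split=> /=.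
- by rewrite Rf.
- by move=> a r k; apply: runs_within_seq (Hf _ _ _) (Hg _ _ _).
- by pb; apply: pb_comp pTg pf.
- exact: pb_comp pg pf.
Qed.

Lemma ptime_const (b : B) : ptime (fun _ : A => b).
Proof.
exists (Seq drop_cmd (push_word (tcode (tree b)))),
  (fun a => 9 * sz a + 4 + (2 * sz b + 1)); split=> /=; pb.
- by rewrite push_word_regs.
- by move=> a r k; apply: runs_within_seq; [apply: runs_within_drop|apply: runs_within_push_word].
Qed.

Lemma ptime_pair (f : A -> B) (g : A -> C) : ptime f -> ptime g ->
  ptime (fun a => (f a, g a)).
Proof.
move=> [cf [Tf [Rf Hf pTf pf]]] [cg [Tg [Rg Hg pTg pg]]].
(* The duplicate of the argument waits under the result of [f] until the first swap; the last swap
   brings [f a] to the top before the node letter closes the pair. *)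
exists (Seq dup_cmd (Seq cf (Seq swap_cmd (Seq cg (Seq swap_cmd (Push 0 tt1)))))).
exists (fun a => 29 * sz a + 6 + (Tf a + (13 * sz (f a) + 13 * sz a + 8
   + (Tg a + (13 * sz (g a) + 13 * sz (f a) + 8 + 2))))); split=> /=; pb.
- by rewrite Rf Rg.
- move=> a r k; apply: runs_within_seq; first exact: runs_within_dup.
  apply: runs_within_seq; first exact: Hf.
  apply: runs_within_seq; first exact: runs_within_swap.
  apply: runs_within_seq; first exact: Hg.
  apply: runs_within_seq; first exact: runs_within_swap.
  rewrite /= -catA; exact: runs_within_push.
- apply: (pb_le (g' := fun a => sz (f a) + sz (g a) + 1)); last by pb.
  by move=> a; rewrite sz_pair addn1.
Qed.

End Closure.

Section Closure.
Context {A B C E S : Type} {cA : coded A} {cB : coded B} {cC : coded C}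
  {cE : coded E} {cS : coded S}.

Lemma ptime_fst (f : A -> B * C) : ptime f -> ptime (fun a => (f a).1).
Proof.
apply: ptime_comp; exists (Seq (Pop 0) (Seq swap_cmd drop_cmd)).
exists (fun x => 1 + (13 * sz x.1 + 13 * sz x.2 + 8 + (9 * sz x.2 + 4))); split=> //=.
- move=> [x y] r k; apply: runs_within_seq; first by wstep.
  rewrite /= -catA; apply: runs_within_seq; first exact: runs_within_swap.
  exact: runs_within_drop.
- apply: (pb_le (g' := fun x => 13 * sz x + 13 * sz x + 13 + 9 * sz x)); last by pb.
  by case=> x y; rewrite sz_pair /=; lia.
- by apply: (pb_le (g' := sz)) (pb_id _) => -[x y]; rewrite sz_pair /=; lia.
Qed.

Lemma ptime_snd (f : A -> B * C) : ptime f -> ptime (fun a => (f a).2).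
Proof.
apply: ptime_comp; exists (Seq (Pop 0) drop_cmd).
exists (fun x => 1 + (9 * sz x.1 + 4)); split=> //=.
- move=> [x y] r k; apply: runs_within_seq; first by wstep.
  rewrite /= -catA; exact: runs_within_drop.
- apply: (pb_le (g' := fun x => 5 + 9 * sz x)); last by pb.
  by case=> x y; rewrite sz_pair /=; lia.
- by apply: (pb_le (g' := sz)) (pb_id _) => -[x y]; rewrite sz_pair /=; lia.
Qed.

Lemma ptime_cons (f : A -> B) (g : A -> seq B) : ptime f -> ptime g ->
  ptime (fun a => f a :: g a).
Proof.
move=> Hf Hg; apply: (ptime_comp (g := fun x => x.1 :: x.2) (f := fun a => (f a, g a))); last exact: ptime_pair Hf Hg.
exists Skip, (fun=> 1); split=> //; pb.
- by move=> [x s] r k; apply: runs_within_skip.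
Qed.

Lemma ptime_some (f : A -> B) : ptime f -> ptime (fun a => Some (f a)).
Proof.
move=> Hf; apply: (ptime_comp (g := fun x : B * unit => Some x.1) (f := fun a => (f a, tt))).
  exists Skip, (fun=> 1); split=> //; pb.
  - by move=> [x []] r k; apply: runs_within_skip.
by apply: ptime_pair => //; apply: ptime_const.
Qed.

(** With the scrutinee on top of the saved argument, pushing one node letter yields the code of the
    pair of its components and the argument. Destructuring is thus free: [h a] is that pair, [b a]
    the tree that is tested, and [p] computes a value with this tree. *)
Lemma ptime_case (b : A -> bintree) (f : A -> B) (g : C -> B) (h : A -> option C)
    (p : A -> S) :
  ptime p -> (forall a, tree (p a) = b a) ->
  ptime f -> ptime g ->
  (forall a, if h a is Some x then
     tree x = Node (b a) (tree a) /\ (exists y z, b a = Node y z) else b a = Leaf) ->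
  ptime (fun a => if h a is Some x then g x else f a).
Proof.
move=> [cp [Tp [Rp Hp pTp pp]]] Eb [cf [Tf [Rf Hf pTf pf]]] [cg [Tg [Rg Hg pTg pg]]] Hh.
have szh a x : h a = Some x -> sz x = sz (p a) + sz a + 1.
  by have := Hh a; case: (h a) => // x' [E1 _] [<-]; rewrite /sz E1 Eb /= size_cat addn1.
have pbh (t : C -> nat) : poly_bounded sz t ->
    poly_bounded sz (fun a => if h a is Some x then t x else 0).
  move=> [d Hd]; apply: (pb_le (g' := fun a => (sz (p a) + sz a + 1 + 2) ^ d)); last by pb.
  by move=> a; case: (h a) (szh a) => // x /(_ _ erefl) <-.
exists (Seq dup_cmd (Seq cp (If 0 is_true_top (Seq (Push 0 tt1) cg) (Seq (Pop 0) cf)))).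
exists (fun a => 29 * sz a + 6 + (Tp a + (2 + (if h a is Some x then Tg x else 0) + (1 + Tf a) + 2))).
split=> /=.
- by rewrite Rp Rf Rg.
- move=> a r k; apply: runs_within_seq; first exact: runs_within_dup.
  apply: runs_within_seq; first exact: Hp.
  rewrite Eb; case: (h a) (Hh a) => [x [Ex [y [z Ey]]]|En].
    apply: (runs_within_le (N := (2 + Tg x).+1)); last by lia.
    apply: runs_within_then; first by rewrite Ey.
    apply: runs_within_seq; first exact: runs_within_push.
    by have := Hg x r k; rewrite Ex /= -catA.
  apply: (runs_within_le (N := (1 + Tf a).+1)); last by lia.
  apply: runs_within_else; first by rewrite En.
  by apply: runs_within_seq (Hf a r k); rewrite En; wstep.
- by pb; apply: pbh.
- apply: (pb_le (g' := fun a => (if h a is Some x then sz (g x) else 0) + sz (f a))).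
    by move=> a; case: (h a) => [x|]; lia.
  by pb; apply: (pbh (fun x => sz (g x))).
Qed.

End Closure.

Section Closure.
Context {A B C E S : Type} {cA : coded A} {cB : coded B} {cC : coded C}
  {cE : coded E} {cS : coded S}.

Lemma ptime_if (b : A -> bool) (f g : A -> B) : ptime b -> ptime f -> ptime g ->
  ptime (fun a => if b a then f a else g a).
Proof.
move=> Hb Hf Hg.
(* The tree of [true] is a node, so [true] itself can be the payload of the [Some] branch. *)
apply: (ptime_eq (f := fun a => if (if b a then Some (true, a) else None) is Some x then f x.2 else g a)).
  by move=> a; case: (b a).
apply: (ptime_case Hb (fun=> erefl) Hg).
  by apply: ptime_comp Hf _; apply: ptime_snd; apply: ptime_id.
by move=> a; case: (b a) => //=; split=> //; exists Leaf, Leaf.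
Qed.
End Closure.

Ltac pt_ext := fail.
Ltac pt_step := match goal with
  | H : ptime ?f |- ptime ?f => exact: H
  | |- ptime (fun _ => ?b) => exact: ptime_const
  | |- ptime (fun x => x) => exact: ptime_id
  | |- ptime (fun _ => (_, _)) => apply: ptime_pair
  | |- ptime fst => exact: (ptime_fst ptime_id)
  | |- ptime snd => exact: (ptime_snd ptime_id)
  | |- ptime (fun _ => _.1) => apply: ptime_fst
  | |- ptime (fun _ => _.2) => apply: ptime_snd
  | |- ptime (fun _ => _ :: _) => apply: ptime_cons
  | |- ptime (fun _ => Some _) => apply: ptime_some
  | |- ptime (fun _ => if _ then _ else _) => apply: ptime_if
  | _ => pt_ext
  end; cbv beta.
Ltac pt := repeat pt_step.

Section Closure2.
Context {A B C E S : Type} {cA : coded A} {cB : coded B} {cC : coded C}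
  {cE : coded E} {cS : coded S}.

Lemma ptime_negb (f : A -> bool) : ptime f -> ptime (fun a => ~~ f a).
Proof.
move=> Hf; apply: (ptime_eq (f := fun a => if f a then false else true)); last by pt.
by move=> a; case: (f a).
Qed.

Lemma ptime_andb (f g : A -> bool) : ptime f -> ptime g -> ptime (fun a => f a && g a).
Proof.
move=> Hf Hg; apply: (ptime_eq (f := fun a => if f a then g a else false)); last by pt.
by move=> a; case: (f a).
Qed.

Lemma ptime_orb (f g : A -> bool) : ptime f -> ptime g -> ptime (fun a => f a || g a).
Proof.
move=> Hf Hg; apply: (ptime_eq (f := fun a => if f a then true else g a)); last by pt.
by move=> a; case: (f a).
Qed.

Lemma ptime_match_seq (l : A -> seq E) (f : A -> B) (g : A -> E -> seq E -> B) :
  ptime l -> ptime f -> ptime (fun p : A * (E * seq E) => g p.1 p.2.1 p.2.2) ->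
  ptime (fun a => match l a with [::] => f a | e :: s => g a e s end).
Proof.
move=> Hl Hf Hg.
apply: (ptime_eq (f := fun a =>
  if (if l a is e :: s then Some ((e, s), a) else None) is Some x
  then g x.2 x.1.1 x.1.2 else f a)); first by move=> a; case: (l a).
apply: (ptime_case Hl (fun=> erefl) Hf).
  by apply: (ptime_comp Hg (f := fun x => (x.2, x.1))); pt.
move=> a; case: (l a) => //= e s; split=> //.
by exists (tree e), (tree s).
Qed.

Lemma ptime_match_option (o : A -> option E) (f : A -> B) (g : A -> E -> B) :
  ptime o -> ptime f -> ptime (fun p : A * E => g p.1 p.2) ->
  ptime (fun a => match o a with Some e => g a e | None => f a end).
Proof.
move=> Ho Hf Hg.
apply: (ptime_eq (f := fun a =>
  if (if o a is Some e then Some ((e, tt), a) else None) is Some x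
  then g x.2 x.1.1 else f a)); first by move=> a; case: (o a).
apply: (ptime_case Ho (fun=> erefl) Hf).
  by apply: (ptime_comp Hg (f := fun x => (x.2, x.1.1))); pt.
move=> a; case: (o a) => //= e; split=> //.
by exists (tree e), Leaf.
Qed.

(** The counter is the length of the code of the tree, in unary; the separator below it protects the
    counters of enclosing loops. *)
Definition load_cmd := Seq (take_tree 2) (Seq (Push 1 (None : letter))
  (While 2 nonempty_top (Seq (Pop 2) (Push 1 tt1)))).

Lemma runs_within_load x r k :
  runs_within load_cmd (std (tcode x ++ r) k) (11 * size (tcode x) + 6)
    (std r (nseq (size (tcode x)) tt1 ++ None :: k)).
Proof.
have L u v m : runs_within (While 2 nonempty_top (Seq (Pop 2) (Push 1 tt1)))
    [:: v; nseq m tt1 ++ None :: k; u; [::]; [::]] (4 * size u + 1)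
    [:: v; nseq (size u + m) tt1 ++ None :: k; [::]; [::]; [::]].
  elim: u m => [|y u IH] m; first exact: runs_within_stop.
  apply: (runs_within_le (N := (1 + 2 + (4 * size u + 1)).+1)); last by rewrite /=; lia.
  have -> : size (y :: u) + m = size u + m.+1 by rewrite /= addSnnS.
  apply: runs_within_loop (IH m.+1) => //.
  by apply: runs_within_seq; wstep.
apply: (runs_within_le (N := 7 * size (tcode x) + 3 + (2 + (4 * size (rev (tcode x)) + 1)))).
  apply: runs_within_seq; first exact: runs_within_take2.
  apply: runs_within_seq; first exact: runs_within_push.
  by have := L (rev (tcode x)) r 0; rewrite cats0 addn0 size_rev.
by rewrite size_rev; lia.
Qed.

(** The bound on every iterate is essential: the polynomial for [g] alone would be composed with
    itself once per iteration. *)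
Lemma ptime_iter (l : A -> C) (z : A -> S) (g : S -> S) (bound : A -> nat) :
  ptime l -> ptime z -> ptime g -> poly_bounded sz bound ->
  (forall a n, n <= sz (l a) -> sz (iter n g (z a)) <= bound a) ->
  ptime (fun a => iter (sz (l a)) g (z a)).
Proof.
move=> [cl [Tl [Rl Hl pTl pl]]] [cz [Tz [Rz Hz pTz pz]]] [cg [Tg [Rg Hg [d Hd] pg]]] pB HB.
exists (Seq dup_cmd (Seq cl (Seq swap_cmd (Seq cz (Seq swap_cmd (Seq load_cmd
  (Seq (While 1 is_true_top (Seq (Pop 1) cg)) (Pop 1)))))))).
(* In each round the 2 pays for the loop test and the [Pop]; the final 1 pays for the last test. *)
pose W (a : A) := @sz _ cC (l a) * ((bound a + 2) ^ d + 2) + 1.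
exists (fun a => 29 * sz a + 6 + (Tl a + (13 * sz (l a) + 13 * sz a + 8 +
  (Tz a + (13 * sz (z a) + 13 * sz (l a) + 8 + (11 * sz (l a) + 6 + (W a + 1))))))).
split=> /=.
- by rewrite Rl Rz Rg.
- move=> a r k; apply: runs_within_seq; first exact: runs_within_dup.
  apply: runs_within_seq; first exact: Hl.
  apply: runs_within_seq; first exact: runs_within_swap.
  apply: runs_within_seq; first exact: Hz.
  apply: runs_within_seq; first exact: runs_within_swap.
  apply: runs_within_seq; first exact: runs_within_load.
  apply: (@runs_within_seq _ _ _ _ (std (tcode (tree (iter (sz (l a)) g (z a))) ++ r) (None :: k)));
    last exact: runs_within_pop.
  have L m n : n + m <= sz (l a) -> runs_within (While 1 is_true_top (Seq (Pop 1) cg))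
      (std (tcode (tree (iter n g (z a))) ++ r) (nseq m tt1 ++ None :: k))
      (m * ((bound a + 2) ^ d + 2) + 1)
      (std (tcode (tree (iter (n + m) g (z a))) ++ r) (None :: k)).
    elim: m n => [|m IH] n le; first by rewrite addn0; apply: runs_within_stop.
    apply: (runs_within_le (N := (1 + Tg (iter n g (z a)) + (m * ((bound a + 2) ^ d + 2) + 1)).+1)).
      have -> : n + m.+1 = n.+1 + m by rewrite addnS.
      apply: runs_within_loop (IH n.+1 _) => //; last by lia.
      by apply: runs_within_seq; [wstep|apply: Hg].
    have := Hd (iter n g (z a)); set e1 := _ ^ d; set e2 := _ ^ d => le1.
    have : e1 <= e2.
      rewrite /e1 /e2; case: (posnP d) => [->|d0] //.
      by rewrite leq_exp2r // leq_add2r HB //; lia.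
    by lia.
  by apply: (L (sz (l a)) 0).
- by pb; apply: pb_mul => //; pb.
- by apply: pb_le pB => a; apply: HB.
Qed.

End Closure2.

Section Closure3.
Context {A E S : Type} {cA : coded A} {cE : coded E} {cS : coded S}.

Lemma ptime_foldl (l : A -> seq E) (z : A -> S) (f : A -> S -> E -> S) (bound : A -> nat) :
  ptime l -> ptime z -> ptime (fun p : A * (S * E) => f p.1 p.2.1 p.2.2) ->
  poly_bounded sz bound ->
  (forall a l1 l2, l a = l1 ++ l2 -> sz (foldl (f a) (z a) l1) <= bound a) ->
  ptime (fun a => foldl (f a) (z a) (l a)).
Proof.
move=> Hl Hz Hf pB HB.
(* Once the list is used up [g] is the identity, so [sz (l a)] iterations, which exceed the number
   of elements, do no harm. The argument is carried along because [f] depends on it. *)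
pose g (x : A * (seq E * S)) := match x.2.1 with
  [::] => x | e :: s => (x.1, (s, f x.1 x.2.2 e)) end.
have Eg a n : iter n g (a, (l a, z a))
    = (a, (drop n (l a), foldl (f a) (z a) (take n (l a)))).
  elim: n => [|n IH]; first by rewrite drop0 take0.
  rewrite iterS IH /g /=; case: (ltnP n (size (l a))) => ln; last first.
    by rewrite !drop_oversize ?(leqW ln) // !take_oversize ?(leqW ln).
  case: (l a) ln => // e0 s ln.
  by rewrite (drop_nth e0 ln) (take_nth e0 ln) -cats1 foldl_cat.
apply: (ptime_eq (f := fun a => (iter (sz (l a)) g (a, (l a, z a))).2.2)).
  by move=> a; rewrite Eg /= take_oversize // ltnW // size_sz.
do 2 apply: ptime_snd.
apply: (ptime_iter (l := l) (z := fun a => (a, (l a, z a))) (g := g) (bound := fun a => sz a + (sz (l a) + bound a).+2)) => //.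
- by pt.
- rewrite /g; apply: (ptime_match_seq (f := id)
    (g := fun x e s => (x.1, (s, f x.1 x.2.2 e)))); pt.
  by apply: (ptime_comp Hf (f := fun p => (p.1.1, (p.1.2.2, p.2.1)))); pt.
- case: Hl => _ [_ [_ _ _ pl]]; pb.
  under eq_fun do rewrite -addn2; pb.
move=> a n _; rewrite Eg !sz_pair; have := HB a _ _ (esym (cat_take_drop n (l a))).
pose proof (sz_cat (take n (l a)) (drop n (l a))) as E1.
pose proof (sz_gt0 (take n (l a))); rewrite cat_take_drop in E1.
by lia.
Qed.
End Closure3.

Lemma ptime_pb {A B} {cA : coded A} {cB : coded B} (f : A -> B) :
  ptime f -> poly_bounded sz (fun a => sz (f a)).
Proof. by case=> c [T [_ _ _ H]]. Qed.

Ltac pb_step := match goal with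
  | |- poly_bounded ?s ?s => exact: pb_id
  | |- poly_bounded _ (fun x => sz x) => exact: pb_id
  | H : ptime ?f |- poly_bounded _ (fun x => sz (?f x)) => exact: (ptime_pb H)
  | H : poly_bounded ?s ?f |- poly_bounded ?s ?f => exact: H
  | |- poly_bounded _ (fun _ => ?n) => exact: pb_const
  | |- poly_bounded _ (fun _ => _ + _) => apply: pb_add
  | |- poly_bounded _ (fun _ => _ * _) => apply: pb_mul
  | |- poly_bounded _ (fun _ => _ ^ _) => apply: pb_exp
  end.
Ltac pb ::= repeat pb_step.

Lemma sz_foldl_growth {E S} {cE : coded E} {cS : coded S} (f : S -> E -> S) b z l :
  (forall s e, sz (f s e) <= sz s + sz e + b) ->
  sz (foldl f z l) <= sz z + sz l + size l * b.
Proof.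
move=> H; elim: l z => [|e l IH] z; first by rewrite sz_nil /=; lia.
by rewrite sz_cons /=; apply: leq_trans (IH _) _; have := H z e; lia.
Qed.

Lemma sz_catl {T} {cT : coded T} (s1 s2 : seq T) : sz s1 <= sz (s1 ++ s2).
Proof. by pose proof (sz_cat s1 s2); pose proof (sz_gt0 s2); lia. Qed.

Lemma sz_catr {T} {cT : coded T} (s1 s2 : seq T) : sz s2 <= sz (s1 ++ s2).
Proof. by pose proof (sz_cat s1 s2); pose proof (sz_gt0 s1); lia. Qed.

(** Every element is charged only once, so the accumulator never exceeds the initial size, the size
    of the list and [b a] for each element together. *)
Lemma ptime_foldl_growth {A E S : Type} {cA : coded A} {cE : coded E} {cS : coded S}
    (l : A -> seq E) (z : A -> S) (f : A -> S -> E -> S) (b : A -> nat) :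
  ptime l -> ptime z -> ptime (fun p : A * (S * E) => f p.1 p.2.1 p.2.2) ->
  poly_bounded sz b ->
  (forall a s e, sz (f a s e) <= sz s + sz e + b a) ->
  ptime (fun a => foldl (f a) (z a) (l a)).
Proof.
move=> Hl Hz Hf pB HB.
apply: (ptime_foldl (bound := fun a => sz (z a) + sz (l a) + sz (l a) * b a)) => //; first by pb.
move=> a l1 l2 ->; apply: leq_trans (sz_foldl_growth _ _ (HB a)) _.
pose proof (size_sz l1); pose proof (sz_catl l1 l2).
by rewrite leq_add ?leq_add // leq_mul //; lia.
Qed.

Lemma ptime_rev {A E : Type} {cA : coded A} {cE : coded E}
    (l : A -> seq E) : ptime l -> ptime (fun a => rev (l a)).
Proof.
move=> Hl; apply: (ptime_eq (f := fun a => foldl (fun s e => e :: s) [::] (l a))).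
  by move=> a; rewrite -[RHS]cats0 -/(catrev _ _); elim: (l a) [::] => //= x s IH t; rewrite IH rev_cons cat_rcons.
apply: (ptime_foldl_growth (f := fun a s e => e :: s) (b := fun=> 1)); pt; pb.
by move=> _ s e; rewrite sz_cons; lia.
Qed.

Lemma ptime_foldr {A E S : Type} {cA : coded A} {cE : coded E} {cS : coded S}
    (l : A -> seq E) (z : A -> S) (f : A -> E -> S -> S) (bound : A -> nat) :
  ptime l -> ptime z -> ptime (fun p : A * (E * S) => f p.1 p.2.1 p.2.2) ->
  poly_bounded sz bound ->
  (forall a l1 l2, l a = l1 ++ l2 -> sz (foldr (f a) (z a) l2) <= bound a) ->
  ptime (fun a => foldr (f a) (z a) (l a)).
Proof.
move=> Hl Hz Hf pB HB.
apply: (ptime_eq (f := fun a => foldl (fun s e => f a e s) (z a) (rev (l a)))).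
  by move=> a; rewrite foldl_rev.
apply: (ptime_foldl (f := fun a s e => f a e s) (bound := bound)) => //; first exact: ptime_rev.
  by apply: (ptime_comp Hf (f := fun p => (p.1, (p.2.2, p.2.1)))); pt.
move=> a l1 l2 E1; rewrite -[l1]revK foldl_rev; apply: (HB a (rev l2)).
by rewrite -rev_cat -E1 revK.
Qed.

Lemma ptime_cat {A E : Type} {cA : coded A} {cE : coded E}
    (l1 l2 : A -> seq E) : ptime l1 -> ptime l2 ->
  ptime (fun a => l1 a ++ l2 a).
Proof.
move=> H1 H2; apply: (ptime_eq (f := fun a => foldr cons (l2 a) (l1 a)));
  first by move=> a; elim: (l1 a) => //= x s ->.
apply: (ptime_foldr (l := l1) (z := l2) (f := fun _ e s => e :: s)
    (bound := fun a => sz (l1 a) + sz (l2 a))); pt; pb.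
move=> a k1 k2 ->; have -> : foldr (fun e s => e :: s) (l2 a) k2 = k2 ++ l2 a by elim: k2 => //= x s ->.
by pose proof (sz_cat k2 (l2 a)); pose proof (sz_catr k1 k2); lia.
Qed.

(** A traversal with a state and one output per element. Maps, carry propagation and the parsing of
    consecutive records all have this form. *)
Fixpoint mealy {E S O : Type} (f : S -> E -> O * S) (s : S) (l : seq E) : seq O * S :=
  if l is e :: l' then
    ((f s e).1 :: (mealy f (f s e).2 l').1, (mealy f (f s e).2 l').2)
  else ([::], s).

Lemma size_mealy {E S O : Type} (f : S -> E -> O * S) s l : size (mealy f s l).1 = size l.
Proof. by elim: l s => //= e l IH s; rewrite IH. Qed.

Lemma mealy_cat {E S O : Type} (f : S -> E -> O * S) s l1 l2 : mealy f s (l1 ++ l2) =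
  ((mealy f s l1).1 ++ (mealy f (mealy f s l1).2 l2).1, (mealy f (mealy f s l1).2 l2).2).
Proof. by elim: l1 s => [|e l IH] s /=; [case: mealy|rewrite IH]. Qed.

Lemma mealy_foldl {E S O : Type} (f : S -> E -> O * S) s l : foldl (fun x e => ((f x.2 e).1 :: x.1, (f x.2 e).2)) ([::], s) l
  = (rev (mealy f s l).1, (mealy f s l).2).
Proof.
rewrite -[rev _]cats0; elim: l s [::] => //= e l IH s os.
by rewrite IH rev_cons cat_rcons.
Qed.

Lemma ptime_mealy {A E S O : Type} {cA : coded A} {cE : coded E} {cS : coded S} {cO : coded O}
    (l : A -> seq E) (z : A -> S) (f : A -> S -> E -> O * S) (bound : A -> nat) :
  ptime l -> ptime z -> ptime (fun p : A * (S * E) => f p.1 p.2.1 p.2.2) ->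
  poly_bounded sz bound ->
  (forall a l1 l2, l a = l1 ++ l2 -> sz (mealy (f a) (z a) l1).2 <= bound a) ->
  ptime (fun a => mealy (f a) (z a) (l a)).
Proof.
move=> Hl Hz Hf pB HB.
pose g a := foldl (fun x e => ((f a x.2 e).1 :: x.1, (f a x.2 e).2)) ([::] : seq O, z a) (l a).
have Hg : ptime g.
  have [d Hd] := ptime_pb Hf.
  (* The outputs are not bounded by assumption: [c a] is the polynomial of [f] at the largest
     argument it can meet, with a state below [bound a] and an element below [sz (l a)]. *)
  pose c (a : A) := (@sz _ cA a + (bound a + @sz _ (coded_seq cE) (l a) + 1) + 1 + 2) ^ d.
  rewrite /g; apply: (ptime_foldl (f := fun a (x : seq O * S) e => ((f a x.2 e).1 :: x.1, (f a x.2 e).2))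
    (z := fun a => ([::] : seq O, z a))
    (bound := fun a => (sz (l a) * (c a + 1) + 1 + bound a + 1))).
  - exact: Hl.
  - by pt.
  - have Hf' : ptime (fun p : A * ((seq O * S) * E) => f p.1 p.2.1.2 p.2.2).
      by apply: (ptime_comp Hf (f := fun p => (p.1, (p.2.1.2, p.2.2)))); pt.
    by pt.
  - by rewrite /c; pb.
  move=> a l1 l2 E1; rewrite mealy_foldl sz_pair addn1 ltnS leq_add ?(HB _ _ l2) //.
  have Rv (s : seq O) : sz (rev s) = sz s.
    elim: s => // x s IH; rewrite rev_cons -cats1.
    by pose proof (sz_cat (rev s) [:: x]) as X; rewrite !sz_cons sz_nil IH in X *; lia.
  have R : sz (mealy (f a) (z a) l1).1 <= size l1 * (c a + 1) + 1.
    rewrite /c; elim/last_ind: l1 l2 E1 => [|l1 e IH] l2 E1; first by rewrite sz_nil.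
    rewrite cat_rcons in E1; have {IH} := IH _ E1.
    rewrite -/(c a) -cats1 mealy_cat /=; set os := (mealy _ _ l1).1; set s := (mealy _ _ l1).2 => IH.
    pose proof (sz_cat os [:: (f a s e).1]) as X; rewrite sz_cons sz_nil in X.
    have : sz (f a s e).1 <= c a.
      have Y : sz (f a s e).1 + sz (f a s e).2 < ((sz a + (sz s + sz e).+1).+1 + 2) ^ d.
        by have := Hd (a, (s, e)) => /=; rewrite [f a s e]surjective_pairing !sz_pair.
      apply: leq_trans (leq_addr (sz (f a s e).2) _) _; apply: leq_trans (ltnW Y) _.
      rewrite /c; case: (posnP d) => [->|d0] //; rewrite leq_exp2r //.
      have := HB a l1 _ E1; rewrite -/s.
      have : sz e <= sz (l a).
        by rewrite E1; pose proof (sz_catr l1 (e :: l2)) as Z; rewrite sz_cons in Z; lia.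
      by lia.
    by rewrite size_cat /= mulnDl; lia.
  have : size l1 <= sz (l a).
    by rewrite E1; pose proof (sz_catl l1 l2); pose proof (size_sz l1); lia.
  by move=> le; rewrite Rv; apply: leq_trans R _; rewrite leq_add2r leq_mul2r le orbT.
apply: (ptime_eq (f := fun a => (rev (g a).1, (g a).2))).
  by move=> a; rewrite /g mealy_foldl revK; case: mealy.
by apply: ptime_pair; [apply: ptime_rev|]; apply: (ptime_comp _ Hg) => /=; pt.
Qed.

Lemma sz_mealy_growth {E S O : Type} {cE : coded E} {cS : coded S}
    (f : S -> E -> O * S) b z l :
  (forall s e, sz (f s e).2 <= sz s + sz e + b) ->
  sz (mealy f z l).2 <= sz z + sz l + size l * b.
Proof.
move=> H; elim: l z => [|e l IH] z; first by rewrite sz_nil /=; lia.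
by rewrite sz_cons /=; apply: leq_trans (IH _) _; have := H z e; lia.
Qed.

Lemma ptime_mealy_growth {A E S O : Type} {cA : coded A} {cE : coded E} {cS : coded S}
    {cO : coded O} (l : A -> seq E) (z : A -> S) (f : A -> S -> E -> O * S) (b : A -> nat) :
  ptime l -> ptime z -> ptime (fun p : A * (S * E) => f p.1 p.2.1 p.2.2) ->
  poly_bounded sz b -> (forall a s e, sz (f a s e).2 <= sz s + sz e + b a) ->
  ptime (fun a => mealy (f a) (z a) (l a)).
Proof.
move=> Hl Hz Hf pB HB.
apply: (ptime_mealy (bound := fun a => sz (z a) + sz (l a) + sz (l a) * b a)) => //; first by pb.
move=> a l1 l2 ->; apply: leq_trans (sz_mealy_growth _ _ (HB a)) _.
pose proof (size_sz l1); pose proof (sz_catl l1 l2).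
by rewrite leq_add ?leq_add // leq_mul //; lia.
Qed.

Lemma ptime_map {A E O : Type} {cA : coded A} {cE : coded E} {cO : coded O}
    (l : A -> seq E) (f : A -> E -> O) :
  ptime l -> ptime (fun p : A * E => f p.1 p.2) ->
  ptime (fun a => [seq f a e | e <- l a]).
Proof.
move=> Hl Hf.
apply: (ptime_eq (f := fun a => (mealy (fun s e => (f a e, s)) tt (l a)).1)).
  by move=> a; elim: (l a) => //= e s ->.
apply: ptime_fst; apply: (ptime_mealy_growth (f := fun a s e => (f a e, s)) (b := fun=> 0)) => //.
- by pt.
- by apply: ptime_pair; [apply: (ptime_comp Hf (f := fun p => (p.1, p.2.2)))|]; pt.
- by pb.
Qed.

Lemma ptime_zip {A E O : Type} {cA : coded A} {cE : coded E} {cO : coded O}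
    (l : A -> seq E) (m : A -> seq O) :
  ptime l -> ptime m -> ptime (fun a => zip (l a) (m a)).
Proof.
move=> Hl Hm.
pose f (x : seq O * seq (E * O)) (e : E) :=
  match x.1 with [::] => x | y :: t => (t, (e, y) :: x.2) end.
apply: (ptime_eq (f := fun a => rev (foldl f (m a, [::]) (l a)).2)).
  move=> a; rewrite -[RHS]cat0s -[[::] in RHS]/(rev ([::] : seq (E * O))).
  elim: (l a) (m a) ([::] : seq (E * O)) => [|e s IH] t r; first by case: t => [|? ?]; rewrite /= cats0.
  case: t => [|y t]; last by rewrite IH rev_cons cat_rcons.
  by rewrite IH; case: s {IH}.
apply: ptime_rev; apply: ptime_snd.
apply: (ptime_foldl_growth (f := fun=> f) (z := fun a => (m a, [::])) (b := fun=> 1)) => //; pb.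
- by pt.
- apply: (ptime_match_seq (l := fun p : A * ((seq O * seq (E * O)) * E) => p.2.1.1)
    (f := fun p => p.2.1) (g := fun p y t => (t, (p.2.2, y) :: p.2.1.2))); pt.
- move=> _ [[|y t] r] e; rewrite /f /=; first by lia.
  by rewrite !sz_pair !sz_cons !sz_pair; lia.
Qed.

(** Truncation to a length given in unary, expressed by [zip] so that it needs no arithmetic. *)
Definition take_as {E T : Type} (u : seq T) (l : seq E) := unzip2 (zip u l).

Lemma take_asE {E T : Type} (u : seq T) (l : seq E) : take_as u l = take (size u) l.
Proof. by rewrite /take_as; elim: u l => [|x u IH] [|y l] //=; rewrite IH. Qed.

Lemma ptime_take_as {A E T : Type} {cA : coded A} {cE : coded E} {cT : coded T}
    (u : A -> seq T) (l : A -> seq E) :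
  ptime u -> ptime l -> ptime (fun a => take_as (u a) (l a)).
Proof.
move=> Hu Hl; apply: (ptime_map (f := fun _ x => x.2)); last by pt.
exact: ptime_zip.
Qed.

(** * Binary arithmetic *)

Fixpoint bval (x : seq bool) : nat := if x is b :: x' then b + (bval x').*2 else 0.

Lemma bval_cat x y : bval (x ++ y) = bval x + 2 ^ size x * bval y.
Proof. by elim: x => [|b x IH] /=; rewrite ?mul1n // IH expnS; lia. Qed.

Lemma bval_zeros {T} (y : seq T) : bval [seq false | _ <- y] = 0.
Proof. by elim: y => //= b y ->. Qed.

Lemma bval_lt x : bval x < 2 ^ size x.
Proof. by elim: x => [|b x IH] //=; rewrite expnS; case: b => /=; lia. Qed.

Definition nonempty {T} (s : seq T) := if s is _ :: _ then true else false.

Definition trim : seq bool -> seq bool :=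
  foldr (fun b s => if b || nonempty s then b :: s else [::]) [::].

Lemma bval_trim x : bval (trim x) = bval x.
Proof. by elim: x => //= b x <-; case: b => //=; case: (trim x). Qed.

Lemma trim_nil_or x : trim x = [::] \/ 2 ^ (size (trim x)).-1 <= bval x.
Proof.
elim: x => [|b x IH] /=; first by left.
case: IH => [->|].
  by rewrite orbF; case: b; [right|left].
case E1: (trim x) => [|c y] /=; last by rewrite orbT /= expnS; right; case: b; lia.
by rewrite orbF; case: b => //=; [right|left].
Qed.

Lemma size_trim x n : bval x < 2 ^ n -> size (trim x) <= n.
Proof.
case: (trim_nil_or x) => [-> //|le lt]; rewrite leqNgt; apply/negP => lt2.
have : 2 ^ n <= 2 ^ (size (trim x)).-1 by rewrite leq_exp2l //; lia.
by lia.
Qed.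

Lemma trim_inj x y : trim x = x -> trim y = y -> bval x = bval y -> x = y.
Proof.
elim: x y => [|b x IH] [|c y] // tx ty.
- move=> E1; case: (trim_nil_or (c :: y)); rewrite ty -?E1 //.
  by rewrite leqNgt expn_gt0.
- move=> E1; case: (trim_nil_or (b :: x)); rewrite tx ?E1 //.
  by rewrite leqNgt expn_gt0.
- move: tx ty => /=; case: ifP => // _ [tx]; case: ifP => // _ [ty] E1.
  have bc : b = c by move: E1; clear; case: b c => [] []; lia.
  by rewrite bc (IH y) //; move: E1; rewrite bc; lia.
Qed.

Lemma trimK x : trim (trim x) = trim x.
Proof.
elim: x => //= b x IH; case: ifP => //= H.
by rewrite IH H.
Qed.

Lemma bval_nat_bits n : bval (nat_bits n) = n.
Proof.
rewrite /nat_bits -{2}(bin_of_natK n); case: (bin_of_nat n) => //= p.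
by elim: p => [p IH|p IH|] //=; rewrite IH natTrecE.
Qed.

Lemma trim_nat_bits n : trim (nat_bits n) = nat_bits n.
Proof.
rewrite /nat_bits; case: (bin_of_nat n) => //= p.
by elim: p => [p IH|p IH|] //=; rewrite IH //; case: p {IH}.
Qed.

(** Trimmed words are determined by their values. This makes computed numbers agree letter by letter
    with the encoding required of the output. *)
Lemma trim_bits x : trim x = nat_bits (bval x).
Proof. by apply: trim_inj; rewrite ?trimK ?trim_nat_bits ?bval_trim ?bval_nat_bits. Qed.

(** The carry of a full adder; with [x] complemented it is the borrow of a subtraction. *)
Definition majority (x y z : bool) := if x then y || z else y && z.

(* One column of a subtraction (when [neg]) or of an addition; the state holds
   the borrow or carry and the remaining bits of the second operand. *)
Definition column (neg : bool) (s : bool * seq bool) (x : bool) : bool * (bool * seq bool) :=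
  (x (+) (head false s.2 (+) s.1),
   (majority (x (+) neg) (head false s.2) s.1, behead s.2)).

(** The first operand is padded with as many zeros as the second has bits, so that the second is
    read to its end. *)
Definition columns (neg : bool) (x y : seq bool) : seq bool * (bool * seq bool) :=
  mealy (column neg) (false, y) (x ++ [seq false | _ <- y]).

Definition badd (x y : seq bool) : seq bool :=
  trim ((columns false x y).1 ++ [:: (columns false x y).2.1]).

Definition ble (x y : seq bool) : bool := ~~ (columns true y x).2.1.

Definition bsub (x y : seq bool) : seq bool := trim (columns true x y).1.

Lemma bval_take_behead n y :
  bval (take n.+1 y) = head false y + (bval (take n (behead y))).*2.
Proof. by case: y. Qed.

(** The outgoing carry has weight [2 ^ size x]. An arbitrary incoming carry and a second operand of
    any length are allowed for the induction. *)
Lemma column_add x c y : let r := mealy (column false) (c, y) x in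
  bval r.1 + 2 ^ size x * r.2.1 = bval x + bval (take (size x) y) + c.
Proof.
elim: x c y => [|b x IH] c y /=; first by rewrite take0 expn0 mul1n /=; lia.
have := IH (majority (b (+) false) (head false y) c) (behead y).
have := bval_take_behead (size x) y; rewrite expnS /=.
set r := mealy _ _ x; move: (bval r.1) (r.2.1) (2 ^ size x).
move=> v d e; move=> ->; move: (bval (take (size x) (behead y))) (bval x) => u w.
by rewrite -mulnA; move: (e * d) => t {r IH}; case: b; case: (head false y); case: c => /=; lia.
Qed.

Lemma column_sub x c y : let r := mealy (column true) (c, y) x in
  bval x + 2 ^ size x * r.2.1 = bval r.1 + bval (take (size x) y) + c.
Proof.
elim: x c y => [|b x IH] c y /=; first by rewrite take0 expn0 mul1n /=; lia.
have := IH (majority (b (+) true) (head false y) c) (behead y).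
have := bval_take_behead (size x) y; rewrite expnS /=.
set r := mealy _ _ x; move: (bval r.1) (r.2.1) (2 ^ size x).
move=> v d e; move=> ->; move: (bval (take (size x) (behead y))) (bval x) => u w.
by rewrite -mulnA; move: (e * d) => t {r IH}; case: b; case: (head false y); case: c => /=; lia.
Qed.

Lemma bval_badd x y : bval (badd x y) = bval x + bval y.
Proof.
rewrite /badd bval_trim bval_cat /columns size_mealy /=.
have := column_add (x ++ [seq false | _ <- y]) false y => /=.
rewrite bval_cat bval_zeros muln0 addn0 take_oversize ?size_cat ?size_map ?leq_addl //.
by lia.
Qed.

Lemma columns_sub x y : bval x + 2 ^ (size x + size y) * (columns true x y).2.1
  = bval (columns true x y).1 + bval y.
Proof.
have := column_sub (x ++ [seq false | _ <- y]) false y => /=.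
rewrite bval_cat bval_zeros muln0 addn0 take_oversize ?size_cat ?size_map ?leq_addl //.
by rewrite /columns addn0.
Qed.

Lemma bleE x y : ble x y = (bval x <= bval y).
Proof.
have := columns_sub y x; rewrite /ble; set r := columns true y x.
have := bval_lt r.1; rewrite /r size_mealy size_cat size_map -/r.
by case: r.2.1 => /=; lia.
Qed.

Lemma bval_bsub x y : bval y <= bval x -> bval (bsub x y) = bval x - bval y.
Proof.
rewrite -bleE /ble /bsub bval_trim => /negbTE E1.
by have := columns_sub x y; rewrite E1; lia.
Qed.

(** The sum is trimmed, so its width is governed by its value and grows by one bit; the columns
    alone would add the two widths, and repeated rounds would let weights grow exponentially
    long. *)
Lemma size_badd x y n : size x <= n -> size y <= n -> size (badd x y) <= n.+1.
Proof.
move=> lx ly; apply: size_trim; rewrite -bval_trim -/(badd x y) bval_badd.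
have lt z : size z <= n -> bval z < 2 ^ n.
  by move=> lz; apply: leq_trans (bval_lt z) _; rewrite leq_exp2l.
by have := lt _ lx; have := lt _ ly; rewrite expnS; lia.
Qed.

Section Basic.
Context {A E S : Type} {cA : coded A} {cE : coded E} {cS : coded S}.

Lemma ptime_head d (l : A -> seq E) : ptime l -> ptime (fun a => head d (l a)).
Proof. by move=> Hl; apply: (ptime_match_seq (f := fun=> d) (g := fun _ x _ => x)); pt. Qed.

Lemma ptime_behead (l : A -> seq E) : ptime l -> ptime (fun a => behead (l a)).
Proof. by move=> Hl; apply: (ptime_match_seq (f := fun=> [::]) (g := fun _ _ s => s)); pt. Qed.

Lemma ptime_nonempty (l : A -> seq E) : ptime l -> ptime (fun a => nonempty (l a)).
Proof. by move=> Hl; apply: (ptime_match_seq (f := fun=> false) (g := fun _ _ _ => true)); pt. Qed.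

Lemma ptime_addb (x y : A -> bool) : ptime x -> ptime y -> ptime (fun a => x a (+) y a).
Proof.
move=> Hx Hy; apply: (ptime_eq (f := fun a => if x a then ~~ y a else y a)).
  by move=> a; case: (x a).
by pt; apply: ptime_negb.
Qed.

Lemma ptime_foldr_growth (l : A -> seq E) (z : A -> S) (f : A -> E -> S -> S) (b : A -> nat) :
  ptime l -> ptime z -> ptime (fun p : A * (E * S) => f p.1 p.2.1 p.2.2) ->
  poly_bounded sz b ->
  (forall a e s, sz (f a e s) <= sz s + sz e + b a) ->
  ptime (fun a => foldr (f a) (z a) (l a)).
Proof.
move=> Hl Hz Hf pB HB.
apply: (ptime_eq (f := fun a => foldl (fun s e => f a e s) (z a) (rev (l a)))).
  by move=> a; rewrite foldl_rev.
apply: (ptime_foldl_growth (f := fun a s e => f a e s) (b := b)) => //; first exact: ptime_rev.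
by apply: (ptime_comp Hf (f := fun p => (p.1, (p.2.2, p.2.1)))); pt.
Qed.

End Basic.

Ltac pt_arith := fail.
Ltac pt_ext ::= match goal with
  | |- ptime (fun _ => head _ _) => apply: ptime_head
  | |- ptime (fun _ => behead _) => apply: ptime_behead
  | |- ptime (fun _ => nonempty _) => apply: ptime_nonempty
  | |- ptime (fun _ => _ (+) _) => apply: ptime_addb
  | |- ptime (fun _ => _ && _) => apply: ptime_andb
  | |- ptime (fun _ => _ || _) => apply: ptime_orb
  | |- ptime (fun _ => ~~ _) => apply: ptime_negb
  | |- ptime (fun _ => _ ++ _) => apply: ptime_cat
  | |- ptime (fun _ => zip _ _) => apply: ptime_zip
  | |- ptime (fun _ => take_as _ _) => apply: ptime_take_as
  | _ => pt_arith
  end.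

Section Arithmetic.
Context {A : Type} {cA : coded A}.

Lemma ptime_trim (l : A -> seq bool) : ptime l -> ptime (fun a => trim (l a)).
Proof.
move=> Hl; apply: (ptime_foldr_growth (z := fun=> [::])
  (f := fun _ b s => if b || nonempty s then b :: s else [::]) (b := fun=> 1)); pt; pb.
by move=> _ b s; case: ifP => _; rewrite ?sz_cons ?sz_nil; lia.
Qed.

Lemma ptime_columns neg (x y : A -> seq bool) :
  ptime x -> ptime y -> ptime (fun a => columns neg (x a) (y a)).
Proof.
move=> Hx Hy; apply: (ptime_mealy_growth (l := fun a => x a ++ [seq false | _ <- y a])
  (z := fun a => (false, y a)) (f := fun _ => column neg) (b := fun=> 3)); pt; pb.
- by apply: (ptime_map (f := fun _ _ => false)); pt.
- by rewrite /column /majority; pt.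
- move=> _ [c s] b; rewrite /column /= !sz_pair.
  have := sz_bool (majority (b (+) neg) (head false s) c).
  by case: s => [|d s] /=; rewrite ?sz_cons; lia.
Qed.
End Arithmetic.

Ltac pt_arith ::= match goal with
  | |- ptime (fun _ => trim _) => apply: ptime_trim
  | |- ptime (fun _ => columns _ _ _) => apply: ptime_columns
  end.

Definition num := (seq bool * seq bool)%type.
Definition node := (option num * bool)%type.

Definition nadd (x y : num) : num := (badd x.1 y.1, badd x.2 y.2).
Definition nle (x y : num) : bool := ble (badd x.1 y.2) (badd y.1 x.2).
Definition num_of (b : seq bool) : num :=
  if head false b then ([::], behead b) else (behead b, [::]).

Section Numbers.
Context {A : Type} {cA : coded A}.

Lemma ptime_badd (x y : A -> seq bool) :
  ptime x -> ptime y -> ptime (fun a => badd (x a) (y a)).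
Proof. by move=> Hx Hy; rewrite /badd; pt. Qed.

Lemma ptime_ble (x y : A -> seq bool) :
  ptime x -> ptime y -> ptime (fun a => ble (x a) (y a)).
Proof. by move=> Hx Hy; rewrite /ble; pt. Qed.

Lemma ptime_bsub (x y : A -> seq bool) :
  ptime x -> ptime y -> ptime (fun a => bsub (x a) (y a)).
Proof. by move=> Hx Hy; rewrite /bsub; pt. Qed.

Lemma ptime_nadd (x y : A -> num) :
  ptime x -> ptime y -> ptime (fun a => nadd (x a) (y a)).
Proof. by move=> Hx Hy; apply: ptime_pair; apply: ptime_badd; pt. Qed.

Lemma ptime_nle (x y : A -> num) :
  ptime x -> ptime y -> ptime (fun a => nle (x a) (y a)).
Proof. by move=> Hx Hy; apply: ptime_ble; apply: ptime_badd; pt. Qed.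

Lemma ptime_num_of (b : A -> seq bool) : ptime b -> ptime (fun a => num_of (b a)).
Proof. by move=> Hb; rewrite /num_of; pt. Qed.
End Numbers.

Ltac pt_num := fail.
Ltac pt_arith ::= match goal with
  | |- ptime (fun _ => badd _ _) => apply: ptime_badd
  | |- ptime (fun _ => ble _ _) => apply: ptime_ble
  | |- ptime (fun _ => bsub _ _) => apply: ptime_bsub
  | |- ptime (fun _ => nadd _ _) => apply: ptime_nadd
  | |- ptime (fun _ => nle _ _) => apply: ptime_nle
  | |- ptime (fun _ => num_of _) => apply: ptime_num_of
  | _ => pt_num
  end.

(** * Parsing *)

Definition split_blocks : seq letter -> seq (seq bool) :=
  foldr (fun x s => if x is Some b then
                      if s is c :: s' then (b :: c) :: s' else [:: [:: b]]
                    else [::] :: s) [::].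

(** A binary number becomes a list by Horner's rule. Cutting to the length of [u] after every
    doubling keeps this polynomial for arbitrary [x]. *)
Definition unary {T} (u : seq T) (x : seq bool) : seq unit :=
  foldr (fun (b : bool) s => take_as u (if b then tt :: s ++ s else s ++ s)) [::] x.

Definition stream := seq (seq bool).

(** A probability occupies two blocks. Only its positivity matters, and this is whether the block of
    the numerator is nonempty. *)
Definition parse_edge (s : stream) : bool * stream :=
  (nonempty (head [::] s), behead (behead s)).

Definition parse_row (U : seq unit) (s : stream) : (num * seq bool) * stream :=
  let r := mealy (fun s' _ => parse_edge s') (behead s) U in
  ((num_of (head [::] s), r.1), r.2).

Definition parse_state (U V : seq unit) (s : stream) : seq (num * seq bool) * stream :=
  mealy (fun s' _ => parse_row U s') s V.

Definition parse_mdp (U V : seq unit) (s : stream) : seq (seq (num * seq bool)) * stream :=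
  mealy (fun s' _ => parse_state U V s') s U.

(** The state of the traversal is the remaining distance to the initial state, in unary, and [None]
    beyond it; [([::], [::])] is the weight 0 of the empty walk. *)
Definition init_vec (U s0 : seq unit) : seq node :=
  (mealy (fun (o : option (seq unit)) _ =>
     if o is Some l then
       if l is _ :: l' then ((None, false), Some l')
       else ((Some ([::], [::]), false), None)
     else ((None, false), None)) (Some s0) U).1.

Section Parsing.
Context {A T : Type} {cA : coded A} {cT : coded T}.

Lemma ptime_split_blocks (u : A -> seq letter) :
  ptime (u : A -> seq (option bool)) -> ptime (fun a => split_blocks (u a)).
Proof.
move=> Hu; apply: (ptime_foldr_growth (E := option bool) (l := u) (z := fun=> [::]) (f := fun _ (x : option bool) s =>
  if x is Some b then if s is c :: s' then (b :: c) :: s' else [:: [:: b]] else [::] :: s)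
  (b := fun=> 8)); pt; pb.
- apply: (ptime_match_option (o := fun p : A * (option bool * seq (seq bool)) => p.2.1)
    (f := fun p => [::] :: p.2.2)
    (g := fun p b => if p.2.2 is c :: s' then (b :: c) :: s' else [:: [:: b]])); pt.
  apply: (ptime_match_seq (l := fun q : (A * (option bool * seq (seq bool))) * bool => q.1.2.2)
    (f := fun q => [:: [:: q.2]]) (g := fun q c s' => (q.2 :: c) :: s')); pt.
- move=> _ [b|] s; last by rewrite sz_cons sz_nil; lia.
  pose proof (sz_bool b).
  by case: s => [|c s']; rewrite !sz_cons ?sz_nil; lia.
Qed.

Lemma sz_units (s : seq unit) : sz s = (size s).*2.+1.
Proof. by elim: s => // x s IH; rewrite sz_cons sz_unit IH /=; lia. Qed.

Lemma ptime_unary (u : A -> seq T) (x : A -> seq bool) :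
  ptime u -> ptime x -> ptime (fun a => unary (u a) (x a)).
Proof.
move=> Hu Hx; apply: (ptime_foldr (z := fun=> [::]) (f := fun a (b : bool) (s : seq unit) =>
  take_as (u a) (if b then tt :: s ++ s else s ++ s)) (bound := fun a => sz (u a) + sz (u a))) => //.
- by pt.
- have Hu' : ptime (fun p : A * (bool * seq unit) => u p.1) by apply: (ptime_comp Hu); pt.
  by pt.
- by pb.
move=> a l1 [|b l2] _ /=; first by rewrite sz_nil; pose proof (sz_gt0 (u a)); lia.
rewrite sz_units take_asE size_take; pose proof (size_sz (u a)).
by case: ifP; lia.
Qed.

Lemma sz_behead {E} {cE : coded E} (s : seq E) : sz (behead s) <= sz s.
Proof. by case: s => // x s; rewrite sz_cons /=; lia. Qed.

Lemma ptime_parse_row (U : A -> seq unit) (s : A -> stream) :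
  ptime U -> ptime s -> ptime (fun a => parse_row (U a) (s a)).
Proof.
move=> HU Hs; rewrite /parse_row.
have H : ptime (fun a => mealy (fun s' (_ : unit) => parse_edge s') (behead (s a)) (U a)).
  apply: (ptime_mealy_growth (l := U) (f := fun _ s' _ => parse_edge s') (b := fun=> 0)); pt; pb.
    by rewrite /parse_edge; pt.
  move=> _ t e; rewrite /parse_edge /=.
  apply: leq_trans (leq_trans (sz_behead _) (sz_behead _)) _; rewrite addn0 leq_addr //.
by pt.
Qed.

End Parsing.

Section Parsing.
Context {A T : Type} {cA : coded A} {cT : coded T}.

Lemma sz_parse_row U s : sz (parse_row U s).2 <= sz s + sz U.
Proof.
rewrite /parse_row /=.
apply: leq_trans (sz_mealy_growth (b := 0) _ _ _) _; last first.
  by rewrite muln0 addn0 leq_add2r sz_behead.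
move=> t e; rewrite /parse_edge /=.
by apply: leq_trans (leq_trans (sz_behead _) (sz_behead _)) _; rewrite addn0 leq_addr.
Qed.

Lemma ptime_parse_state (U V : A -> seq unit) (s : A -> stream) :
  ptime U -> ptime V -> ptime s -> ptime (fun a => parse_state (U a) (V a) (s a)).
Proof.
move=> HU HV Hs; apply: (ptime_mealy_growth (l := V) (z := s)
  (f := fun a s' _ => parse_row (U a) s') (b := fun a => sz (U a))) => //.
- by cbv beta; apply: ptime_parse_row; [apply: (ptime_comp HU)|]; pt.
- by pb.
- by move=> a t e; apply: leq_trans (sz_parse_row _ _) _; lia.
Qed.

End Parsing.

Section Parsing.
Context {A T : Type} {cA : coded A} {cT : coded T}.

Lemma sz_parse_state U V s : sz (parse_state U V s).2 <= sz s + sz V + sz V * sz U.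
Proof.
apply: leq_trans (sz_mealy_growth (b := sz U) _ _ _) _; last first.
  by rewrite leq_add2l leq_mul2r ltnW ?orbT // size_sz.
by move=> t e; apply: leq_trans (sz_parse_row _ _) _; lia.
Qed.

Lemma ptime_parse_mdp (U V : A -> seq unit) (s : A -> stream) :
  ptime U -> ptime V -> ptime s -> ptime (fun a => parse_mdp (U a) (V a) (s a)).
Proof.
move=> HU HV Hs; apply: (ptime_mealy_growth (l := U) (z := s)
  (f := fun a s' _ => parse_state (U a) (V a) s') (b := fun a => sz (V a) + sz (V a) * sz (U a))) => //.
- by cbv beta; apply: ptime_parse_state; [apply: (ptime_comp HU)|apply: (ptime_comp HV)|]; pt.
- by pb.
- by move=> a t e; apply: leq_trans (sz_parse_state _ _ _) _; lia.
Qed.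

Lemma ptime_init_vec (U s0 : A -> seq unit) :
  ptime U -> ptime s0 -> ptime (fun a => init_vec (U a) (s0 a)).
Proof.
move=> HU Hs; apply: ptime_fst.
apply: (ptime_mealy_growth (l := U) (z := fun a => Some (s0 a))
  (f := fun _ (o : option (seq unit)) (_ : unit) =>
     if o is Some l then
       if l is _ :: l' then ((None, false) : node, Some l')
       else ((Some ([::], [::]), false), None)
     else ((None, false), None)) (b := fun=> 2)); pt; pb.
- apply: (ptime_match_option (o := fun p : A * (option (seq unit) * unit) => p.2.1)
    (f := fun _ => ((None, false), None))
    (g := fun p l => if l is _ :: l' then ((None, false) : node, Some l')
       else ((Some ([::], [::]), false), None))); pt.
  apply: (ptime_match_seq (l := fun q : (A * (option (seq unit) * unit)) * seq unit => q.2)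
    (f := fun _ => ((Some ([::], [::]), false), None))
    (g := fun q _ l' => ((None, false) : node, Some l'))); pt.
- move=> _ [[|x l]|] e /=; rewrite ?sz_none; try lia.
  by rewrite !sz_some sz_cons; lia.
Qed.
End Parsing.

(** * Longest walks *)

(* A node carries the best weight found so far and a flag which is set when
   arbitrarily large weights are possible. The flag is raised by an improvement
   in a round with [mode] set, and is inherited along edges. *)
Definition improve (mode inf : bool) (c : num) (x : node) : node :=
  if x.1 is Some d then
    if nle c d then (Some d, x.2 || inf) else (Some c, x.2 || inf || mode)
  else (Some c, x.2 || inf).

Definition relax_row (mode : bool) (src : node) (row : num * seq bool)
    (acc : seq node) : seq node :=
  if src.1 is Some d then
    [seq if p.1 then improve mode src.2 (nadd d row.1) p.2 else p.2 | p <- zip row.2 acc]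
  else acc.

Definition relax_state (mode : bool) (acc : seq node)
    (p : node * seq (num * seq bool)) : seq node :=
  foldl (fun acc row => relax_row mode p.1 row acc) acc p.2.

(** Sources are read from [v] as it was at the start and only the targets accumulate. A round
    therefore extends walks by a single step. *)
Definition round (mode : bool) (G : seq (seq (num * seq bool))) (v : seq node) :=
  foldl (relax_state mode) v (zip v G).

Definition rounds (mode : bool) (G : seq (seq (num * seq bool))) (U : seq unit)
    (v : seq node) :=
  foldl (fun v _ => round mode G v) v U.

(** * Bit widths during the rounds *)

Definition num_le (W : nat) (x : num) := (size x.1 <= W) && (size x.2 <= W).
Definition node_le (W : nat) (x : node) := if x.1 is Some d then num_le W d else true.
Definition rows_le (W : nat) (r : seq (num * seq bool)) := all (fun x => num_le W x.1) r.

Lemma num_leW W W' x : W <= W' -> num_le W x -> num_le W' x.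
Proof. by rewrite /num_le => le /andP[l1 l2]; rewrite !(leq_trans _ le). Qed.

Lemma node_leW W W' x : W <= W' -> node_le W x -> node_le W' x.
Proof. by rewrite /node_le => le; case: x.1 => // d; apply: num_leW. Qed.

Lemma num_le_nadd W x y : num_le W x -> num_le W y -> num_le W.+1 (nadd x y).
Proof. by move=> /andP[? ?] /andP[? ?]; rewrite /num_le !size_badd. Qed.

(** A new entry is the sum of two numbers of width [W], and older entries may already have [W.+1]
    bits. The same bound thus survives any number of rows within one round. *)
Lemma relax_row_le W mode src row acc : node_le W src -> num_le W row.1 ->
  all (node_le W.+1) acc ->
  all (node_le W.+1) (relax_row mode src row acc) /\ size (relax_row mode src row acc) <= size acc.
Proof.
rewrite {1}/node_le /relax_row; case: src.1 => [d|] // ld lr la; split; last first.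
  by rewrite size_map size_zip geq_minr.
elim: row.2 acc la => [|b bs IH] [|x acc] //= /andP[lx la]; rewrite IH // andbT.
case: b => //; rewrite /improve; case: x lx => [[e|] i] //=; last first.
  by move=> _; apply: num_le_nadd.
by rewrite /node_le /=; case: ifP => // _ _; apply: num_le_nadd.
Qed.

Lemma relax_state_le W mode acc p : node_le W p.1 -> rows_le W p.2 ->
  all (node_le W.+1) acc ->
  all (node_le W.+1) (relax_state mode acc p) /\ size (relax_state mode acc p) <= size acc.
Proof.
move=> l1; rewrite /relax_state; elim: p.2 acc => [|row r IH] acc //= /andP[l2 l3] l4.
have [l5 l6] := relax_row_le mode l1 l2 l4; have [l7 l8] := IH _ l3 l5.
by split=> //; apply: leq_trans l8 l6.
Qed.

Lemma relax_states_le W mode l acc :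
  all (fun p => node_le W p.1 && rows_le W p.2) l -> all (node_le W.+1) acc ->
  all (node_le W.+1) (foldl (relax_state mode) acc l) /\
  size (foldl (relax_state mode) acc l) <= size acc.
Proof.
elim: l acc => [|p l IH] acc //= /andP[/andP[l1 l2] l3] l4.
have [l5 l6] := relax_state_le mode l1 l2 l4; have [l7 l8] := IH _ l3 l5.
by split=> //; apply: leq_trans l8 l6.
Qed.

Lemma all_zip_le W v G : all (node_le W) v -> all (rows_le W) G ->
  all (fun p => node_le W p.1 && rows_le W p.2) (zip v G).
Proof.
by elim: v G => [|x v IH] [|r G] //= /andP[l1 l2] /andP[l3 l4]; rewrite l1 l3 IH.
Qed.

Lemma all_leW W v : all (node_le W) v -> all (node_le W.+1) v.
Proof. by apply: sub_all => x; apply: node_leW. Qed.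

Lemma rounds_le W mode G U v : all (node_le W) v -> all (rows_le W) G ->
  all (node_le (W + size U)) (rounds mode G U v) /\ size (rounds mode G U v) <= size v.
Proof.
rewrite /rounds; elim: U W v => [|x U IH] W v l1 l2; first by rewrite addn0.
have [l3 l4] := relax_states_le mode (all_zip_le l1 l2) (all_leW l1).
have [|l5 l6] := IH W.+1 (round mode G v) l3.
  by apply: sub_all l2 => r; apply: sub_all => y; apply: num_leW.
by rewrite /= addnS -addSn; split=> //; apply: leq_trans l6 l4.
Qed.

Lemma sz_bits (x : seq bool) : size x <= sz x <= (4 * size x).+1.
Proof.
elim: x => [|b x IH]; first by rewrite sz_nil.
by rewrite sz_cons /=; pose proof (sz_bool b); pose proof (sz_gt0 b); lia.
Qed.

(** Each component takes at most [4 * W + 1] letters, the flag at most 3, and [Some] together with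
    the two pairs adds 4. *)
Lemma sz_node W (x : node) : node_le W x -> sz x <= 8 * W + 9.
Proof.
case: x => -[[p q]|] i; rewrite /node_le /num_le /=; pose proof (sz_bool i).
  move=> /andP[l1 l2]; rewrite sz_pair sz_some sz_pair.
  by have := sz_bits p; have := sz_bits q; lia.
by rewrite sz_pair sz_none; lia.
Qed.

Lemma sz_nodes W n (v : seq node) : all (node_le W) v -> size v <= n ->
  sz v <= n * (8 * W + 10) + 1.
Proof.
elim: v n => [|x v IH] n; first by rewrite sz_nil addn1.
case: n => [|n] //=.
by move=> /andP[/sz_node l1 /IH{}IH] /IH l2; rewrite sz_cons; lia.
Qed.

Lemma node_le_sz (v : seq node) : all (node_le (sz v)) v.
Proof.
elim: v => //= x v IH; apply/andP; split; last first.
  by apply: sub_all IH => y; apply: node_leW; rewrite sz_cons; lia.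
rewrite sz_cons; case: x => -[[p q]|] i; rewrite /node_le /num_le //=.
rewrite sz_pair sz_some sz_pair.
by have := sz_bits p; have := sz_bits q; lia.
Qed.

Lemma rows_le_sz (r : seq (num * seq bool)) : rows_le (sz r) r.
Proof.
rewrite /rows_le; elim: r => //= x r IH; apply/andP; split; last first.
  by apply: sub_all IH => y; apply: num_leW; rewrite sz_cons; lia.
rewrite sz_cons; case: x => -[p q] bs; rewrite /num_le /= !sz_pair.
by have := sz_bits p; have := sz_bits q; lia.
Qed.

Lemma all_rows_le_sz (G : seq (seq (num * seq bool))) : all (rows_le (sz G)) G.
Proof.
elim: G => //= r G IH; rewrite sz_cons; apply/andP; split.
  by apply: sub_all (rows_le_sz r) => y; apply: num_leW; lia.
by apply: sub_all IH => r'; apply: sub_all => y; apply: num_leW; lia.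
Qed.

Section Walks.
Context {A : Type} {cA : coded A}.

Lemma ptime_improve (m i : A -> bool) (c : A -> num) (x : A -> node) :
  ptime m -> ptime i -> ptime c -> ptime x ->
  ptime (fun a => improve (m a) (i a) (c a) (x a)).
Proof.
move=> Hm Hi Hc Hx.
apply: (ptime_match_option (o := fun a => (x a).1) (f := fun a => (Some (c a), (x a).2 || i a))
  (g := fun a d => if nle (c a) d then (Some d, (x a).2 || i a)
                   else (Some (c a), (x a).2 || i a || m a))).
- by pt.
- by pt.
have R B (cB : coded B) (f : A -> B) : ptime f -> ptime (fun p : A * num => f p.1).
  by move=> Hf; apply: (ptime_comp Hf); pt.
have Hm' := R _ _ _ Hm; have Hi' := R _ _ _ Hi; have Hc' := R _ _ _ Hc.
have Hx' := R _ _ _ Hx.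
by pt.
Qed.

End Walks.

Lemma ptime_relax_row :
  ptime (fun p : (bool * node) * ((num * seq bool) * seq node) =>
           relax_row p.1.1 p.1.2 p.2.1 p.2.2).
Proof.
apply: (ptime_match_option (f := fun p : (bool * node) * ((num * seq bool) * seq node) => p.2.2)
 (o := fun p => p.1.2.1)
 (g := fun p d => [seq if q.1 then improve p.1.1 p.1.2.2 (nadd d p.2.1.1) q.2 else q.2
                  | q <- zip p.2.1.2 p.2.2])); pt.
apply: (ptime_map (f := fun (p : ((bool * node) * ((num * seq bool) * seq node)) * num) q => 
   if q.1 then improve p.1.1.1 p.1.1.2.2 (nadd p.2 p.1.2.1.1) q.2 else q.2)); pt.
by apply: ptime_improve; pt.
Qed.

(** The accumulator is bounded through the widths and the number of its nodes; the size of the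
    argument bounds both. *)
Lemma ptime_relax_state :
  ptime (fun p : bool * (seq node * (node * seq (num * seq bool))) =>
           relax_state p.1 p.2.1 p.2.2).
Proof.
pose T := (bool * (seq node * (node * seq (num * seq bool))))%type.
apply: (ptime_foldl (A := T) (l := fun p => p.2.2.2) (z := fun p => p.2.1)
  (f := fun p acc row => relax_row p.1 p.2.2.1 row acc)
  (bound := fun p : T => sz p * (8 * (sz p + 1) + 10) + 1)); pt; pb.
- by apply: (ptime_comp ptime_relax_row
   (f := fun p : T * (seq node * (num * seq bool)) => ((p.1.1, p.1.2.2.1), (p.2.2, p.2.1)))); pt.
move=> [m [acc [x r]]] l1 l2 /= ->; rewrite [sz _ + 1]addn1.
have szE : sz (m, (acc, (x, l1 ++ l2))) = (sz m + (sz acc + (sz x + sz (l1 ++ l2)).+1).+1).+1.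
  by rewrite !sz_pair.
set N := sz _ in szE *; pose proof (sz_catl l1 l2).
have le1 : node_le N x.
  by apply: (@node_leW (sz [:: x])); [rewrite sz_cons sz_nil; lia|have /andP[] := node_le_sz [:: x]].
have le2 : rows_le N l1 by apply: sub_all (rows_le_sz l1) => y; apply: num_leW; lia.
have le3 : all (node_le N.+1) acc.
  by apply: sub_all (node_le_sz acc) => y; apply: node_leW; lia.
have [l5 l6] := @relax_state_le N m acc (x, l1) le1 le2 le3.
apply: (sz_nodes l5); apply: leq_trans l6 _.
by pose proof (size_sz acc); lia.
Qed.

Lemma ptime_round : ptime (fun p : (bool * seq (seq (num * seq bool))) * seq node =>
  round p.1.1 p.1.2 p.2).
Proof.
pose T := ((bool * seq (seq (num * seq bool))) * seq node)%type.
apply: (ptime_foldl (A := T) (l := fun p => zip p.2 p.1.2) (z := fun p => p.2)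
  (f := fun p => relax_state p.1.1)
  (bound := fun p : T => sz p * (8 * (sz p + 1) + 10) + 1)); pt; pb.
- by apply: (ptime_comp ptime_relax_state (f := fun p : T * _ => (p.1.1.1, p.2))); pt.
move=> [[m G] v] l1 l2 /=; rewrite [sz _ + 1]addn1.
have szE : sz ((m, G), v) = ((sz m + sz G).+1 + sz v).+1 by rewrite !sz_pair.
set N := sz _ in szE * => E1.
have le1 : all (node_le N) v by apply: sub_all (node_le_sz v) => y; apply: node_leW; lia.
have le2 : all (rows_le N) G.
  by apply: sub_all (all_rows_le_sz G) => r; apply: sub_all => y; apply: num_leW; lia.
have := all_zip_le le1 le2; rewrite E1 all_cat => /andP[le3 _].
have [l5 l6] := relax_states_le m le3 (all_leW le1).
apply: (sz_nodes l5); apply: leq_trans l6 _.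
by pose proof (size_sz v); lia.
Qed.

Lemma ptime_rounds {A} {cA : coded A} mode (G : A -> seq (seq (num * seq bool)))
    (U : A -> seq unit) (v : A -> seq node) :
  ptime G -> ptime U -> ptime v -> ptime (fun a => rounds mode (G a) (U a) (v a)).
Proof.
move=> HG HU Hv.
apply: (ptime_foldl (l := U) (z := v) (f := fun a v _ => round mode (G a) v)
  (bound := fun a => sz (v a) * (8 * (sz (v a) + sz (G a) + sz (U a)) + 10) + 1)) => //.
- have HG' : ptime (fun p : A * (seq node * unit) => G p.1) by apply: (ptime_comp HG); pt.
  by apply: (ptime_comp ptime_round (f := fun p : A * (seq node * unit) => ((mode, G p.1), p.2.1))); pt.
- by pb.
move=> a l1 l2 E1; set W := sz (v a) + sz (G a).
have le1 : all (node_le W) (v a).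
  by apply: sub_all (node_le_sz (v a)) => y; apply: node_leW; rewrite leq_addr.
have le2 : all (rows_le W) (G a).
  by apply: sub_all (all_rows_le_sz (G a)) => r; apply: sub_all => y; apply: num_leW; rewrite leq_addl.
have [l5 l6] := rounds_le mode l1 le1 le2.
have {}l5 : all (node_le (sz (v a) + sz (G a) + sz (U a))) (rounds mode (G a) l1 (v a)).
  apply: sub_all l5 => y; apply: node_leW; rewrite leq_add2l E1.
  by pose proof (sz_catl l1 l2); pose proof (size_sz l1); lia.
apply: (sz_nodes l5); apply: leq_trans l6 _.
by apply: ltnW; apply: size_sz.
Qed.

(** * The decision and the value algorithm *)

Definition states_of (u : seq letter) : seq unit := unary u (head [::] (split_blocks u)).
Definition actions_of (u : seq letter) : seq unit :=
  unary u (head [::] (behead (split_blocks u))).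
Definition parsed (u : seq letter) :=
  parse_mdp (states_of u) (actions_of u) (behead (behead (split_blocks u))).
Definition start_of (u : seq letter) : seq unit := unary u (head [::] (parsed u).2).
(** The additional [tt] is the round that detects improvements; the remaining [nS] rounds spread the
    flags. The block of the initial state is dropped, so that states are paired with their target
    blocks. *)
Definition solution (u : seq letter) : seq (node * seq bool) :=
  zip (rounds true (parsed u).1 (tt :: states_of u)
        (rounds false (parsed u).1 (states_of u) (init_vec (states_of u) (start_of u))))
      (behead (parsed u).2).

Definition accepting (p : node * seq bool) : bool :=
  if p.1.1 is Some d then
    if p.2 is b :: k then ~~ b || (p.1.2 || nle (num_of k) d) else false
  else false.

Definition decide (u : seq letter) : seq letter := [:: Some (has accepting (solution u))].

Definition star (p : node * seq bool) : bool :=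
  if p.1.1 is Some d then if p.2 is b :: k then ~~ b else false else false.

(** The difference is brought to sign and absolute value. Equal components fall on the nonnegative
    side, where the encoding places 0. *)
Definition show (x : node) : seq letter :=
  if x.1 is Some d then
    if x.2 then [:: None; Some true]
    else [seq Some b | b <- if ble d.2 d.1 then false :: bsub d.1 d.2
                            else true :: bsub d.2 d.1] ++ [:: None]
  else [:: None; Some false].

(** A block starts with [true] exactly for a target with a finite threshold; for goal instances this
    singles out one state. *)
Definition goal_node (l : seq (node * seq bool)) : node :=
  head (None, false) (foldr (fun p s => if head false p.2 then p.1 :: s else s) [::] l).

(** A reachable state of [Tstar] satisfies the property whatever the threshold of the goal, hence
    the answer [+oo]. *)
Definition value (u : seq letter) : seq letter :=
  if has star (solution u) then [:: None; Some true] else show (goal_node (solution u)).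

#[export] Instance coded_letter : coded letter := coded_option coded_bool.

Section Final.
Context {A E : Type} {cA : coded A} {cE : coded E}.

Lemma ptime_has (p : pred E) (l : A -> seq E) :
  ptime p -> ptime l -> ptime (fun a => has p (l a)).
Proof.
move=> Hp Hl; apply: (ptime_eq (f := fun a => foldr (fun e b => p e || b) false (l a))).
  by move=> a; elim: (l a) => //= e s ->.
apply: (ptime_foldr (z := fun=> false) (f := fun _ e b => p e || b) (bound := fun=> 3)) => //.
- by pt.
- have Hp' : ptime (fun q : A * (E * bool) => p q.2.1) by apply: (ptime_comp Hp); pt.
  by pt.
- by pb.
- by move=> a l1 l2 _; apply: sz_bool.
Qed.
End Final.

Lemma ptime_states_of : ptime states_of.
Proof.
have H : ptime (fun u : seq letter => split_blocks u) by apply: ptime_split_blocks; pt.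
by apply: ptime_unary; pt.
Qed.

Lemma ptime_actions_of : ptime actions_of.
Proof.
have H : ptime (fun u : seq letter => split_blocks u) by apply: ptime_split_blocks; pt.
by apply: ptime_unary; pt.
Qed.

Lemma ptime_parsed : ptime parsed.
Proof.
have H : ptime (fun u : seq letter => split_blocks u) by apply: ptime_split_blocks; pt.
apply: ptime_parse_mdp; [exact: ptime_states_of|exact: ptime_actions_of|by pt].
Qed.

Lemma ptime_solution : ptime solution.
Proof.
have Hp : ptime (fun u => parsed u) := ptime_parsed.
have Hs : ptime (fun u => states_of u) := ptime_states_of.
have H0 : ptime (fun u => start_of u) by apply: ptime_unary; pt.
rewrite /solution; apply: ptime_zip; last by pt.
apply: ptime_rounds; [by pt|by pt|].
apply: ptime_rounds; [by pt|by pt|].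
by apply: ptime_init_vec.
Qed.

Lemma ptime_accepting : ptime accepting.
Proof.
apply: (ptime_match_option (o := fun p : node * seq bool => p.1.1) (f := fun=> false)
  (g := fun p d => if p.2 is b :: k then ~~ b || (p.1.2 || nle (num_of k) d) else false)); pt.
apply: (ptime_match_seq (l := fun q : (node * seq bool) * num => q.1.2) (f := fun=> false)
  (g := fun q b k => ~~ b || (q.1.1.2 || nle (num_of k) q.2))); pt.
Qed.

Lemma ptime_star : ptime star.
Proof.
apply: (ptime_match_option (o := fun p : node * seq bool => p.1.1) (f := fun=> false)
  (g := fun p _ => if p.2 is b :: k then ~~ b else false)); pt.
apply: (ptime_match_seq (l := fun q : (node * seq bool) * num => q.1.2) (f := fun=> false)
  (g := fun q b _ => ~~ b)); pt.
Qed.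

Lemma ptime_decide : ptime decide.
Proof.
have H : ptime (fun u => has accepting (solution u)).
  by apply: ptime_has; [exact: ptime_accepting|exact: ptime_solution].
by apply: (ptime_cons (f := fun u => Some (has accepting (solution u))) (g := fun=> [::])); pt.
Qed.

Lemma ptime_show : ptime show.
Proof.
apply: (ptime_match_option (o := fun x : node => x.1) (f := fun=> [:: None; Some false])
  (g := fun x d => if x.2 then [:: None; Some true]
    else [seq Some b | b <- if ble d.2 d.1 then false :: bsub d.1 d.2
                            else true :: bsub d.2 d.1] ++ [:: None])); pt.
by apply: (ptime_map (f := fun _ b => Some b)); pt.
Qed.

Lemma ptime_goal_node : ptime goal_node.
Proof.
apply: ptime_head; apply: (ptime_foldr_growth (l := id) (z := fun=> [::])
  (f := fun _ (p : node * seq bool) s => if head false p.2 then p.1 :: s else s) (b := fun=> 1)); pt; pb.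
by move=> _ [x k] s; rewrite sz_pair /=; case: ifP; rewrite ?sz_cons; lia.
Qed.

Lemma ptime_value : ptime value.
Proof.
have H : ptime (fun u => has star (solution u)).
  by apply: ptime_has; [exact: ptime_star|exact: ptime_solution].
have H2 : ptime (fun u => show (goal_node (solution u))).
  apply: ptime_comp; first exact: ptime_show.
  by apply: ptime_comp; [exact: ptime_goal_node|exact: ptime_solution].
by rewrite /value; pt.
Qed.

(** * Conversion between words on the tape and codes of trees *)

Definition is_sep_top : pred (option letter) :=
  fun x => if x is Some None then true else false.

Definition letter_code (x : letter) : seq letter := tt1 :: tcode (tree x).

(** The code of a list is built from its end: the word is reversed into register 2, the empty list
    is written, and every letter is then put in front together with its cons node. *)
Definition read_cmd := Seq (pour 0 2) (Seq (Push 0 ff1)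
  (While 2 nonempty_top (Seq
    (If 2 is_sep_top (push_word (letter_code None))
      (If 2 is_true_top (push_word (letter_code tt1)) (push_word (letter_code ff1))))
    (Pop 2)))).

Lemma runs_within_read u :
  runs_within read_cmd (std u [::]) (24 * size u + 4) (std (tcode (tree u)) [::]).
Proof.
have L w s : runs_within (While 2 nonempty_top (Seq
    (If 2 is_sep_top (push_word (letter_code None))
      (If 2 is_true_top (push_word (letter_code tt1)) (push_word (letter_code ff1))))
    (Pop 2))) [:: tcode (tree s); [::]; w; [::]; [::]] (18 * size w + 1)
    (std (tcode (tree (rev w ++ s))) [::]).
  elim: w s => [|x w IH] s; first exact: runs_within_stop.
  apply: (runs_within_le (N := (16 + 1 + (18 * size w + 1)).+1)); last by rewrite /=; lia.
  rewrite rev_cons cat_rcons.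
  apply: runs_within_loop (IH (x :: s)) => //.
  apply: (@runs_within_seq _ _ _ _ [:: tcode (tree (x :: s)); [::]; x :: w; [::]; [::]]);
    last by wstep.
  have -> : tcode (tree (x :: s)) = letter_code x ++ tcode (tree s) by [].
  case: x => [[|]|].
  - apply: (@runs_within_le _ _ (2 * 6 + 1).+2) => //.
    by apply: runs_within_else => //; apply: runs_within_then => //; apply: (runs_within_push_word (letter_code tt1)).
  - apply: (@runs_within_le _ _ (2 * 4 + 1).+2) => //.
    by apply: runs_within_else => //; apply: runs_within_else => //; apply: (runs_within_push_word (letter_code ff1)).
  - apply: (@runs_within_le _ _ (2 * 2 + 1).+1) => //.
    by apply: runs_within_then => //; apply: (runs_within_push_word (letter_code None)).
apply: (runs_within_le (N := 6 * size u + 1 + (2 + (18 * size (rev u) + 1)))); last first.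
  by rewrite size_rev; lia.
apply: runs_within_seq; first exact: (@runs_within_pour 0 2).
rewrite /= cats0; apply: runs_within_seq; first exact: runs_within_push.
by have := L (rev u) [::]; rewrite revK cats0.
Qed.

(** After its cons node a letter reads [ff1] for the separator, [tt1 ff1 ff1] for the bit 0 and
    [tt1 tt1 ff1 ff1 ff1] for the bit 1. At most two letters tell them apart, and the pops remove
    the rest. *)
Definition write_cmd := Seq
  (While 0 is_true_top (Seq (Pop 0)
    (If 0 is_false_top (Seq (Pop 0) (Push 2 None)) (Seq (Pop 0)
      (If 0 is_false_top (Seq (Push 2 ff1) (Seq (Pop 0) (Pop 0)))
        (Seq (Push 2 tt1) (Seq (Pop 0) (Seq (Pop 0) (Seq (Pop 0) (Pop 0))))))))))
  (Seq (Pop 0) (pour 2 0)).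

Lemma runs_within_write u :
  runs_within write_cmd (std (tcode (tree u)) [::]) (18 * size u + 3) (std u [::]).
Proof.
rewrite /write_cmd; set body := (Seq (Pop 0) (If _ _ _ _)).
have L w s : runs_within (While 0 is_true_top body)
    [:: tcode (tree w); [::]; s; [::]; [::]] (12 * size w + 1)
    [:: [:: ff1]; [::]; rev w ++ s; [::]; [::]].
  elim: w s => [|x w IH] s; first exact: runs_within_stop.
  apply: (runs_within_le (N := (11 + (12 * size w + 1)).+1)); last by rewrite /=; lia.
  rewrite rev_cons cat_rcons; apply: runs_within_loop (IH (x :: s)) => //.
  case: x => [[|]|].
  - apply: (@runs_within_le _ _ (1 + (1 + (2 + (1 + (1 + (1 + 1)))).+1).+1)) => //.
    apply: runs_within_seq; first by wstep.
    apply: runs_within_else => //; apply: runs_within_seq; first by wstep.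
    apply: runs_within_else => //.
    by do 4 (apply: runs_within_seq; [by wstep|]); wstep.
  - apply: (@runs_within_le _ _ (1 + (1 + (2 + (1 + 1)).+1).+1)) => //.
    apply: runs_within_seq; first by wstep.
    apply: runs_within_else => //; apply: runs_within_seq; first by wstep.
    apply: runs_within_then => //.
    by do 2 (apply: runs_within_seq; [by wstep|]); wstep.
  - apply: (@runs_within_le _ _ (1 + (1 + 2).+1)) => //.
    apply: runs_within_seq; first by wstep.
    apply: runs_within_then => //.
    by apply: runs_within_seq; wstep.
apply: (runs_within_le (N := 12 * size u + 1 + (1 + (6 * size (rev u) + 1)))); last first.
  by rewrite size_rev; lia.
apply: runs_within_seq; first exact: L.
apply: runs_within_seq; first by wstep.
have := @runs_within_pour 2 0 (rev u) [:: [::]; [::]; rev u; [::]; [::]] isT isT isT erefl.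
by rewrite /= revK !cats0.
Qed.

Lemma sz_word (u : seq (option bool)) :
  size u <= @sz _ (@coded_seq (option bool) coded_letter) u <= 6 * size u + 1.
Proof.
elim: u => // x u IH; rewrite sz_cons /=.
have : 0 < @sz (option bool) coded_letter x <= 5 by case: x => [[]|].
by lia.
Qed.

Theorem polytime_of_ptime (X Y : Type) (encX : X -> seq letter) (encY : Y -> seq letter)
    (f : X -> Y) (F : seq letter -> seq letter) :
  ptime F -> (forall x, F (encX x) = encY (f x)) -> polytime encX encY f.
Proof.
move=> [c [T [Rc Hc pT pF]]] HF.
have [d Hd] : poly_bounded size (fun u : seq letter =>
    24 * size u + 4 + (T u + (18 * size (F u) + 3))).
  have ps : poly_bounded size (fun u : seq letter => sz u).
    apply: (@pb_le _ _ _ (fun u : seq letter => 6 * size u + 1)); last by pb.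
    by move=> u; case/andP: (sz_word u).
  have pT' : poly_bounded size T := pb_comp (u := id) pT ps.
  have pF' : poly_bounded size (fun u => sz (F u)) := pb_comp (u := id) pF ps.
  have pF2 : poly_bounded size (fun u => size (F u)).
    by apply: pb_le pF' => u; case/andP: (sz_word (F u)).
  by pb.
(* For an input of length [n], [(n + 2) ^ d] is at most [3 ^ d * n ^ d] if [n] is positive and at
   most [3 ^ d] if it is 0. The 4 stands for five tapes, one per register. *)
exists (cmd_machine 4 (Seq read_cmd (Seq c write_cmd))), (3 ^ d), d => x.
set u := encX x.
have [n R le] : runs_within (Seq read_cmd (Seq c write_cmd)) (std u [::])
    (24 * size u + 4 + (T u + (18 * size (F u) + 3))) (std (F u) [::]).
  apply: runs_within_seq; first exact: runs_within_read.
  apply: runs_within_seq; last exact: runs_within_write.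
  by have := Hc u [::] [::]; rewrite !cats0.
exists n.
  apply: (leq_trans le); apply: leq_trans (Hd u) _.
  case: (size u) => [|m].
    by rewrite add0n; apply: leq_trans (leq_addl _ _); case: (d) => // d'; rewrite leq_exp2r.
  rewrite -expnMn; apply: leq_trans (leq_addr _ _).
  by case: (d) => // d'; rewrite leq_exp2r //; lia.
rewrite -HF; apply: (@cmd_machine_output 4 _ u 4 n (F u)) R.
by rewrite /= Rc.
Qed.

Import Order.TTheory GRing.Theory Num.Theory.

(** * Correctness of the parser *)

Definition word_of (bs : seq (seq bool)) : seq letter := flatten (map block bs).

Lemma word_of_cat bs1 bs2 : word_of (bs1 ++ bs2) = word_of bs1 ++ word_of bs2.
Proof. by rewrite /word_of map_cat flatten_cat. Qed.

Lemma word_of_flatten {T} (f : T -> seq (seq bool)) l :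
  flatten [seq word_of (f x) | x <- l] = word_of (flatten [seq f x | x <- l]).
Proof. by elim: l => //= x l ->; rewrite word_of_cat. Qed.

Lemma split_blocks_block b w : split_blocks (block b ++ w) = b :: split_blocks w.
Proof. by rewrite /block; elim: b => //= c b ->. Qed.

Lemma word_ofK : cancel word_of split_blocks.
Proof. by elim=> // b bs IH; rewrite /word_of /= split_blocks_block -/(word_of bs) IH. Qed.

Lemma size_word_of bs : size bs <= size (word_of bs).
Proof.
elim: bs => //= b bs IH; rewrite /word_of /= size_cat -/(word_of bs) size_rcons.
by rewrite addSn ltnS; apply: leq_trans IH (leq_addl _ _).
Qed.

Definition edge_blocks (M : mdp) (s : state M) (a : action M) (t : state M) : seq (seq bool) :=
  [:: nat_bits (absz (numq (trans s a t))); nat_bits (absz (denq (trans s a t)))].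

Definition row_blocks (M : mdp) (s : state M) (a : action M) : seq (seq bool) :=
  int_bits (wgt s a) :: flatten [seq edge_blocks s a t | t <- enum 'I_(nS M)].

Definition state_blocks (M : mdp) (s : state M) : seq (seq bool) :=
  flatten [seq row_blocks s a | a <- enum 'I_(nA M)].

Definition mdp_blocks (M : mdp) : seq (seq bool) :=
  flatten [seq state_blocks s | s <- enum 'I_(nS M)].

Definition dwr_block (M : mdp) (phi : dwr M) (t : state M) : seq bool :=
  if t \in targets phi then
    if threshold phi t is Some k then true :: int_bits k else [:: false]
  else [::].

Definition instance_blocks (x : dwr_instance) : seq (seq bool) :=
  nat_bits (nS (inst_mdp x)) :: nat_bits (nA (inst_mdp x)) ::
  mdp_blocks (inst_mdp x) ++
  nat_bits (inst_state x) :: [seq dwr_block (inst_dwr x) t | t <- enum 'I_(nS (inst_mdp x))].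

Lemma enc_instance_blocks x : enc_instance x = word_of (instance_blocks x).
Proof.
have mdpE : flatten [seq flatten [seq enc_int (wgt s a) ++
      flatten [seq enc_prob (trans s a t) | t <- enum 'I_(nS (inst_mdp x))]
    | a <- enum 'I_(nA (inst_mdp x))] | s <- enum 'I_(nS (inst_mdp x))]
    = word_of (mdp_blocks (inst_mdp x)).
  rewrite -word_of_flatten; congr flatten; apply: eq_map => s.
  rewrite -word_of_flatten; congr flatten; apply: eq_map => a.
  rewrite /row_blocks -cat1s word_of_cat {1}/word_of /= cats0 -word_of_flatten.
  congr (_ :: (_ ++ flatten _)); apply: eq_map => t.
  by rewrite /word_of /= cats0.
have dwrE : enc_dwr (inst_dwr x)
    = word_of [seq dwr_block (inst_dwr x) t | t <- enum 'I_(nS (inst_mdp x))].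
  by rewrite /enc_dwr /word_of -map_comp.
rewrite /enc_instance /enc_mdp mdpE dwrE -!catA /instance_blocks.
rewrite -[nat_bits _ :: nat_bits _ :: _]/([:: nat_bits _; nat_bits _] ++ _) !word_of_cat.
by rewrite /word_of /= cats0 -!catA.
Qed.

(** The intermediate values do not exceed the final one, so the truncation never takes effect when
    the latter fits. *)
Lemma unaryE {T} (u : seq T) x : bval x <= size u -> unary u x = nseq (bval x) tt.
Proof.
elim: x => //= b x IH le; rewrite IH; last by lia.
rewrite take_asE take_oversize; last first.
  by case: b le => /= le; rewrite ?size_cat !size_nseq; lia.
by case: b {le} => /=; rewrite -nseqD addnn.
Qed.

Lemma unary_nat_bits {T} (u : seq T) n : n <= size u -> unary u (nat_bits n) = nseq n tt.
Proof. by move=> le; rewrite unaryE bval_nat_bits. Qed.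

Lemma mealy_parse {E V} (f : stream -> V * stream) (cd : E -> seq (seq bool)) (val : E -> V) l :
  (forall e rest, f (cd e ++ rest) = (val e, rest)) ->
  forall rest, mealy (fun s (_ : unit) => f s) (flatten [seq cd e | e <- l] ++ rest) (nseq (size l) tt)
  = ([seq val e | e <- l], rest).
Proof. by move=> H rest; elim: l => //= e l IH; rewrite -catA H /= IH. Qed.

Definition graph (M : mdp) : seq (seq (num * seq bool)) :=
  [seq [seq (num_of (int_bits (wgt s a)), [seq (0 < trans s a t)%R | t <- enum 'I_(nS M)])
       | a <- enum 'I_(nA M)] | s <- enum 'I_(nS M)].

Lemma nonempty_nat_bits n : nonempty (nat_bits n) = (n != 0).
Proof.
case: n => // n; have := bval_nat_bits n.+1; by case: (nat_bits _).
Qed.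

Lemma parse_mdpE (M : mdp) rest :
  parse_mdp (nseq (nS M) tt) (nseq (nA M) tt) (mdp_blocks M ++ rest) = (graph M, rest).
Proof.
have sS : size (enum 'I_(nS M)) = nS M by rewrite size_enum_ord.
have sA : size (enum 'I_(nA M)) = nA M by rewrite size_enum_ord.
rewrite /parse_mdp -[X in mealy _ _ (nseq X tt)]sS; apply: mealy_parse => s {}rest.
rewrite /parse_state -[X in mealy _ _ (nseq X tt)]sA; apply: mealy_parse => a {}rest.
rewrite /parse_row /= -[X in nseq X tt]sS (mealy_parse (E := state M) (val := fun t => (0 < trans s a t)%R)) //.
move=> t {}rest; rewrite /parse_edge /= nonempty_nat_bits; congr (_, _).
by rewrite absz_eq0 numq_eq0 lt_def trans_ge0 andbT.
Qed.

Lemma size_flatten_ge {T E} (f : E -> seq T) l :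
  (forall x, 0 < size (f x)) -> size l <= size (flatten [seq f x | x <- l]).
Proof.
by move=> H; elim: l => //= x l IH; rewrite size_cat; have := H x; lia.
Qed.

Section Input.
Variable x : dwr_instance.
Notation M := (inst_mdp x).
Notation u := (enc_instance x).

(** Every state contributes one block of the property, and every block at least its separator. *)
Lemma size_instance : size (mdp_blocks M) + nS M < size u.
Proof.
rewrite enc_instance_blocks; apply: leq_trans (size_word_of _).
by rewrite /instance_blocks /= size_cat /= size_map size_enum_ord; lia.
Qed.

Lemma states_ofE : states_of u = nseq (nS M) tt.
Proof.
have := size_instance => le.
rewrite /states_of {2}enc_instance_blocks word_ofK /= unary_nat_bits //.
exact: leq_trans (leq_addl _ _) (ltnW le).
Qed.

Lemma actions_ofE : actions_of u = nseq (nA M) tt.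
Proof.
have := size_instance => le.
rewrite /actions_of {2}enc_instance_blocks word_ofK /= unary_nat_bits //.
suff : nA M <= size (mdp_blocks M).
  by move=> le2; apply: leq_trans (leq_trans le2 (leq_addr _ _)) (ltnW le).
rewrite /mdp_blocks.
(* The list of states is nonempty, since it contains the initial state, and the part of the input
   for one state has a row for each action. This bounds [nA] by the input length. *)
have : inst_state x \in enum 'I_(nS M) by rewrite mem_enum.
move: (enum _) => l; elim: l => //= s l IH; rewrite inE size_cat => /orP[_|/IH]; last by lia.
apply: leq_trans (leq_addr _ _).
by rewrite -[leqLHS](size_enum_ord (nA M)); apply: size_flatten_ge.
Qed.

Lemma parsedE : parsed u = (graph M,
  nat_bits (inst_state x) :: [seq dwr_block (inst_dwr x) t | t <- enum 'I_(nS M)]).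
Proof.
by rewrite /parsed states_ofE actions_ofE enc_instance_blocks word_ofK /= parse_mdpE.
Qed.

Lemma start_ofE : start_of u = nseq (inst_state x) tt.
Proof.
have := size_instance => le; rewrite /start_of parsedE unary_nat_bits //=.
apply: leq_trans (leq_trans (ltnW (ltn_ord (inst_state x))) (leq_addl _ _)) (ltnW le).
Qed.

Definition init_node (t : state M) : node :=
  (if t == inst_state x then Some ([::], [::]) else None, false).

Lemma init_vecE : init_vec (states_of u) (start_of u) = [seq init_node t | t <- enum 'I_(nS M)].
Proof.
rewrite states_ofE start_ofE /init_vec /init_node.
set f := fun o _ => _.
have N n : (mealy f None (nseq n tt)).1 = nseq n (None, false) by elim: n => //= n ->.
have S m n : (mealy f (Some (nseq m tt)) (nseq n tt)).1
    = [seq ((if i == m then Some ([::], [::]) else None, false) : node) | i <- iota 0 n].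
  elim: n m => // n IH [|m] /=.
    rewrite N; congr cons; apply: (@eq_from_nth _ (None, false)).
      by rewrite size_map size_iota size_nseq.
    move=> i; rewrite size_nseq => lt; rewrite nth_nseq lt (nth_map 0) ?size_iota //.
    by rewrite nth_iota.
  by rewrite IH -[1]addn0 iotaDl -map_comp.
rewrite S -val_enum_ord -map_comp; apply: eq_map => i /=.
by rewrite -val_eqE.
Qed.

End Input.

(** * Walks in an MDP *)

Section Paths.
Variable M : mdp.
Implicit Types (s t : state M) (p q : seq (action M * state M)).

Lemma path_last_cat s p q : path_last s (p ++ q) = path_last (path_last s p) q.
Proof. by rewrite /path_last map_cat last_cat. Qed.

Lemma is_path_cat s p q : is_path s (p ++ q) = is_path s p && is_path (path_last s p) q.
Proof.
elim: p s => //= -[a t] p IH s; by rewrite IH andbA.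
Qed.

Lemma path_wgt_cat s p q : (path_wgt s (p ++ q) = path_wgt s p + path_wgt (path_last s p) q)%R.
Proof.
elim: p s => [|[a t] p IH] s /=; first by rewrite add0r.
by rewrite IH addrA.
Qed.

Lemma path_last_take s p i : i <= size p -> path_last s (take i p) = nth s (s :: map snd p) i.
Proof.
move=> le; rewrite /path_last map_take -nth_last size_takel ?size_map //.
by case: i le => [|i] le; rewrite ?take0 //= nth_take.
Qed.

Lemma walk_cycle s p : nS M <= size p -> exists p1 c p2,
  [/\ p = p1 ++ c ++ p2, c != [::] & path_last (path_last s p1) c = path_last s p1].
Proof.
(* Pigeonhole: with its start the walk visits [size p + 1] states, more than there are. *)
move=> le; have : ~~ uniq (s :: map snd p).
  apply/negP => /card_uniqP E; have := max_card (mem (s :: map snd p)).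
  by rewrite E card_ord /= size_map; lia.
case/(uniqPn s) => i [j [ij]]; rewrite /= size_map ltnS => jp E.
exists (take i p), (take (j - i) (drop i p)), (drop j p).
have E1 : take i p ++ take (j - i) (drop i p) = take j p.
  by rewrite -{2}(subnKC (ltnW ij)) takeD.
split.
- by rewrite catA E1 cat_take_drop.
- by apply: contraTneq ij => /(congr1 size); rewrite size_takel ?size_drop ?leq_sub2r // => /eqP; rewrite subn_eq0 -leqNgt. 
- rewrite -path_last_cat E1 !path_last_take //; last exact: leq_trans (ltnW ij) jp.
Qed.

Definition leads_to s t p := is_path s p && (path_last s p == t).

Lemma leads_to_cat s t p q : leads_to s t (p ++ q) =
  is_path s p && leads_to (path_last s p) t q.
Proof. by rewrite /leads_to is_path_cat path_last_cat andbA. Qed.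

Lemma leads_to_rcons s t p a t' : leads_to s t (rcons p (a, t')) =
  [&& is_path s p, (0 < trans (path_last s p) a t')%R & t' == t].
Proof. by rewrite -cats1 leads_to_cat /leads_to /= andbT. Qed.

Lemma path_wgt_rcons s p a t :
  (path_wgt s (rcons p (a, t)) = path_wgt s p + wgt (path_last s p) a)%R.
Proof. by rewrite -cats1 path_wgt_cat /= addr0. Qed.

Lemma leads_to_cut s t p1 c p2 : path_last (path_last s p1) c = path_last s p1 ->
  leads_to s t (p1 ++ c ++ p2) ->
  leads_to s t (p1 ++ p2) /\ is_path (path_last s p1) c.
Proof.
by move=> E; rewrite !leads_to_cat E => /and3P[-> -> ->].
Qed.

Lemma leads_to_short s t p : leads_to s t p -> exists2 q, leads_to s t q & size q < nS M.
Proof.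
have [n] := ubnP (size p); elim: n p => // n IH p lt H.
case: (ltnP (size p) (nS M)) => [|le]; first by exists p.
have [p1 [c [p2 [E c0 cyc]]]] := walk_cycle s le.
rewrite E in H; have [H' _] := leads_to_cut cyc H.
apply: (IH (p1 ++ p2)) => //.
have : 0 < size c by case: (c) c0.
by move: lt; rewrite E !size_cat; move: (size p1) (size c) (size p2) => n1 n2 n3; lia.
Qed.

Definition unbounded s t := forall K : int, exists2 p, leads_to s t p & (K <= path_wgt s p)%R.

(** The cycle is pumped. Weights are integers, so each turn gains at least 1, and the absolute value
    of the missing amount is a sufficient number of turns. *)
Lemma unbounded_cycle s t p1 c p2 : path_last (path_last s p1) c = path_last s p1 ->
  leads_to s t (p1 ++ c ++ p2) -> (0 < path_wgt (path_last s p1) c)%R -> unbounded s t.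
Proof.
move=> cyc H pos K; move: H; rewrite !leads_to_cat cyc => /and3P[H1 H2 H3].
set v := path_last s p1 in cyc pos H2 H3.
pose cn n := flatten (nseq n c).
have [L [I W]] : (forall n, path_last v (cn n) = v) /\ (forall n, is_path v (cn n)) /\
    (forall n, (n%:Z <= path_wgt v (cn n))%R).
  split; last split; elim=> //= n; rewrite /cn /=.
  - by rewrite path_last_cat cyc.
  - by rewrite is_path_cat cyc H2.
  - rewrite path_wgt_cat cyc -/(cn n); move: pos.
    by move: (path_wgt v c) (path_wgt v (cn n)) => y z; lia.
pose n := absz (K - path_wgt s p1 - path_wgt v p2)%R.
exists (p1 ++ cn n ++ p2); first by rewrite !leads_to_cat -/v L I H1.
have le : (K - path_wgt s p1 - path_wgt v p2 <= n%:Z)%R by rewrite /n; lia.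
rewrite !path_wgt_cat -/v L; have := W n.
by move: (path_wgt v (cn n)) le => y le; lia.
Qed.

Lemma unbounded_step s t a v : unbounded s v -> (0 < trans v a t)%R -> unbounded s t.
Proof.
move=> U pos K; have [p /andP[ip /eqP ep] le] := U (K - wgt v a)%R.
exists (rcons p (a, t)); first by rewrite leads_to_rcons ip ep pos eqxx.
by rewrite path_wgt_rcons ep; lia.
Qed.

End Paths.

(** * Correctness of the rounds *)

Definition nval (x : num) : int := ((bval x.1)%:Z - (bval x.2)%:Z)%R.

Lemma nval_nadd x y : (nval (nadd x y) = nval x + nval y)%R.
Proof. by rewrite /nval /= !bval_badd; lia. Qed.

Lemma nleE x y : nle x y = (nval x <= nval y)%R.
Proof. by rewrite /nle bleE !bval_badd /nval; lia. Qed.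

Lemma nval_num_of z : nval (num_of (int_bits z)) = z.
Proof.
rewrite /num_of /int_bits /=; case: ifP => H; rewrite /nval /= bval_nat_bits; lia.
Qed.

Lemma improve_val m i c x : exists e, [/\ (improve m i c x).1 = Some e,
   e = c \/ x.1 = Some e, (nval c <= nval e)%R &
   forall d, x.1 = Some d -> (nval d <= nval e)%R].
Proof.
rewrite /improve; case: x => -[d|] j /=; last by exists c; split=> //; left.
rewrite nleE; case: lerP => [le|/ltW lt].
  by exists d; split=> //; [right|move=> _ [<-]].
by exists c; split=> //; [left|move=> _ [<-]].
Qed.

Lemma improve_flag m i c x : (improve m i c x).2 =
  [|| x.2, i | m && (if x.1 is Some d then (nval d < nval c)%R else false)].
Proof.
rewrite /improve; case: x => -[d|] j /=; last by rewrite andbF orbF.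
by rewrite nleE; case: ltrP => _ /=; rewrite ?andbF ?andbT ?orbF ?orbA.
Qed.

(** Splits a fold over whole vectors into independent folds, one per coordinate; through it the
    rounds on lists become functions on states. *)
Lemma foldl_pointwise (T E V : Type) (l : seq T) (f : seq V -> E -> seq V) (g : T -> V -> E -> V) :
  (forall H e, f [seq H t | t <- l] e = [seq g t (H t) e | t <- l]) ->
  forall H es, foldl f [seq H t | t <- l] es = [seq foldl (g t) (H t) es | t <- l].
Proof. by move=> fg H es; elim: es H => //= e es IH H; rewrite fg (IH (fun t => g t (H t) e)). Qed.

Lemma foldl_map (S E T : Type) (f : S -> E -> S) (h : T -> E) x l :
  foldl f x (map h l) = foldl (fun y e => f y (h e)) x l.
Proof. by elim: l x => /=. Qed.

Lemma zip_map2 (T V W : Type) (f : T -> V) (g : T -> W) l :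
  zip [seq f t | t <- l] [seq g t | t <- l] = [seq (f t, g t) | t <- l].
Proof. by elim: l => //= x l ->. Qed.

Section Round.
Variable M : mdp.
Notation edge := (state M * action M)%type.
Implicit Types (F : state M -> node) (t : state M) (p : edge).

(** [F] is the vector at the start of the round, [x] the current content of the node of [t]. *)
Definition relax m F t (x : node) p : node :=
  if (F p.1).1 is Some d then
    if (0 < trans p.1 p.2 t)%R
    then improve m (F p.1).2 (nadd d (num_of (int_bits (wgt p.1 p.2)))) x else x
  else x.

Definition edges : seq edge := [seq (s, a) | s <- enum 'I_(nS M), a <- enum 'I_(nA M)].

Lemma mem_edges p : p \in edges.
Proof. by case: p => s a; apply: allpairs_f; rewrite mem_enum. Qed.

Definition round_fun m F t : node := foldl (relax m F t) (F t) edges.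

Lemma roundE m F : round m (graph M) [seq F t | t <- enum 'I_(nS M)]
  = [seq round_fun m F t | t <- enum 'I_(nS M)].
Proof.
rewrite /round /graph zip_map2.
have rowE (H : state M -> node) s a : relax_row m (F s)
    (num_of (int_bits (wgt s a)), [seq (0 < trans s a t)%R | t <- enum 'I_(nS M)])
    [seq H t | t <- enum 'I_(nS M)] = [seq relax m F t (H t) (s, a) | t <- enum 'I_(nS M)].
  by rewrite /relax_row /relax /=; case: (F s).1 => // d; rewrite zip_map2 -map_comp.
have stateE (H : state M -> node) s : relax_state m [seq H t | t <- enum 'I_(nS M)]
    (F s, [seq (num_of (int_bits (wgt s a)), [seq (0 < trans s a t)%R | t <- enum 'I_(nS M)])
          | a <- enum 'I_(nA M)])
  = [seq foldl (fun x a => relax m F t x (s, a)) (H t) (enum 'I_(nA M)) | t <- enum 'I_(nS M)].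
  rewrite /relax_state foldl_map /=.
  by apply: (foldl_pointwise (g := fun t x a => relax m F t x (s, a))) => {}H a; apply: rowE.
rewrite foldl_map (foldl_pointwise (g := fun t x s =>
  foldl (fun x a => relax m F t x (s, a)) x (enum 'I_(nA M)))); last first.
  by move=> H s; apply: stateE.
apply: eq_map => t; rewrite /round_fun /edges; move: (F t) => x.
move: (enum _) (enum _) => lS lA; elim: lS x => //= s l IH x.
by rewrite IH foldl_cat foldl_map.
Qed.

Definition candidate F t p (c : int) := exists d,
  [/\ (F p.1).1 = Some d, (0 < trans p.1 p.2 t)%R & c = (nval d + wgt p.1 p.2)%R].

Variant relax_spec m F t x p : node -> Prop :=
| RelaxSkip : (forall c, ~ candidate F t p c) -> relax_spec m F t x p x
| RelaxStep c d y : candidate F t p c -> y.1 = Some d ->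
    nval d = c \/ x.1 = Some d -> (c <= nval d)%R ->
    (forall d', x.1 = Some d' -> (nval d' <= nval d)%R) ->
    y.2 = [|| x.2, (F p.1).2 | m && (if x.1 is Some d' then (nval d' < c)%R else false)] ->
    relax_spec m F t x p y.

Lemma relaxP m F t x p : relax_spec m F t x p (relax m F t x p).
Proof.
rewrite /relax; case E: (F p.1).1 => [d|]; last by left=> c [d []]; rewrite E.
case: ifP => pos; last by left=> c [d' []]; rewrite pos.
set w := num_of _; have nw : nval (nadd d w) = (nval d + wgt p.1 p.2)%R.
  by rewrite nval_nadd nval_num_of.
have [e [E1 E2 le mono]] := improve_val m (F p.1).2 (nadd d w) x.
apply: (@RelaxStep _ _ _ _ _ (nval (nadd d w)) e) => //.
- by exists d.
- by case: E2 => [->|]; [left|right].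
- by rewrite improve_flag.
Qed.

Lemma candidate_inj F t p c c' : candidate F t p c -> candidate F t p c' -> c = c'.
Proof. by move=> [d [E _ ->]] [d' [E' _ ->]]; move: E'; rewrite E => -[->]. Qed.

(** Relaxation invents no value: the result is the old value or a candidate. With [Q] saying that a
    number is the weight of a short enough walk, this shows that the values are attained. *)
Lemma fold_achieved m F t (x : node) l (Q : int -> Prop) :
  (forall d, x.1 = Some d -> Q (nval d)) ->
  (forall p c, p \in l -> candidate F t p c -> Q c) ->
  forall d, (foldl (relax m F t) x l).1 = Some d -> Q (nval d).
Proof.
elim: l x => //= p l IH x H1 H2; apply: IH; last first.
  by move=> p' c pl; apply: H2; rewrite inE pl orbT.
case: relaxP => [|c d y cand Ey Ed _ _ _ d' ]; first by [].
rewrite Ey => -[<-]; case: Ed => [->|]; last exact: H1.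
by apply: H2 cand; rewrite inE eqxx.
Qed.

Lemma fold_mono m F t (x : node) l d : x.1 = Some d ->
  exists2 d', (foldl (relax m F t) x l).1 = Some d' & (nval d <= nval d')%R.
Proof.
elim: l x d => [|p l IH] x d E /=; first by exists d.
case: relaxP => [_|c e y _ Ey _ _ mono _]; first exact: IH.
by have [d' H le] := IH _ _ Ey; exists d' => //; apply: le_trans (mono _ E) le.
Qed.

Lemma fold_candidate m F t (x : node) l p c : p \in l -> candidate F t p c ->
  exists2 d', (foldl (relax m F t) x l).1 = Some d' & (c <= nval d')%R.
Proof.
elim: l x => //= p' l IH x; rewrite inE => /orP[/eqP<- cand|pl cand]; last exact: IH.
case: relaxP => [/(_ _ cand)//|c' e y cand' Ey _ le _ _].
have [d' H le'] := fold_mono m F t l Ey; exists d' => //.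
by rewrite (candidate_inj cand cand') (le_trans le le').
Qed.

Lemma fold_flag_mono m F t (x : node) l : x.2 -> (foldl (relax m F t) x l).2.
Proof.
elim: l x => //= p l IH x fx; apply: IH.
by case: relaxP => // c d y _ _ _ _ _ ->; rewrite fx.
Qed.

Lemma fold_flag_inherit m F t (x : node) l p c : p \in l -> candidate F t p c -> (F p.1).2 ->
  (foldl (relax m F t) x l).2.
Proof.
elim: l x => //= p' l IH x; rewrite inE => /orP[/eqP<- cand fp|pl cand fp]; last exact: IH.
apply: fold_flag_mono.
by case: relaxP => [/(_ _ cand)//|c' d y _ _ _ _ _ ->]; rewrite fp orbT.
Qed.

(** When the edge [p] has its turn, its candidate may no longer be an improvement, because earlier
    edges have already raised the value. But then one of them has set the flag. *)
Lemma fold_flag_improve F t (x : node) l p c d : p \in l -> candidate F t p c ->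
  x.1 = Some d -> (nval d < c)%R -> (foldl (relax true F t) x l).2.
Proof.
move=> pl cand E lt.
(* Invariant along the fold: a current value [e] above the initial [d] implies that the flag is
   up. *)
suff H y e : y.1 = Some e -> (nval d < nval e)%R ==> y.2 -> (nval d <= nval e)%R ->
    (foldl (relax true F t) y l).2 by apply: (H x d) => //; rewrite ltxx.
elim: l y e pl => //= p' l IH y e; rewrite inE => /orP[/eqP<- Ey fl le|pl Ey fl le]; last first.
  case: relaxP => [_|c' e' z cand' Ez Ee le' mono Ef]; first exact: (IH _ e).
  have le2 := mono _ Ey; apply: (IH _ e') => //; last exact: le_trans le le2.
  rewrite Ef Ey /=; apply/implyP => lt'.
  case: Ee => [Ee|]; last by rewrite Ey => -[Ee]; move: fl; rewrite Ee lt' /= => ->.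
  rewrite -Ee; case: (ltrP (nval e) (nval e')) => [|le3]; first by rewrite !orbT.
  by move: fl; rewrite (lt_le_trans lt' le3) /= => ->.
apply: fold_flag_mono.
case: relaxP => [/(_ _ cand)//|c' e' z cand' Ez Ee le' mono ->].
rewrite Ey /= -(candidate_inj cand cand'); case: (ltrP (nval e) c) => [|le3].
  by rewrite !orbT.
by move: fl; rewrite (lt_le_trans lt le3) /= => ->.
Qed.

(** Improvements are measured against the content in the middle of the fold; since values only grow,
    they are also improvements over the initial [x]. *)
Lemma fold_flag_origin m F t (x : node) l : (foldl (relax m F t) x l).2 ->
  [\/ x.2, exists p c, candidate F t p c /\ (F p.1).2
    | m /\ exists p c, candidate F t p c /\ forall d, x.1 = Some d -> (nval d < c)%R].
Proof.
elim: l x => [|p l IH] x /=; first by constructor 1.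
case: relaxP => [_ /IH //|c d y cand Ey Ed le mono fy] /IH[|H|[mt H]].
- rewrite fy => /or3P[->|fp|/andP[mt]].
  + by constructor 1.
  + by constructor 2; exists p, c.
  + case E: x.1 => [d'|] // lt; constructor 3; split=> //.
    by exists p, c; split=> // e [<-].
- by constructor 2.
- constructor 3; split=> //; have [p' [c' [cand' H']]] := H; exists p', c'; split=> // e Ex.
  by apply: le_lt_trans (mono _ Ex) (H' _ Ey).
Qed.

End Round.

(** * Values and flags as statements about walks *)

Section LongestWalks.
Variables (M : mdp) (s0 : state M).
Implicit Types (F : state M -> node) (t : state M).

(** Since the maximum is over all walks of at most [k] steps, an improvement in the next round comes
    from a walk of exactly [k.+1] steps. *)
Definition best k F := forall t,
  if (F t).1 is Some d then
    (exists p, [/\ leads_to s0 t p, size p <= k & path_wgt s0 p = nval d]) /\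
    (forall p, leads_to s0 t p -> size p <= k -> (path_wgt s0 p <= nval d)%R)
  else forall p, leads_to s0 t p -> k < size p.

Lemma best_init : best 0 (fun t => (if t == s0 then Some ([::], [::]) else None, false)).
Proof.
move=> t /=; case: eqP => [->|ne] /=.
  split; first by exists [::]; rewrite /leads_to /= eqxx.
  by case=> //= _ _.
by case=> //; rewrite /leads_to /= eq_sym => /eqP.
Qed.

Lemma best_candidate k F t p c : best k F -> candidate F t p c ->
  exists q, [/\ leads_to s0 t q, size q <= k.+1 & path_wgt s0 q = c].
Proof.
case: p => s a B [d [Ed pos ->]]; have := B s; rewrite Ed => -[[q [/andP[iq /eqP eq] sq wq]] _].
exists (rcons q (a, t)); rewrite leads_to_rcons iq eq pos eqxx size_rcons; split=> //.
by rewrite path_wgt_rcons wq eq.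
Qed.

Lemma best_last_step k F t p : best k F -> leads_to s0 t p -> 0 < size p <= k.+1 ->
  exists e c, candidate F t e c /\ (path_wgt s0 p <= c)%R.
Proof.
move=> B; case/lastP: p => [|p [a t']] //; rewrite leads_to_rcons size_rcons.
move=> /and3P[ip pos /eqP et] /andP[_]; rewrite {t'}et ltnS in pos * => sp.
have lp : leads_to s0 (path_last s0 p) p by rewrite /leads_to ip eqxx.
have := B (path_last s0 p); case Ed: (F _).1 => [d|]; last first.
  by move=> /(_ p lp); rewrite ltnNge sp.
move=> [_ /(_ p lp sp) le]; exists (path_last s0 p, a), (nval d + wgt (path_last s0 p) a)%R.
by split; [exists d|rewrite path_wgt_rcons lerD2r].
Qed.

Lemma best_round m k F : best k F -> best k.+1 (round_fun m F).
Proof.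
move=> B t.
have ach (Q : int -> Prop) : (forall q, leads_to s0 t q -> size q <= k.+1 -> Q (path_wgt s0 q)) ->
    forall d, (round_fun m F t).1 = Some d -> Q (nval d).
  move=> HQ; apply: fold_achieved => [d Ed|p c _ /(best_candidate B)[q [lq sq <-]]]; last exact: HQ.
  have := B t; rewrite Ed => -[[q [lq sq <-]] _]; apply: HQ => //; exact: leq_trans sq _.
have up p : leads_to s0 t p -> size p <= k.+1 ->
    exists2 d, (round_fun m F t).1 = Some d & (path_wgt s0 p <= nval d)%R.
  move=> lp; case: (posnP (size p)) => [/size0nil p0 _|p0 sp].
    have := B t; case Ed: (F t).1 => [d|]; last by move=> /(_ p lp); rewrite p0.
    move=> [_ /(_ p lp)]; rewrite p0 => /(_ isT) le.
    by have [d' E le'] := fold_mono m F t (edges M) Ed; exists d' => //; apply: le_trans le le'.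
  have [e [c [cand le]]] : exists e c, candidate F t e c /\ (path_wgt s0 p <= c)%R.
    by apply: (best_last_step B lp); rewrite p0.
  have [d E le'] := fold_candidate m (F t) (mem_edges e) cand.
  by exists d => //; apply: le_trans le le'.
case E: (round_fun m F t).1 => [d|].
  split; last by move=> p lp sp; have [d'] := up p lp sp; rewrite E => -[<-].
  apply: (ach (fun c => exists p, [/\ leads_to s0 t p, size p <= k.+1 & path_wgt s0 p = c])) => //.
  by move=> q lq sq; exists q.
by move=> p lp; rewrite ltnNge; apply/negP => sp; have [d] := up p lp sp; rewrite E.
Qed.

Definition noflag F := forall t, (F t).2 = false.

Lemma noflag_round F : noflag F -> noflag (round_fun false F).
Proof.
move=> nF t; apply/negbTE/negP => /fold_flag_origin[|[p [c [_]]]|[]//]; by rewrite nF.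
Qed.

(** A reachable state is reached in fewer than [nS] steps, so it has a value by now. *)
Lemma best_reach k F t p : best k F -> nS M <= k.+1 -> leads_to s0 t p ->
  exists d, (F t).1 = Some d.
Proof.
move=> B le /leads_to_short[q lq sq]; have := B t; case: (F t).1 => [d|]; first by exists d.
by move=> /(_ q lq); lia.
Qed.

(** The improving walk has [k.+1] steps, enough for a cycle. Without the cycle it has at most [k]
    steps, hence weight at most the old value; so the cycle has positive weight and can be
    pumped. *)
Lemma improvement_unbounded k F t p c : best k F -> nS M <= k.+1 ->
  candidate F t p c -> (forall d, (F t).1 = Some d -> (nval d < c)%R) -> unbounded s0 t.
Proof.
move=> B le cand H; have [q [lq sq wq]] := best_candidate B cand.
have [d Ed] := best_reach B le lq.
have lt := H _ Ed; have := B t; rewrite Ed => -[_ up].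
have sq' : size q = k.+1.
  apply/eqP; rewrite eqn_leq sq /= ltnNge; apply/negP => sk.
  by have := up q lq sk; rewrite wq leNgt lt.
have leqq : nS M <= size q by rewrite sq'.
have [p1 [c' [p2 [E c0 cyc]]]] := walk_cycle s0 leqq.
have lq2 : leads_to s0 t (p1 ++ c' ++ p2) by rewrite -E.
have [l' _] := leads_to_cut cyc lq2.
apply: (unbounded_cycle cyc lq2).
have s' : size (p1 ++ p2) <= k.
  have : 0 < size c' by case: (c') c0.
  move: sq'; rewrite E !size_cat; move: (size p1) (size c') (size p2) => n1 n2 n3; lia.
have := up _ l' s'; move: lt; rewrite -wq E !path_wgt_cat cyc.
by move: (path_wgt s0 p1) (path_wgt _ c') (path_wgt _ p2) (nval d) => w1 w2 w3 w; lia.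
Qed.

Definition sound F := forall t, (F t).2 -> unbounded s0 t.

Lemma sound_round m k F : best k F -> nS M <= k.+1 -> sound F -> sound (round_fun m F).
Proof.
move=> B le S t /fold_flag_origin[|[[s a] [c [[d [_ pos _]] fs]]]|[_ [p [c [cand H]]]]].
- exact: S.
- exact: unbounded_step (S _ fs) pos.
- exact: improvement_unbounded B le cand H.
Qed.

Lemma flag_path k F s q : best k F -> nS M <= k.+1 -> sound F -> (F s).2 -> is_path s q ->
  (iter (size q) (round_fun true) F (path_last s q)).2.
Proof.
move=> B le S fs; elim/last_ind: q => // q [a t] IH.
rewrite -cats1 is_path_cat path_last_cat size_cat addn1 /= andbT => /andP[iq pos].
have fl := IH iq; set G := iter _ _ F in fl *.
have [BG leG] : best (k + size q) G /\ sound G.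
  rewrite /G; elim: (size q) => [|n [B' S']] /=; first by rewrite addn0.
  rewrite addnS; split; first exact: best_round.
  by apply: sound_round B' _ S'; lia.
(* A flagged state has unbounded weights, so it is reached by some walk; it therefore has a value
   and offers a candidate along the edge, which transports the flag. *)
have [p lp _] := leG _ fl 0%R.
have [d Ed] : exists d, (G (path_last s q)).1 = Some d by apply: (best_reach BG) lp; lia.
apply: (@fold_flag_inherit _ _ G _ _ _ (path_last s q, a) (nval d + wgt (path_last s q) a)%R) => //.
  exact: mem_edges.
by exists d.
Qed.

Lemma flag_iter F n t : (F t).2 -> (iter n (round_fun true) F t).2.
Proof. by move=> f; elim: n => //= n IH; apply: fold_flag_mono. Qed.

(** On the states that lead to [t] the round improves nothing, so the values of [F] satisfy every
    edge inequality there. They form a potential, which bounds each walk by induction on its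
    length. *)
Lemma improvement_bound k F t : best k F -> nS M <= k.+1 ->
  (forall s q, (round_fun true F s).2 -> ~ leads_to s t q) ->
  forall p, leads_to s0 t p -> exists2 d, (F t).1 = Some d & (path_wgt s0 p <= nval d)%R.
Proof.
move=> B le N p lp.
(* The induction is on a prefix [q] of the walk; the remainder [r] witnesses that its end still
   leads to [t]. *)
suff H q r : leads_to s0 (path_last s0 q) q -> leads_to (path_last s0 q) t r ->
    exists2 d, (F (path_last s0 q)).1 = Some d & (path_wgt s0 q <= nval d)%R.
  have [ip /eqP ep] := andP lp; rewrite -ep; apply: (H p [::]); first by rewrite ep.
  by rewrite ep /leads_to /= eqxx.
elim/last_ind: q r => [|q [a v] IH] r lq lr.
  have [d Ed] := best_reach B le lq; exists d => //.
  have := B (path_last s0 [::]); rewrite Ed => -[_ up].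
  by apply: (up [::]).
have [d' Ed'] := best_reach B le lq; exists d' => //.
have ev : path_last s0 (rcons q (a, v)) = v by rewrite -cats1 path_last_cat.
rewrite ev in Ed' lr lq *; move: lq; rewrite leads_to_rcons => /and3P[iq pos _].
have [||d Ed le1] := IH ((a, v) :: r).
- by rewrite /leads_to iq eqxx.
- by move: lr; rewrite /leads_to /= pos.
have cand : candidate F v (path_last s0 q, a) (nval d + wgt (path_last s0 q) a)%R by exists d.
rewrite path_wgt_rcons; apply: (@le_trans _ _ (nval d + wgt (path_last s0 q) a)%R); first by rewrite lerD2r.
rewrite leNgt; apply/negP => lt; apply: (N v r) => //.
exact: (fold_flag_improve (mem_edges _) cand Ed' lt).
Qed.

Definition node_spec t (x : node) :=
  if x.1 is Some d then
    if x.2 then unbounded s0 t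
    else (exists2 p, leads_to s0 t p & path_wgt s0 p = nval d) /\
         (forall p, leads_to s0 t p -> (path_wgt s0 p <= nval d)%R)
  else forall p, ~~ leads_to s0 t p.

Lemma final_spec F t : best (nS M) F -> noflag F ->
  node_spec t (iter (nS M).+1 (round_fun true) F t).
Proof.
move=> B nF; have le : nS M <= (nS M).+1 by [].
have S : sound F by move=> s; rewrite nF.
have inv n : best (nS M + n) (iter n (round_fun true) F) /\ sound (iter n (round_fun true) F).
  elim: n => [|n [B' S']] /=; first by rewrite addn0.
  rewrite addnS; split; first exact: best_round.
  by apply: sound_round B' _ S'; lia.
have [BG SG] := inv (nS M).+1; set G := iter _ _ _ in BG SG *.
have leG : nS M <= (nS M + (nS M).+1).+1 by lia.
rewrite /node_spec; case Ed: (G t).1 => [d|]; last first.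
  by move=> p; apply/negP => /(best_reach BG leG)[d]; rewrite Ed.
case: ifP => [|nfl]; first exact: SG.
have := BG t; rewrite Ed => -[[p [lp _ wp]] up]; split; first by exists p.
have [B1 S1] := inv 1.
(* A flag raised in the first of these rounds would reach [t] along a walk of fewer than [nS] steps
   within the [nS] rounds left, and would persist until the end. *)
have N s q : (round_fun true F s).2 -> ~ leads_to s t q.
  move=> fs /leads_to_short[q' /andP[iq /eqP eq] sq].
  have fl := flag_path B1 (leqW (leq_addr _ _)) S1 fs iq.
  have := flag_iter (nS M - size q') fl; rewrite -iterD subnK ?(ltnW sq) // eq.
  by rewrite -iterSr -/G nfl.
(* The bound is obtained for the value before the flagged rounds. That value is the weight of a walk
   of at most [nS] steps, so the final value dominates it. *)
move=> q lq; have [d' Ed' le'] := improvement_bound B le N lq.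
apply: le_trans le' _.
have := B t; rewrite Ed' => -[[p' [lp' sp' <-]] _]; apply: up => //.
by apply: leq_trans sp' (leq_addr _ _).
Qed.

End LongestWalks.

Lemma rounds_iter m M n (F : state M -> node) :
  rounds m (graph M) (nseq n tt) [seq F t | t <- enum 'I_(nS M)]
  = [seq iter n (round_fun m) F t | t <- enum 'I_(nS M)].
Proof.
elim: n F => //= n IH F; rewrite /rounds /= roundE -/(rounds _ _ _ _) IH.
by apply: eq_map => t; rewrite -iterS iterSr.
Qed.

Lemma solutionE x : exists F : state (inst_mdp x) -> node,
  (forall t, node_spec (inst_state x) t (F t)) /\
  solution (enc_instance x)
  = [seq (F t, dwr_block (inst_dwr x) t) | t <- enum 'I_(nS (inst_mdp x))].
Proof.
set M := inst_mdp x; set n := nS M.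
pose F0 := iter n (round_fun false) (@init_node x).
exists (iter n.+1 (round_fun true) F0); split; last first.
  rewrite /solution init_vecE states_ofE parsedE /=.
  rewrite rounds_iter roundE rounds_iter zip_map2; apply: eq_map => t.
  by rewrite -iterS iterSr.
have inv k : best (inst_state x) k (iter k (round_fun false) (@init_node x)) /\
    noflag (iter k (round_fun false) (@init_node x)).
  elim: k => [|k [B nF]] /=; first by split=> //; apply: best_init.
  by split; [apply: best_round|apply: noflag_round].
have [B nF] := inv n.
by move=> t; apply: final_spec.
Qed.

(** * The path measure of a memoryless scheduler *)

Local Open Scope classical_set_scope.
Local Open Scope ring_scope.

Section Locate.
Variables (R : realType) (X : eqType) (q : X -> R).
Hypothesis q_ge0 : forall x, 0 <= q x.

(* The points of [0, sum of q) are cut into consecutive intervals of lengths q;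
   the second component is the relative position in the interval hit. *)
Fixpoint locate (l : seq X) (u : R) : option (X * R) :=
  if l is x :: l' then
    if u < q x then Some (x, u / q x) else locate l' (u - q x)
  else None.

Fixpoint offset (l : seq X) (x : X) : R :=
  if l is y :: l' then if y == x then 0 else q y + offset l' x else 0.

Lemma offset_ge0 l x : 0 <= offset l x.
Proof. by elim: l => //= y l IH; case: ifP => // _; rewrite addr_ge0. Qed.

Lemma offset_le l x : x \in l -> offset l x + q x <= \sum_(y <- l) q y.
Proof.
elim: l => //= y l IH; rewrite inE big_cons eq_sym.
case: eqP => [-> _|_ /= xl]; last by rewrite -addrA lerD2l IH.
by rewrite add0r lerDl sumr_ge0.
Qed.

Lemma locate_mem l u y v : locate l u = Some (y, v) -> y \in l.
Proof.
elim: l u => //= x l IH u; rewrite inE; case: ifP => _; first by case=> -> _; rewrite eqxx.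
by move=> /IH ->; rewrite orbT.
Qed.

Lemma locate_some l u y v : 0 <= u -> locate l u = Some (y, v) -> 0 < q y /\ 0 <= v < 1.
Proof.
elim: l u => //= x l IH u u0; case: ltP => [ux [<- <-]|xu]; last first.
  by apply: IH; rewrite subr_ge0.
have x0 : 0 < q x by apply: le_lt_trans u0 ux.
by split=> //; rewrite divr_ge0 ?(ltW x0) //= ltr_pdivrMr ?mul1r.
Qed.

Lemma locate_none l u : 0 <= u -> locate l u = None -> \sum_(y <- l) q y <= u.
Proof.
elim: l u => [|x l IH] u u0 /=; first by rewrite big_nil.
case: ltP => // xu H; rewrite big_cons addrC -lerBrDr.
by apply: IH H; rewrite subr_ge0.
Qed.

(** Hitting [x] with a relative position in [[a, b)] means lying in the copy of [[a, b)] scaled into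
    the interval of [x]. This is the induction step for the preimages of cylinders. *)
Lemma locate_interval l x a b u : uniq l -> x \in l -> 0 <= a -> b <= 1 -> 0 <= u ->
  (if locate l u is Some (y, v) then (y == x) && (a <= v < b) else false)
  = (offset l x + q x * a <= u < offset l x + q x * b).
Proof.
move=> + + a0 b1; elim: l u => //= y l IH u /andP[yl ul]; rewrite inE eq_sym => xl u0.
case: ltP => [uy|yu].
  have y0 : 0 < q y by apply: le_lt_trans u0 uy.
  case: eqP => [<-|_] /=.
    by rewrite !add0r ler_pdivlMr // ltr_pdivrMr // mulrC [b * _]mulrC.
  apply/esym/negbTE; rewrite negb_and -ltNge; apply/orP; left.
  apply: lt_le_trans uy _; rewrite -addrA lerDl.
  by rewrite addr_ge0 ?offset_ge0 // mulr_ge0.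
case: eqP xl => [<- _|_ /= xl].
  (* Here [u] lies beyond the interval of [x]. By uniqueness [x] does not occur again, and the right
     end is not exceeded because [b <= 1], so both sides are false. *)
  rewrite !add0r; apply/idP/idP => [|/andP[_ lt]].
    by case E: locate => [[z v]|] //= /andP[/eqP zy _]; rewrite -zy (locate_mem E) in yl.
  suff : u < u by rewrite ltxx.
  by apply: lt_le_trans lt _; apply: le_trans yu; rewrite -[leRHS]mulr1 ler_wpM2l.
by rewrite IH ?subr_ge0 // lerBrDl ltrBlDl !addrA.
Qed.
End Locate.

(** * Paths drawn from a point of the unit interval *)

Section Draw.
Variables (R : realType) (M : mdp).
Notation step := (action M * state M)%type.

Definition uniform_choice (v : state M) (a : action M) : R :=
  if enabled v a then (#|[pred a | enabled v a]|%:R)^-1 else 0.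

Lemma uniform_choice_ge0 (v : state M) a : 0 <= uniform_choice v a.
Proof. by rewrite /uniform_choice; case: ifP => // _; rewrite invr_ge0. Qed.

Lemma card_enabled_gt0 (v : state M) : ~~ trap v -> (0 < #|[pred a | enabled v a]|)%N.
Proof. by rewrite negb_forall => /existsP[a]; rewrite negbK => ea; apply/card_gt0P; exists a. Qed.

Lemma sum_uniform_choice (v : state M) : ~~ trap v -> \sum_a uniform_choice v a = 1.
Proof.
move=> /card_enabled_gt0 e0; rewrite /uniform_choice -big_mkcond /= sumr_const.
by rewrite -[LHS]mulr_natr mulVf // pnatr_eq0 -lt0n.
Qed.

Definition uniform_scheduler : scheduler M R.
Proof.
exists (fun s p a => uniform_choice (path_last s p) a).
- by move=> s p a _ _; apply: uniform_choice_ge0.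
- by move=> s p _; apply: sum_uniform_choice.
- by move=> s p a _ _; rewrite /uniform_choice; case: ifP; rewrite ?ltxx.
Defined.

Definition step_prob (v : state M) (x : step) : R :=
  uniform_choice v x.1 * ratr (trans v x.1 x.2).

Lemma step_prob_ge0 (v : state M) x : 0 <= step_prob v x.
Proof. by rewrite mulr_ge0 ?uniform_choice_ge0 // ler0q trans_ge0. Qed.

Lemma enabled_trans (v : state M) a t : 0 < trans v a t -> enabled v a.
Proof.
move=> pos; rewrite /enabled; case: (trans_sum v a) => [/eqP|/eqP] //.
rewrite psumr_eq0; last by move=> i _; apply: trans_ge0.
by move=> /allP /(_ t); rewrite mem_index_enum => /(_ isT) /eqP E; rewrite E ltxx in pos.
Qed.

Lemma step_prob_gt0 (v : state M) a t : (0 < step_prob v (a, t)) = (0 < trans v a t).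
Proof.
apply/idP/idP => [|pos].
  rewrite lt_def step_prob_ge0 andbT mulf_eq0 negb_or => /andP[_ /=].
  by rewrite fmorph_eq0 lt_def trans_ge0 andbT.
have ea := enabled_trans pos.
rewrite mulr_gt0 ?ltr0q // /uniform_choice /= ea invr_gt0 ltr0n.
by apply/card_gt0P; exists a.
Qed.

Lemma sum_step_prob (v : state M) : ~~ trap v -> \sum_x step_prob v x = 1.
Proof.
move=> nt; rewrite -(sum_uniform_choice nt).
rewrite -(pair_bigA _ (fun a t => step_prob v (a, t))) /=.
apply: eq_bigr => a _; rewrite /step_prob /= -mulr_sumr /uniform_choice.
case: ifP => [/eqP E|_]; last by rewrite mul0r.
by rewrite -rmorph_sum E rmorph1 mulr1.
Qed.

Lemma sum_step_prob_le1 (v : state M) : \sum_x step_prob v x <= 1.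
Proof.
case: (boolP (trap v)) => [/forallP tv|/sum_step_prob -> //].
rewrite big1 ?ler01 // => -[a t] _.
by rewrite /step_prob /uniform_choice (negPf (tv a)) mul0r.
Qed.

Notation steps := (index_enum (action M * state M)%type).

(** A single number supplies all random choices: its relative position in the interval that is hit
    becomes the number for the remaining steps. In a trap all lengths are 0 and nothing is hit. *)
Definition walk_step (c : state M * R) : option (step * R) :=
  locate (step_prob c.1) steps c.2.

Fixpoint walk (c : state M * R) (k : nat) : state M * R :=
  if k is k'.+1 then
    if walk_step (walk c k') is Some (x, v) then (x.2, v) else walk c k'
  else c.

Definition walk_steps (c : state M * R) (k : nat) : option step :=
  omap fst (walk_step (walk c k)).

Lemma walkS c x v k : walk_step c = Some (x, v) -> walk c k.+1 = walk (x.2, v) k.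
Proof. by move=> E; elim: k => [|k IH] /=; [rewrite E|rewrite -IH]. Qed.

Lemma walk_unit c k : 0 <= c.2 < 1 -> 0 <= (walk c k).2 < 1.
Proof.
move=> c01; elim: k => //= k IH; case E: walk_step => [[x v]|] //=.
by have [] := locate_some (proj1 (andP IH)) E.
Qed.

Lemma walk_maxpath (s : state M) (u : R) : 0 <= u < 1 -> is_maxpath s (walk_steps (s, u)).
Proof.
move=> u01 k.
have -> : state_at s (walk_steps (s, u)) k = (walk (s, u) k).1.
  elim: k => //= k ->; rewrite /walk_steps.
  by case: walk_step => [[[a t] v]|].
have /andP[k0 k1] := walk_unit k (c := (s, u)) u01.
rewrite /walk_steps /walk_step; case E: locate => [[[a t] v]|] /=.
  by have [] := locate_some k0 E; rewrite step_prob_gt0.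
(* If no interval is hit, the position is at least the sum of the step probabilities. Outside traps
   this sum is 1, but positions stay below 1. *)
apply: contraTT k1 => nt; rewrite -leNgt -(sum_step_prob nt).
exact: locate_none k0 E.
Qed.

(** The numbers whose path starts with [p] form one interval; the interval of the later steps is
    scaled and nested in that of the first step. *)
Fixpoint interval_start (v : state M) (p : seq step) : R :=
  if p is x :: p' then
    offset (step_prob v) steps x + step_prob v x * interval_start x.2 p'
  else 0.

Fixpoint interval_width (v : state M) (p : seq step) : R :=
  if p is x :: p' then step_prob v x * interval_width x.2 p' else 1.

Lemma interval_width_ge0 (v : state M) p : 0 <= interval_width v p.
Proof. by elim: p v => //= x p IH v; rewrite mulr_ge0 ?step_prob_ge0. Qed.

Lemma interval_start_ge0 (v : state M) p : 0 <= interval_start v p.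
Proof.
elim: p v => //= x p IH v.
apply: addr_ge0; last by rewrite mulr_ge0 ?step_prob_ge0.
by apply: offset_ge0 => y; apply: step_prob_ge0.
Qed.

Lemma interval_end_le1 (v : state M) p : interval_start v p + interval_width v p <= 1.
Proof.
elim: p v => /= [|x p IH] v; first by rewrite add0r.
rewrite -addrA -mulrDr; apply: le_trans (sum_step_prob_le1 v).
apply: le_trans (offset_le (step_prob_ge0 v) (mem_index_enum x)).
by rewrite lerD2l -[leRHS]mulr1 ler_wpM2l ?step_prob_ge0.
Qed.

Lemma walk_prefix (v : state M) (u : R) p : 0 <= u < 1 ->
  (mkseq (walk_steps (v, u)) (size p) = map Some p) <->
  interval_start v p <= u < interval_start v p + interval_width v p.
Proof.
elim: p v u => [|x p IH] v u u01 /=; first by rewrite add0r u01.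
rewrite -addrA -mulrDr -locate_interval ?index_enum_uniq ?mem_index_enum
  ?interval_start_ge0 ?interval_end_le1 //; [|exact: step_prob_ge0|by case/andP: u01].
rewrite /mkseq /= -[1%N]addn0 iotaDl -map_comp.
rewrite /walk_steps /= {1}/walk_step /=.
case E: locate => [[y w]|] //=.
have /andP[u0 _] := u01.
have [_ w01] := locate_some u0 E.
have E1 : walk_step (v, u) = Some (y, w) by [].
rewrite (eq_map (g := walk_steps (y.2, w))); last first.
  move=> i. by rewrite /walk_steps -(walkS _ E1).
rewrite -/(mkseq _ _); case: eqP => [<-|ne] /=.
  by split=> [[H]|H]; [apply/(IH _ _ w01)|congr cons; apply/(IH _ _ w01)].
by split=> // -[].
Qed.

(** The path must be defined on the whole real line; points outside [[0, 1)], which the uniform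
    distribution ignores, are sent to the path of 0. *)
Definition clamp (u : R) : R := if 0 <= u < 1 then u else 0.

Lemma clamp_unit u : 0 <= clamp u < 1.
Proof. by rewrite /clamp; case: ifP => //; rewrite lexx ltr01. Qed.

Definition draw (s : state M) (u : measurableTypeR R) : path_space s :=
  MaxPath (walk_maxpath s (clamp_unit u)).

Lemma draw_cylinder (s : state M) p :
  draw s @^-1` (cylinder p) `&` `[0, 1[ =
  `[interval_start s p, interval_start s p + interval_width s p[%classic.
Proof.
apply/seteqP; split => u /=; rewrite /cylinder /prefix_of /= !in_itv /=.
  by move=> [H u01]; move: H; rewrite /clamp u01 => /(walk_prefix _ _ u01).
move=> H; have u01 : 0 <= u < 1.
  case/andP: H => l1 l2; apply/andP; split.
    exact: le_trans (interval_start_ge0 _ _) l1.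
  exact: lt_le_trans l2 (interval_end_le1 _ _).
by split=> //; rewrite /clamp u01; apply/walk_prefix.
Qed.

Lemma measurable_draw (s : state M) : measurable_fun [set: measurableTypeR R] (draw s).
Proof.
eapply (@measurability _ _ (measurableTypeR R) (path_space s) setT (draw s) (@cylinders M s)) => // _ [_ [p /= _ <-] <-].
rewrite setTI -(setIT (_ @^-1` _)) -(setUv (`[0, 1[ : set (measurableTypeR R))) setIUr.
apply: measurableU; first by rewrite draw_cylinder; apply: measurable_itv.
(* Outside the unit interval [draw] is constant, so that part of the preimage is either everything
   or empty, according to the path of 0. *)
have [H|H] := pselect (prefix_of p (draw s 0)).
  suff -> : draw s @^-1` cylinder p `&` ~` `[0, 1[ = ~` `[0, 1[ by apply: measurableC.
  apply/seteqP; split => u /=; first by case.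
  rewrite in_itv /= => /negP/negbTE nu; split; last by rewrite nu.
  by move: H; rewrite /cylinder /prefix_of /= /clamp nu lexx ltr01.
suff -> : draw s @^-1` cylinder p `&` ~` `[0, 1[ = set0 by [].
apply/seteqP; split => u //=; rewrite in_itv /= => -[H2 /negP/negbTE nu]; apply: H.
by move: H2; rewrite /cylinder /prefix_of /= /clamp nu lexx ltr01.
Qed.

HB.instance Definition _ (s : state M) :=
  isMeasurableFun.Build _ _ _ _ (draw s) (@measurable_draw s).

Definition path_measure (s : state M) : probability (path_space s) R :=
  distribution (uniform_prob (@ltr01 R)) (draw s).

Lemma uniform_prob_itv (a b : R) : 0 <= a -> 0 <= b -> a + b <= 1 ->
  uniform_prob (@ltr01 R) `[a, a + b[ = b%:E.
Proof.
move=> a0 b0 ab; rewrite /uniform_prob (eq_integral (fun=> 1%:E)); last first.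
  move=> x; rewrite inE /= in_itv /= => /andP[l1 l2]; rewrite /uniform_pdf.
  by rewrite (le_trans a0 l1) (ltW (lt_le_trans l2 ab)) subr0 invr1.
rewrite integral_cst //= mul1e lebesgue_measure_itv /= lte_fin ltrDl.
case: ltP => [_|b0']; first by rewrite -EFinD addrAC subrr add0r.
by congr EFin; apply/eqP; rewrite eq_le b0 b0'.
Qed.

Lemma measurable_cylinder (s : state M) p : is_path s p ->
  measurable (cylinder p : set (path_space s)).
Proof. by move=> sp; apply: sub_sigma_algebra; exists p. Qed.

Lemma path_measure_cylinder (s : state M) p : is_path s p ->
  path_measure s (cylinder p : set (path_space s)) = (interval_width s p)%:E.
Proof.
move=> sp; rewrite /path_measure /distribution /pushforward /=.
pose P : probability (measurableTypeR R) R := uniform_prob (@ltr01 R); set I := `[0, 1[%classic : set (measurableTypeR R).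
have mc : measurable (draw s @^-1` cylinder p).
  by rewrite -[X in measurable X]setTI; apply: measurable_draw => //; apply: measurable_cylinder.
have mI : measurable I by apply: measurable_itv.
(* The part outside [I] is null because [I] has mass 1, and the part inside is the interval already
   computed. *)
transitivity (P (draw s @^-1` cylinder p `\` I) + P (draw s @^-1` cylinder p `&` I))%E.
  exact: measureDI.
have -> : P (draw s @^-1` cylinder p `&` I) = (interval_width s p)%:E.
  by rewrite draw_cylinder; apply: uniform_prob_itv;
     rewrite ?interval_start_ge0 ?interval_width_ge0 ?interval_end_le1.
suff -> : P (draw s @^-1` cylinder p `\` I) = 0%E by rewrite add0e.
have PI : P I = 1%E.
  by have := @uniform_prob_itv 0 1 (lexx _) ler01; rewrite add0r; apply.
apply/eqP; rewrite eq_le measure_ge0 andbT.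
have <- : P (~` I) = 0%E by rewrite probability_setC // PI subee.
by apply: le_measure; rewrite ?inE; [apply: measurableD|apply: measurableC|move=> u []].
Qed.

Lemma path_prob_width (s : state M) h p :
  path_prob uniform_scheduler s h p = interval_width (path_last s h) p.
Proof.
elim: p h => //= -[a t] p IH h; rewrite IH /step_prob /=; congr (_ * interval_width _ _).
by rewrite /path_last map_rcons last_rcons.
Qed.

Lemma uniform_scheduler_measure (s : state M) :
  is_scheduler_measure uniform_scheduler (path_measure s).
Proof. by move=> p sp; rewrite path_measure_cylinder // path_prob_width. Qed.

Lemma interval_width_gt0 (s : state M) p : is_path s p -> 0 < interval_width s p.
Proof.
elim: p s => //= -[a t] p IH s /andP[pos sp].
by rewrite mulr_gt0 ?step_prob_gt0 ?IH.
Qed.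
End Draw.

(** * Measurability of the property and reduction to finite paths *)

Lemma is_path_rcons (M : mdp) (s : state M) p a t :
  is_path s (rcons p (a, t)) = is_path s p && (0 < trans (path_last s p) a t).
Proof. by elim: p s => //= [s|[b v] p IH s]; rewrite ?andbT // IH andbA. Qed.

Lemma path_last_rcons (M : mdp) (s : state M) p a t : path_last s (rcons p (a, t)) = t.
Proof. by rewrite /path_last map_rcons last_rcons. Qed.

(** The generating cylinders are those of genuine paths. Every prefix of a maximal path is one, so
    [sat] is a union of generators. *)
Lemma prefix_is_path (M : mdp) (s : state M) (w : maxpath s) p :
  prefix_of p w -> is_path s p /\ path_last s p = state_at s w (size p).
Proof.
elim/last_ind: p => // p [a t] IH.
rewrite /prefix_of size_rcons map_rcons mkseqS => /rcons_inj[/IH[sp E1] E2].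
rewrite is_path_rcons path_last_rcons sp /= E2; split=> //.
by have := maxpathP w (size p); rewrite E2 E1.
Qed.

Lemma measurable_sat (M : mdp) (s : state M) (phi : dwr M) :
  measurable (sat phi (s := s) : set (path_space s)).
Proof.
have -> : sat phi (s := s) = \bigcup_(p in [set p | [/\ is_path s p,
   path_last s p \in targets phi & Defs.meets (path_wgt s p) (threshold phi (path_last s p))]])
   (cylinder p : set (path_space s)).
  apply/seteqP; split => w /=.
    by move=> [p [pw tp mp]]; exists p => //=; split=> //; have [] := prefix_is_path pw.
  by move=> [p [sp tp mp] pw]; exists p.
rewrite bigcup_mkcond; apply: countable_bigcupT_measurable; [exact: countableP|move=> p].
by case: ifP => // /set_mem[sp _ _]; apply: measurable_cylinder.
Qed.

Lemma exists_posE (R : realType) (M : mdp) (s : state M) (phi : dwr M) :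
  exists_pos R s phi <-> exists p, [/\ is_path s p, path_last s p \in targets phi
    & Defs.meets (path_wgt s p) (threshold phi (path_last s p))].
Proof.
split=> [[S [mu [_ pos]]]|[p [sp tp mp]]].
  have [w [p [pw tp mp]]] : sat phi (s := s) !=set0.
    (* Positive measure is used only to exclude the empty set. *)
    by apply/set0P; apply: contraTneq pos => ->; rewrite measure0 ltxx.
  by exists p; split=> //; have [] := prefix_is_path pw.
exists (uniform_scheduler R M), (path_measure R s); split.
  exact: uniform_scheduler_measure.
apply: (@lt_le_trans _ _ (path_measure R s (cylinder p : set (path_space s)))).
  by rewrite path_measure_cylinder // lte_fin interval_width_gt0.
apply: le_measure; rewrite ?inE; [exact: measurable_cylinder|exact: measurable_sat|].
by move=> w pw; exists p.
Qed.

Local Close Scope ring_scope.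
Local Close Scope classical_set_scope.
Local Open Scope nat_scope.

(** * Tests on nodes against existence of walks *)

Section Verdict.
Variables (M : mdp) (s0 : state M) (phi : dwr M).
Implicit Types (t : state M) (x : node).

Lemma node_spec_some t x p : node_spec s0 t x -> leads_to s0 t p -> exists d, x.1 = Some d.
Proof.
rewrite /node_spec; case: x.1 => [d|] H lp; first by exists d.
by have := H p; rewrite lp.
Qed.

Lemma node_spec_threshold t x d (k : int) : node_spec s0 t x -> x.1 = Some d ->
  (x.2 || (k <= nval d)%R) <-> exists2 p, leads_to s0 t p & (k <= path_wgt s0 p)%R.
Proof.
rewrite /node_spec => + E; rewrite E; case: x.2 => [U|[[p lp wp] up]] /=.
  by split=> // _; apply: U.
by split=> [le|[q lq le]]; [exists p; rewrite ?wp|apply: le_trans le (up q lq)].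
Qed.

Lemma accepting_spec t x : node_spec s0 t x ->
  accepting (x, dwr_block phi t) <->
  exists p, [/\ leads_to s0 t p, t \in targets phi
              & Defs.meets (path_wgt s0 p) (threshold phi t)].
Proof.
move=> S; rewrite /accepting /dwr_block /=; split.
  case Ed: x.1 => [d|] //; case: ifP => // _; case: (threshold phi t) => [k|] /=.
    rewrite nleE nval_num_of => /(node_spec_threshold k S Ed)[p lp le].
    by exists p.
  move=> _; suff [p lp] : exists p, leads_to s0 t p by exists p.
  move: S; rewrite /node_spec Ed; case: x.2 => [/(_ 0%R)[p lp _]|[[p lp _] _]]; by exists p.
move=> [p [lp tT mp]]; have [d Ed] := node_spec_some S lp; rewrite Ed tT.
case: (threshold phi t) mp => [k|] //= le; rewrite nleE nval_num_of.
by apply/(node_spec_threshold k S Ed); exists p.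
Qed.

Lemma star_spec t x : node_spec s0 t x ->
  star (x, dwr_block phi t) <-> (exists p, leads_to s0 t p) /\ t \in Tstar phi.
Proof.
move=> S; rewrite /star /dwr_block /= /Tstar inE; split.
  case Ed: x.1 => [d|] //; case: ifP => // _; case: (threshold phi t) => [k|] //= _.
  split=> //; move: S; rewrite /node_spec Ed.
  by case: x.2 => [/(_ 0%R)[p lp _]|[[p lp _] _]]; exists p.
move=> [[p lp] /andP[tT /eqP E]]; have [d Ed] := node_spec_some S lp.
by rewrite Ed tT E.
Qed.

End Verdict.

Lemma decideE (R : realType) (x : dwr_instance) :
  decide (enc_instance x) = enc_bool `[< DWR_exists_pos R x >].
Proof.
have [F [S E]] := solutionE x; rewrite /decide /enc_bool E; congr [:: Some _].
rewrite has_map; apply/idP/asboolP.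
  move=> /hasP[t _ /(accepting_spec _ (S t))[p [/andP[ip /eqP ep] tT mp]]].
  by apply/exists_posE; exists p; rewrite ep.
move=> /exists_posE[p [ip tT mp]]; apply/hasP.
exists (path_last (inst_state x) p); first by rewrite mem_enum.
by apply/(accepting_spec _ (S _)); exists p; split=> //; rewrite /leads_to ip eqxx.
Qed.

(** * Suprema of sets of integers *)

Section Supremum.
Local Open Scope classical_set_scope.
Implicit Type A : set int.

(** [supremum] chooses some least upper bound, and antisymmetry makes it unique; the member [k0]
    rules out the default for the empty set. *)
Lemma supremum_int_eq A (s : \bar int) k0 : A k0 ->
  (forall k, A k -> (k%:E <= s)%E) ->
  (forall y, (forall k, A k -> (k%:E <= y)%E) -> (s <= y)%E) ->
  supremum -oo%E [set k%:E | k in A] = s.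
Proof.
move=> Ak0 ub lub; rewrite /supremum ifF; last first.
  by apply/negbTE/set0P; exists k0%:E; exists k0.
apply: xget_unique.
  by split=> [_ [k Ak <-]|y uy]; [apply: ub|apply: lub => k Ak; apply: uy; exists k].
move=> y [uy ly]; apply/eqP; rewrite eq_le; apply/andP; split.
  by apply: ly => _ [k Ak <-]; apply: ub.
by apply: lub => k Ak; apply: uy; exists k.
Qed.

Lemma supremum_int_all A : (forall k, A k) -> supremum -oo%E [set k%:E | k in A] = +oo%E.
Proof.
move=> H; apply: (supremum_int_eq (H 0%R)) => [k _|y uy]; first exact: leey.
(* A finite bound [r] fails at [r + 1], and [-oo] fails at any member. *)
case: y uy => [r| |] // uy.
  by have := uy (r + 1)%R (H _); rewrite lee_fin; lia.
by have := uy 0%R (H _).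
Qed.

Lemma supremum_int_max A m : A m -> (forall k, A k -> (k <= m)%R) ->
  supremum -oo%E [set k%:E | k in A] = m%:E.
Proof.
by move=> Am H; apply: (supremum_int_eq Am) => [k /H|y]; [rewrite lee_fin|apply].
Qed.

End Supremum.

(** The printed bits are a trimmed difference, hence the canonical bits of the absolute value; the
    comparison of the components decides the sign bit. *)
Lemma show_num (x : node) d : x.1 = Some d -> x.2 = false -> show x = enc_int (nval d).
Proof.
rewrite /show => -> ->; rewrite /enc_int /block -cats1 /int_bits bleE /nval.
congr ([seq Some b | b <- _] ++ _); case: leqP => le.
  rewrite /bsub trim_bits -bval_trim -/(bsub _ _) bval_bsub //.
  congr (_ :: nat_bits _); lia.
rewrite /bsub trim_bits -bval_trim -/(bsub _ _) bval_bsub ?(ltnW le) //.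
congr (_ :: nat_bits _); lia.
Qed.

(** * The value algorithm computes the supremum *)

Section Value.
Variable x : goal_instance.
Notation M := (inst_mdp x).
Notation phi := (inst_dwr x).
Notation s0 := (inst_state x).
Notation g := (goal x).

Lemma mem_goal t : (t \in targets phi) && (threshold phi t != None) = (t == g).
Proof.
have /setP/(_ t) := goalP x; rewrite !inE.
by case: (t \in targets phi); rewrite ?andbF ?andbT //= => <-.
Qed.

Lemma goal_block t : head false (dwr_block phi t) = (t == g).
Proof.
rewrite -mem_goal /dwr_block; case: (t \in targets phi) => //=.
by case: (threshold phi t).
Qed.

Lemma goal_nodeE (F : state M -> node) :
  goal_node [seq (F t, dwr_block phi t) | t <- enum 'I_(nS M)] = F g.
Proof.
rewrite /goal_node.
have H l : foldr (fun p s => if head false p.2 then p.1 :: s else s) [::]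
    [seq (F t, dwr_block phi t) | t <- l] = [seq F t | t <- l & t == g].
  by elim: l => //= t l ->; rewrite goal_block; case: ifP.
rewrite H (_ : [seq t <- enum 'I_(nS M) | t == g] = [:: g]) //.
by apply: filter_pred1_uniq; rewrite ?enum_uniq ?mem_enum.
Qed.

(** All targets other than the goal lie in [Tstar], so for them reachability suffices, whatever [k]
    is; only walks to the goal are compared with [k]. *)
Lemma exists_pos_threshold (R : realType) k :
  exists_pos R s0 (set_threshold phi g k) <->
  (exists t p, leads_to s0 t p /\ t \in Tstar phi) \/
  (exists2 p, leads_to s0 g p & (k <= path_wgt s0 p)%R).
Proof.
have gT : (g \in targets phi) && (threshold phi g != None) by rewrite mem_goal eqxx.
split=> [/exists_posE[p [ip tT]]|H]; last apply/exists_posE.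
  rewrite /= in tT *; case: eqP => [ep le|/eqP ng mp].
    by right; exists p => //; rewrite /leads_to ip ep eqxx.
  left; exists (path_last s0 p), p; split; first by rewrite /leads_to ip eqxx.
  have := mem_goal (path_last s0 p); rewrite tT (negPf ng) /= => /negbFE E.
  by rewrite inE tT.
case: H => [[t [p [/andP[ip /eqP ep]]]]|[p /andP[ip /eqP ep] le]].
  rewrite inE => /andP[tT /eqP tN]; exists p; rewrite ep; split=> //=.
  case: eqP => [tg|_]; last by rewrite tN.
  by move: gT; rewrite -tg tN andbF.
by exists p; rewrite ep /= eqxx; split=> //; case/andP: gT.
Qed.

Lemma valueE (R : realType) : value (enc_goal_instance x) = enc_extint (K_value R x).
Proof.
have [F [S E]] := solutionE x; rewrite /value /enc_goal_instance E goal_nodeE has_map.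
rewrite /K_value /K_exists_pos.
case: ifP => [/hasP[t _ /(star_spec _ (S t))[[p lp] tT]]|/negbT nstar].
  rewrite supremum_int_all // => k /=; apply/exists_pos_threshold.
  by left; exists t, p.
have noT t p : leads_to s0 t p -> t \notin Tstar phi.
  move=> lp; apply: contra nstar => tT; apply/hasP; exists t; first by rewrite mem_enum.
  by apply/(star_spec _ (S t)); split=> //; exists p.
have posE k : exists_pos R s0 (set_threshold phi g k) <->
    exists2 p, leads_to s0 g p & (k <= path_wgt s0 p)%R.
  rewrite exists_pos_threshold; split=> [[[t [p [lp tT]]]|//]|]; last by right.
  by have := noT _ _ lp; rewrite tT.
have := S g; rewrite /node_spec; case Ed: (F g).1 => [d|]; last first.
  (* The goal is unreachable, so the set of thresholds is empty and its supremum is the default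
     [-oo]. *)
  move=> N; rewrite /show Ed (_ : [set k : int | _]%classic = set0); last first.
    by apply/seteqP; split=> k //= /posE[p lp _]; have := N p; rewrite lp.
  by rewrite image_set0 supremum0.
case: ifP => [fl U|fl [[p lp wp] up]].
  rewrite /show Ed fl supremum_int_all // => k /=; apply/posE; exact: U.
rewrite (show_num Ed fl) (@supremum_int_max _ (nval d)) //=.
  by apply/posE; exists p; rewrite ?wp.
by move=> k /posE[q lq le]; apply: le_trans le (up q lq).
Qed.

End Value.

Theorem theoremD1 (R : realType) :
  in_P enc_instance (DWR_exists_pos R) /\
  polytime enc_goal_instance enc_extint (K_value R).
Proof.
split.
  apply: (polytime_of_ptime ptime_decide) => x; exact: decideE.
by apply: (polytime_of_ptime ptime_value) => x; apply: valueE.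
Qed.
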